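(* Let $0<\varepsilon\le1$ and let $\hat a$ be an admissible cutoff function (of type (a), (b) or (c)) satisfying $$\|\hat a^{(k)}\|_\infty\le\tilde c(\tilde c/\varepsilon)^kk^k(\ln k)^{k(1+\varepsilon)}\ (k\ge3),\qquad\|\hat a^{(k)}\|_\infty\le\tilde c(\tilde c/\varepsilon)^kk^k\ (k=1,2).$$ Then for every integer $n\ge1$ the kernel $L_n^\kappa(x,y)=\sum_{j=0}^\infty\hat a(j/n)P_j(w_\kappa;x,y)$ satisfies, for $x,y\in T^d$, $$|L_n^\kappa(x,y)|\le\frac{c\,n^d}{\sqrt{W_\kappa(n;x)}\sqrt{W_\kappa(n;y)}}\exp\Big\{-\frac{c^\diamond n\rho(x,y)}{[\ln(e+n\rho(x,y))]^{1+\varepsilon}}\Big\},$$ where $c^\diamond=c'\varepsilon$ with $c'>0$ an absolute constant and $c$ depends only on $\kappa,d,\varepsilon$. Moreover, for each integer $\ell>1$ there is an appropriate admissible cutoff function for which the estimate holds with $[\ln(e+n\rho(x,y))]^{1+\varepsilon}$ replaced by $\prod_{i=1}^{\ell}\ln_i(\exp_i(1)+n\rho(x,y))\cdot[\ln_{\ell+1}(\exp_{\ell+1}(1)+n\rho(x,y))]^{1+\varepsilon}$.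
   Context: $T^d=\{x\in\mathbb R^d:x_1,\dots,x_d\ge0,\ 1-|x|_1\ge0\}$, $|x|_1=x_1+\dots+x_d$, with weight $w_\kappa(x)=x_1^{\kappa_1-1/2}\cdots x_d^{\kappa_d-1/2}(1-|x|_1)^{\kappa_{d+1}-1/2}$, $\kappa_i\ge0$. $P_n(w_\kappa;x,y)$ is the kernel of the orthogonal projector of $L^2(T^d,w_\kappa)$ onto the space of polynomials of total degree $n$ orthogonal to all lower-degree polynomials: $(\mathrm{Proj}_nf)(x)=\int_{T^d}f(y)P_n(w_\kappa;x,y)w_\kappa(y)dy$. With $x_{d+1}:=1-|x|_1$, $y_{d+1}:=1-|y|_1$: $\rho(x,y)=\arccos\{\sqrt{x_1y_1}+\dots+\sqrt{x_{d+1}y_{d+1}}\}$ and $W_\kappa(n;x)=\prod_{i=1}^{d+1}(x_i+n^{-2})^{\kappa_i}$. Admissible cutoff functions: $\hat a\in C^\infty[0,\infty)$ of type (a): $\operatorname{supp}\hat a\subset[0,2]$, $\hat a=1$ on $[0,1]$; type (b): $\operatorname{supp}\hat a\subset[1/2,2]$; type (c): type (b) and $|\hat a(t)|^2+|\hat a(t/2)|^2=1$ on $[1,2]$. $\tilde c>1$ is a fixed absolute constant (e.g. $\tilde c=88$). $\ln_i$ is the $i$-fold iterated logarithm, $\exp_i(1)$ the $i$-fold iterated exponential at $1$. *)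

(* Defs.v *)
From HB Require Import structures.
From mathcomp Require Import all_boot all_order all_algebra.
From mathcomp Require Import all_classical all_reals all_analysis.
Set Implicit Arguments. Unset Strict Implicit. Unset Printing Implicit Defensive.
Import Order.TTheory GRing.Theory Num.Theory.
Local Open Scope ring_scope.

Section SimplexDefs.
Variable R : realType.

Definition xext (d : nat) (x : 'I_d -> R) : 'I_d.+1 -> R :=
  fun i => match unlift ord_max i with
           | Some j => x j
           | None => 1 - \sum_(j < d) x j
           end.

Definition in_simplex (d : nat) (x : 'I_d -> R) : bool :=
  [forall i, 0 <= x i] && (\sum_(i < d) x i <= 1).

Definition wk (d : nat) (kappa : 'I_d.+1 -> R) (x : 'I_d -> R) : R :=
  \prod_(i < d.+1) (xext x i) `^ (kappa i - 2^-1).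

Definition rho (d : nat) (x y : 'I_d -> R) : R :=
  acos (\sum_(i < d.+1) Num.sqrt (xext x i * xext y i)).

Definition Wk (d : nat) (kappa : 'I_d.+1 -> R) (n : nat) (x : 'I_d -> R) : R :=
  \prod_(i < d.+1) (xext x i + (n%:R ^- 2)) `^ (kappa i).

Definition extend_last (d : nat) (x : 'I_d -> R) (t : R) : 'I_d.+1 -> R :=
  fun i => match unlift ord_max i with Some j => x j | None => t end.

Fixpoint iint (d : nat) : (('I_d -> R) -> R) -> R :=
  match d return (('I_d -> R) -> R) -> R with
  | 0 => fun f => f (fun _ => 0)
  | d'.+1 => fun f =>
      iint (fun x : 'I_d' -> R =>
        Rintegral (@lebesgue_measure R) setT (fun t => f (extend_last x t)))
  end.

Definition ipw (d : nat) (kappa : 'I_d.+1 -> R) (f g : ('I_d -> R) -> R) : R :=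
  iint (fun y => if in_simplex y then f y * g y * wk kappa y else 0).

Definition is_poly_le (d n : nat) (f : ('I_d -> R) -> R) : Prop :=
  exists c : {ffun 'I_d -> 'I_n.+1} -> R, forall x,
    f x = \sum_(a : {ffun 'I_d -> 'I_n.+1} | (\sum_(i < d) (a i : nat) <= n)%N)
            c a * \prod_(i < d) x i ^+ (a i).

Definition in_Vn (d : nat) (kappa : 'I_d.+1 -> R) (n : nat)
    (f : ('I_d -> R) -> R) : Prop :=
  is_poly_le n f /\
  forall m, (m < n)%N -> forall q, is_poly_le m q -> ipw kappa f q = 0.

(* P is the kernel P_n(w_kappa; x, y) of the orthogonal projector onto V_n:
   for x in T^d, P x is in V_n and reproduces V_n:
   \int_{T^d} q(y) P(x,y) w_kappa(y) dy = q(x) for all q in V_n. *)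
Definition is_Pn_kernel (d : nat) (kappa : 'I_d.+1 -> R) (n : nat)
    (P : ('I_d -> R) -> ('I_d -> R) -> R) : Prop :=
  forall x, in_simplex x ->
    in_Vn kappa n (P x) /\
    (forall q, in_Vn kappa n q -> ipw kappa q (P x) = q x).

(* The kernel L_n^kappa(x,y) = sum_j ahat(j/n) P_j(x,y); since supp ahat is
   contained in [0,2], only the terms j <= 2n can be nonzero. *)
Definition Lkernel (d : nat) (P : nat -> ('I_d -> R) -> ('I_d -> R) -> R)
    (ahat : R -> R) (n : nat) (x y : 'I_d -> R) : R :=
  \sum_(j < (2 * n).+1) ahat (j%:R / n%:R) * P j x y.

(* Admissible cutoff functions. Every admissible ahat is constant near 0,
   so C^infty on [0,oo) amounts to C^infty on (0,oo). *)
Inductive cutoff_type := TypeA | TypeB | TypeC.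

Definition smooth_pos (f : R -> R) : Prop :=
  forall (k : nat) (t : R), 0 < t -> derivable (derive1n k f) t 1.

Definition supp_in_1half_2 (f : R -> R) : Prop :=
  forall t, 0 <= t -> (t < 2^-1) || (2 < t) -> f t = 0.

Definition admissible (ty : cutoff_type) (f : R -> R) : Prop :=
  smooth_pos f /\
  match ty with
  | TypeA => (forall t, 2 < t -> f t = 0) /\ (forall t, 0 <= t <= 1 -> f t = 1)
  | TypeB => supp_in_1half_2 f
  | TypeC => supp_in_1half_2 f /\
             (forall t, 1 <= t <= 2 -> (f t) ^+ 2 + (f (t / 2)) ^+ 2 = 1)
  end.

(* ||ahat^{(k)}||_oo <= B for the sup over [0,oo) (equivalently (0,oo)). *)
Definition deriv_sup_le (f : R -> R) (k : nat) (B : R) : Prop :=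
  forall t, 0 < t -> `| derive1n k f t | <= B.

Definition deriv_growth (ctilde eps : R) (f : R -> R) : Prop :=
  (forall k : nat, (1 <= k <= 2)%N ->
     deriv_sup_le f k (ctilde * (ctilde / eps) ^+ k * (k%:R) ^+ k)) /\
  (forall k : nat, (3 <= k)%N ->
     deriv_sup_le f k (ctilde * (ctilde / eps) ^+ k * (k%:R) ^+ k
                        * (ln (k%:R)) `^ (k%:R * (1 + eps)))).

Definition lni (i : nat) (t : R) : R := iter i (@ln R) t.
Definition expi1 (i : nat) : R := iter i (@expR R) 1.

Definition logfactor (ell : nat) (eps u : R) : R :=
  (\prod_(1 <= i < ell.+1) lni i (expi1 i + u)) *
  (lni ell.+1 (expi1 ell.+1 + u)) `^ (1 + eps).

End SimplexDefs.

(* Main.v *)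
Require Import Defs.
From mathcomp Require Import all_boot all_order all_algebra.
From mathcomp Require Import all_classical all_reals all_analysis.
From mathcomp Require Import measurable_realfun ring lra zify.
Import Order.TTheory GRing.Theory Num.Theory.
Import numFieldNormedType.Exports.
Local Open Scope classical_set_scope.
Local Open Scope ring_scope.
Set Implicit Arguments. Unset Strict Implicit. Unset Printing Implicit Defensive.

(* With th_i = kappa_i + 1/2, the moments of w_kappa are ratios of Pochhammer symbols, and the
   reproducing kernel of the polynomials of degree <= n is an explicit double sum. Writing the
   symbols 1 / (th_i)_l as moments of beta laws turns it into a product formula: the kernel at
   (x, y) is the mean, over independent t_i in [-1,1], of a one-variable kernel at s = z^2,
   z = sum_i sqrt (x_i y_i) t_i.

   In one variable, l summations by parts of G = sum_j ahat(j/n) Q_j raise the parameter of the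
   kernels by l and turn the coefficients into l-th differences; by Parseval and the Nikolskii
   inequality, (1-s)^(l/2) |G(s)| is at most C n^(2 th - 1) (12/n)^l sup |ahat^(l)| for even l.
   Multiplying the bound for the l at hand by one with a fixed large exponent gives a factor that
   can be averaged over t, which produces W_kappa, and a factor (C / (n rho))^l sup |ahat^(l)|.
   The optimal l yields the exponential.

   For the refined estimate, the cutoff is an infinite iterated mean of a ramp, over windows of
   lengths about eps / (j P(K j)) with P(x) = prod_i ln_i x * (ln_(ell+1) x)^(1+eps); their sum
   converges since eps / (x P(x)) is minus the derivative of (ln_(ell+1) x)^(-eps). For type (c)
   one takes sin (pi/2 (psi(t) - psi(2t))). *)

(** * Pochhammer symbols and the Chu-Vandermonde identity *)

(** The number l of derivatives spent grows with n rho, so every constant met on the way must be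
    independent of l or at most geometric in it. Hence Pochhammer symbols are compared by
    inequalities uniform in the raised parameter, and the sequence [H] bounding the derivatives of
    the cutoff is required to satisfy 8 (i+1) H_i <= H_(i+1): differentiating the weights 1 / (2u +
    T) of the summation by parts then costs no more than one further derivative of the cutoff. Decay
    of order l can be taken out of the mean over t, because |z| <= w = sum_i sqrt (x_i y_i) = cos
    rho for every t. The weights come from inside the mean, where a power of decay depending only on
    kappa and d is enough. The two bounds are multiplied, so what is estimated is the square of the
    kernel. If H_k <= A beta_k^k, the choice is l about half of the largest k with 144 beta_k <= n
    rho; the side condition 8 l <= n holds because rho is bounded. The exponent of the result is
    therefore the inverse function of k -> beta_k, up to a constant: beta_k about k (ln k)^(1+eps) /
    eps gives the first estimate, a slower growth the refined one. *)

Section Pochhammer.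
Variable R : realType.
Implicit Types (a b c p : R) (m n k : nat).

Definition poch a n : R := \prod_(i < n) (a + i%:R).

Lemma poch0 a : poch a 0 = 1. Proof. by rewrite /poch big_ord0. Qed.

Lemma pochS a n : poch a n.+1 = poch a n * (a + n%:R).
Proof. by rewrite /poch big_ord_recr. Qed.

Lemma pochD a m n : poch a (m + n) = poch a m * poch (a + m%:R) n.
Proof.
elim: n => [|n IH]; first by rewrite addn0 poch0 mulr1.
by rewrite addnS !pochS IH natrD mulrA addrA.
Qed.

Lemma pochSl a n : poch a n.+1 = a * poch (a + 1) n.
Proof. by rewrite -add1n pochD pochS poch0 mul1r addr0. Qed.

Lemma poch_gt0 a n : 0 < a -> 0 < poch a n.
Proof. by move=> a0; apply: prodr_gt0 => i _; rewrite ltr_wpDr. Qed.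

Lemma poch_neq0 a n : 0 < a -> poch a n != 0.
Proof. by move=> /poch_gt0 h; rewrite gt_eqF. Qed.

Lemma poch1 n : poch 1 n = n`!%:R.
Proof.
by elim: n => [|n IH]; rewrite ?poch0 // pochS IH factS mulnC natrM -natr1 addrC.
Qed.

Lemma factr_neq0 n : n`!%:R != 0 :> R.
Proof. by rewrite pnatr_eq0 -lt0n fact_gt0. Qed.

Lemma factr_gt0 n : 0 < n`!%:R :> R.
Proof. by rewrite ltr0n fact_gt0. Qed.

Lemma poch_half m : (m.*2)`!%:R = 4 ^+ m * m`!%:R * poch 2^-1 m :> R.
Proof.
elim: m => [|m IH]; first by rewrite poch0 expr0 !mulr1.
rewrite doubleS 2!factS mulnA natrM IH pochS exprS factS !natrM.
have -> : m.*2.+2%:R = 2 * m.+1%:R :> R by rewrite -natrM mul2n.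
have -> : m.*2.+1%:R = 2 * m%:R + 1 :> R by rewrite -natr1 -natrM mul2n.
by field.
Qed.

(** The divided difference at the nodes 0, ..., n, that is, the n-th forward difference at 0 over
    n!. *)
Definition fdiff (f : nat -> R) n : R :=
  \sum_(m < n.+1) (-1) ^+ (n - m) / (m`!%:R * (n - m)`!%:R) * f m.

Lemma eq_fdiff f g n : (forall m, (m <= n)%N -> f m = g m) -> fdiff f n = fdiff g n.
Proof. by move=> h; apply: eq_bigr => i _; rewrite h // -ltnS. Qed.

Lemma fdiff_mul f c n : fdiff (fun m => (m%:R + c) * f m) n =
  (if n is n'.+1 then fdiff (fun m => f m.+1) n' else 0) + c * fdiff f n.
Proof.
rewrite /fdiff mulr_sumr.
under eq_bigr do rewrite mulrDl mulrDr.
rewrite big_split /=; congr (_ + _); last by apply: eq_bigr => i _; rewrite mulrCA.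
case: n => [|n]; first by rewrite big_ord1 /= mul0r mulr0.
rewrite big_ord_recl /= mul0r mulr0 add0r; apply: eq_bigr => i _.
rewrite /bump /= add1n subSS factS natrM mulrA; congr (_ * _).
rewrite !invfM; have := factr_neq0 i; have : i.+1%:R != 0 :> R by rewrite pnatr_eq0.
have := factr_neq0 (n - i).
move: (i`!%:R : R) (i.+1%:R : R) ((n - i)`!%:R : R) => x y z hx hy hz; field.
by rewrite hx hy hz.
Qed.

(** A divided difference at n + 1 nodes reads off the coefficient of degree n. Each factor split off
    by [fdiff_mul] lowers n by one and shifts the other constants by one, so the induction runs over
    all lists. *)
Lemma fdiff_prod (s : seq R) n : (size s <= n)%N ->
  fdiff (fun m => \prod_(c <- s) (m%:R + c)) n = (size s == n)%:R.
Proof.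
move: {2}(size s) (erefl (size s)) => t; elim: t s n => [|t IH] [|c s] n //=.
  move=> _ _; case: n => [|n].
    by rewrite /fdiff big_ord1 big_nil /= subnn fact0 expr0 !mulr1 divr1.
  rewrite (@eq_fdiff _ (fun m => 1)); last by move=> m _; rewrite big_nil.
  have -> : fdiff (fun=> 1) n.+1 = n.+1`!%:R^-1 * \sum_(i < n.+2) (-1) ^+ (n.+1 - i) *+ 'C(n.+1, i).
    rewrite /fdiff mulr_sumr; apply: eq_bigr => i _.
    have h : (i <= n.+1)%N by rewrite -ltnS.
    rewrite -(bin_fact h) !natrM -[((-1) ^+ _ *+ _)]mulr_natr.
    have := factr_neq0 i; have := factr_neq0 (n.+1 - i).
    have : 'C(n.+1, i)%:R != 0 :> R by rewrite pnatr_eq0 -lt0n bin_gt0.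
    move: (i`!%:R : R) ('C(n.+1, i)%:R : R) ((n.+1 - i)`!%:R : R) => x y z hy hz hx.
    move: ((-1) ^+ _ : R) => w.
    by rewrite mulr1; field; rewrite hx hy hz.
  have := exprDn (-1 : R) 1 n.+1; rewrite addNr expr0n /=.
  under eq_bigr do rewrite expr1n mulr1.
  by move=> <-; rewrite mulr0.
move=> [hst] hs.
rewrite (@eq_fdiff _ (fun m => (m%:R + c) * \prod_(c <- s) (m%:R + c))); last first.
  by move=> m _; rewrite big_cons.
rewrite fdiff_mul (IH _ _ hst) ?(ltnW hs) // (ltn_eqF hs) mulr0 addr0.
case: n hs => // n; rewrite ltnS eqSS => hs.
rewrite -(size_map (fun x => 1 + x) s) -IH ?size_map //; apply: eq_fdiff => m _.
by rewrite big_map; apply: eq_bigr => i _; rewrite addrA natr1.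
Qed.

(** Induction on n for all b and c at once: Pascal's rule splits the sum into the case (b, c) and -
    b / c times the case (b + 1, c + 1), and c - b is the same in both. *)
Lemma chu_vandermonde b c n : (forall i, c + i%:R != 0) ->
  \sum_(m < n.+1) (-1) ^+ m * 'C(n, m)%:R * poch b m / poch c m = poch (c - b) n / poch c n.
Proof.
elim: n b c => [|n IH] b c hc.
  by rewrite big_ord1 !poch0 expr0 bin0 !mulr1.
have pc c' k : (forall i, c' + i%:R != 0) -> poch c' k != 0.
  by move=> h; apply/prodf_neq0 => i _.
have hc1 i : c + 1 + i%:R != 0 by rewrite -addrA nat1r.
have c0 : c != 0 by have := hc 0; rewrite addr0.
have IH1 := IH b c hc; have IH2 := IH (b + 1) (c + 1) hc1.
transitivity (poch (c - b) n / poch c n - b / c * (poch (c + 1 - (b + 1)) n / poch (c + 1) n)).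
  rewrite -IH1 -IH2 mulr_sumr big_ord_recl /= !poch0 expr0 bin0 !mulr1 mul1r.
  under eq_bigr => i _ do rewrite /bump /= add1n binS natrD mulrDr mulrDl mulrDl.
  rewrite big_split /= addrA -sumrN; congr (_ + _).
    rewrite [RHS]big_ord_recl /= !poch0 expr0 bin0 !mulr1 mul1r; congr (_ + _).
    rewrite big_ord_recr /= bin_small // mulr0 !mul0r addr0; apply: eq_bigr => i _.
    by rewrite /bump /= add1n.
  apply: eq_bigr => i _; rewrite !pochSl exprS.
  have := pc _ i hc1; move=> h; field.
  by rewrite h c0.
have -> : c + 1 - (b + 1) = c - b by ring.
have h1 := pc _ n hc; have h2 := pc _ n hc1; have h3 := hc n.
have : c * poch (c + 1) n = poch c n * (c + n%:R) by rewrite -pochSl pochS.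
rewrite (pochS (c - b)) (pochS c) => E.
have -> : poch (c + 1) n = poch c n * (c + n%:R) / c by rewrite -E mulrAC divff // mul1r.
by field; rewrite h1 h3 c0.
Qed.

End Pochhammer.

(** * Beta and Dirichlet integrals *)

Section OpenInterval.
Variable R : realType.
Local Notation mu := (@lebesgue_measure R).
Implicit Types (f g F : R -> R) (r : R).

Lemma div_succ3_le r m n : 0 < r -> (m <= n)%N -> r / n.+3%:R <= r / m.+3%:R.
Proof.
by move=> r0 mn; rewrite ler_pM2l // lef_pV2 ?posrE ?ltr0n // ler_nat.
Qed.

(** A compact exhaustion of ]0, r[, since the integrands may blow up at both ends. The shift by 3
    keeps r / n.+3 below r / 2, so that no interval degenerates. *)
Definition shrink r (n : nat) : set R := `[r / n.+3%:R, r - r / n.+3%:R]%classic.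

Lemma shrink_bigcup r : 0 < r -> \bigcup_n shrink r n = `]0, r[%classic.
Proof.
move=> r0; apply/seteqP; split => x /=.
- move=> [n _]; rewrite /shrink /= !in_itv /= => /andP[h1 h2].
  have h : 0 < r / n.+3%:R by rewrite divr_gt0.
  by rewrite (lt_le_trans h h1) /= (le_lt_trans h2) // ltrBlDr ltrDl.
- rewrite in_itv /= => /andP[x0 xr].
  set m := Num.min x (r - x).
  have m0 : 0 < m by rewrite lt_min x0 subr_gt0.
  have [n hn] : exists n : nat, r / m <= n%:R.
    by exists (Num.bound (r / m)); apply/ltW/archi_boundP; rewrite divr_ge0 ?ltW.
  exists n => //; rewrite /shrink /= in_itv /=.
  have h : r / n.+3%:R <= m.
    rewrite ler_pdivrMr // mulrC -ler_pdivrMr //.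
    by apply: (le_trans hn); rewrite ler_nat; do 3 apply: leqW; exact: leqnn.
  move: h; rewrite le_min => /andP[h1 h2].
  by rewrite h1 /= lerBrDl -lerBrDr.
Qed.

Lemma shrink_nd r : 0 < r -> nondecreasing_seq (shrink r).
Proof.
move=> r0 m n mn; apply/subsetPset => x; rewrite /shrink /= !in_itv /= => /andP[h1 h2].
have h := div_succ3_le r0 mn.
by rewrite (le_trans h h1) (le_trans h2) // lerB.
Qed.

Lemma shrink_sub r n x : 0 < r -> shrink r n x -> 0 < x < r.
Proof.
move=> r0 h; have : (`]0, r[%classic) x by rewrite -shrink_bigcup //; exists n.
by rewrite /= in_itv.
Qed.

Lemma shrink_lt r n : 0 < r -> r / n.+3%:R < r - r / n.+3%:R.
Proof.
move=> r0; move: (div_succ3_le r0 (leq0n n)); move: (r / n.+3%:R) => y; lra.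
Qed.

Definition ocont r f := forall x, 0 < x < r -> {for x, continuous f}.

Lemma ocont_shrink r f n : 0 < r -> ocont r f -> {within shrink r n, continuous f}.
Proof.
move=> r0 cf; apply: continuous_in_subspaceT => x; rewrite inE => h.
exact: cf (shrink_sub r0 h).
Qed.

Lemma ocont_meas r f : ocont r f -> measurable_fun `]0, r[%classic f.
Proof.
move=> cf; apply: open_continuous_measurable_fun; first exact: interval_open.
by move=> x; rewrite inE /= in_itv /= => /cf.
Qed.

Lemma shrink_cvg r f : 0 < r -> ocont r f -> (forall x, 0 < x < r -> 0 <= f x) ->
  (\int[mu]_(x in shrink r n) (f x)%:E @[n --> \oo] --> \int[mu]_(x in `]0%R, r[) (f x)%:E)%E.
Proof.
move=> r0 cf f0; rewrite -(shrink_bigcup r0).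
apply: ge0_nondecreasing_set_cvg_integral.
- exact: shrink_nd.
- by move=> i; exact: measurable_itv.
- move=> i; apply/measurable_EFinP; apply: (measurable_funS _ _ (ocont_meas cf)) => //.
  by move=> x /shrink_sub; rewrite /= in_itv /=; apply.
- by move=> i x /shrink_sub h; rewrite lee_fin f0 // h.
Qed.

Lemma shrink_ends r : 0 < r ->
  (r / n.+3%:R @[n --> \oo] --> (0 : R)^'+) /\ (r - r / n.+3%:R @[n --> \oo] --> r^'-).
Proof.
move=> r0.
have h0 e : 0 < e -> \forall n \near \oo, r / n.+3%:R < e.
  move=> e0; near=> n.
  have hn : r / e <= n%:R by near: n; exact: nbhs_infty_ger.
  rewrite ltr_pdivrMr // mulrC -ltr_pdivrMr // (le_lt_trans hn) // ltr_nat.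
  by do 2 apply: leqW; exact: leqnn.
split => A /= [e /= e0 He]; have := h0 _ e0; apply: filterS => n hn; apply: He.
- by rewrite /ball_ /= sub0r normrN gtr0_norm // divr_gt0.
- by rewrite divr_gt0.
- by rewrite /ball_ /= opprB addrC subrK gtr0_norm // divr_gt0.
- by rewrite ltrBlDr ltrDl divr_gt0.
Unshelve. all: by end_near.
Qed.

Lemma shrink_FTC r f F n : 0 < r -> ocont r f ->
  (forall x, 0 < x < r -> is_derive x 1 F (f x)) ->
  (\int[mu]_(x in shrink r n) (f x)%:E = (F (r - r / n.+3%:R))%:E - (F (r / n.+3%:R))%:E)%E.
Proof.
move=> r0 cf dF.
have sub x : r / n.+3%:R <= x <= r - r / n.+3%:R -> 0 < x < r.
  by move=> h; apply: (@shrink_sub r n) => //; rewrite /shrink /= in_itv.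
have cF x : r / n.+3%:R <= x <= r - r / n.+3%:R -> {for x, continuous F}.
  move=> /sub /dF dx; apply: differentiable_continuous.
  by apply/derivable1_diffP.
have lt := shrink_lt n r0.
apply: continuous_FTC2 => //.
- exact: ocont_shrink.
- split.
  + move=> x; rewrite in_itv /= => /andP[h1 h2].
    by have /dF : 0 < x < r by apply: sub; rewrite !ltW.
  + apply: cvg_at_right_filter; apply: cF; rewrite lexx /=; exact: ltW.
  + apply: cvg_at_left_filter; apply: cF; rewrite lexx andbT; exact: ltW.
- move=> x; rewrite in_itv /= => /andP[h1 h2].
  have /dF dx : 0 < x < r by apply: sub; rewrite !ltW.
  by rewrite derive1E; apply: derive_val.
Qed.

Lemma oint_FTC r f F : 0 < r -> ocont r f -> (forall x, 0 < x < r -> 0 <= f x) ->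
  (forall x, 0 < x < r -> is_derive x 1 F (f x)) ->
  F x @[x --> 0^'+] --> F 0 -> F x @[x --> r^'-] --> F r ->
  (\int[mu]_(x in `]0%R, r[) (f x)%:E = (F r - F 0)%:E)%E.
Proof.
move=> r0 cf f0 dF F0 Fr.
have [e0 er] := shrink_ends r0.
have H : (fun n => \int[mu]_(x in shrink r n) (f x)%:E)%E @ \oo --> (F r - F 0)%:E.
  rewrite (_ : (fun n => _) = EFin \o (fun n => F (r - r / n.+3%:R) - F (r / n.+3%:R))); last first.
    by apply/funext => n; rewrite (shrink_FTC _ r0 cf dF).
  apply: cvg_EFin; first exact: nearW.
  by apply: cvgB; [exact: cvg_comp er Fr | exact: cvg_comp e0 F0].
exact: (cvg_unique (@ereal_hausdorff R) (shrink_cvg r0 cf f0) H).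
Qed.

Lemma oint_fin_integrable r f : ocont r f -> (forall x, 0 < x < r -> 0 <= f x) ->
  (\int[mu]_(x in `]0%R, r[) (f x)%:E < +oo)%E -> mu.-integrable `]0, r[ (EFin \o f).
Proof.
move=> cf f0 fin; apply/integrableP; split.
  by apply/measurable_EFinP; exact: ocont_meas.
rewrite (_ : (\int[mu]_(x in _) _)%E = \int[mu]_(x in `]0%R, r[) (f x)%:E)%E //.
apply: eq_integral => x; rewrite inE /= in_itv /= => h.
by rewrite ger0_norm // f0.
Qed.

Lemma oint_le_integrable r f g : ocont r f -> mu.-integrable `]0, r[ (EFin \o g) ->
  (forall x, 0 < x < r -> `|f x| <= g x) -> mu.-integrable `]0, r[ (EFin \o f).
Proof.
move=> cf ig fg; apply: le_integrable ig => //.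
  by apply/measurable_EFinP; exact: ocont_meas.
move=> x; rewrite /= in_itv /= => /fg h; rewrite lee_fin.
by rewrite (le_trans h) // ler_norm.
Qed.

Lemma oint_scale r f : 0 < r -> ocont 1 f -> (forall x, 0 < x < 1 -> 0 <= f x) ->
  (\int[mu]_(x in `]0%R, r[) (f (x / r))%:E = r%:E * \int[mu]_(x in `]0%R, 1%R[) (f x)%:E)%E.
Proof.
move=> r0 cf f0.
have rI0 x : 0 < x < r -> 0 < x / r < 1.
  by move=> /andP[x0 xr]; rewrite divr_gt0 //= ltr_pdivrMr // mul1r.
have cg : ocont r (fun x => f (x / r)).
  move=> x /rI0 h.
  exact: (@cvg_comp _ _ _ (fun x => x / r) f _ _ _ (@mulrr_continuous _ r^-1 x) (cf _ h)).
have g0 x : 0 < x < r -> 0 <= f (x / r) by move=> /rI0; exact: f0.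
have H := shrink_cvg r0 cg g0.
have K := cvgeZl (erefl : r%:E \is a fin_num) (shrink_cvg ltr01 cf f0).
apply: (cvg_unique (@ereal_hausdorff R) H); apply: cvg_trans K.
rewrite (_ : (fun n => \int[mu]_(x in shrink r n) _)%E = (fun n => r%:E * \int[mu]_(x in shrink 1 n) (f x)%:E)%E) //.
apply/funext => n; have r0' : r != 0 by rewrite gt_eqF.
have -> : shrink 1 n = `[(r / n.+3%:R) / r, (r - r / n.+3%:R) / r]%classic.
  by rewrite /shrink mulrAC divff // mulrBl divff // mulrAC divff.
have dF (x : R) : is_derive x 1 (fun y => y / r) (r^-1).
  rewrite (_ : (fun y => y / r) = r^-1 \*: id); last first.
    by apply/funext => y /=; rewrite mulrC.
  by apply: is_derive_eq; rewrite /GRing.scale /= mulr1.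
have dE : derive1 (fun y : R => y / r) = cst (r^-1).
  by apply/funext => x; rewrite derive1E; apply: derive_val.
have lt := shrink_lt n r0.
have cF : continuous (fun y : R => y / r) by exact: mulrr_continuous.
rewrite (@integration_by_substitution_increasing R (fun y => y / r) f).
- rewrite dE -ge0_integralZl //.
  + by apply: eq_integral => x _; rewrite -EFinM fctE /= mulrCA mulfV // mulr1.
  + apply/measurable_EFinP; apply: measurable_funM => //.
    apply: (measurable_funS _ _ (ocont_meas cg)) => //.
    by move=> x /(shrink_sub r0); rewrite /= in_itv.
  + move=> x /(shrink_sub r0) h; rewrite lee_fin /= mulr_ge0 ?g0 //.
    by rewrite invr_ge0 ltW.
  + by rewrite lee_fin ltW.
- exact: ltW.
- by move=> x y _ _ xy; rewrite ltr_pM2r // invr_gt0.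
- by rewrite dE => x _; exact: cst_continuous.
- by rewrite dE; apply: is_cvg_cst.
- by rewrite dE; apply: is_cvg_cst.
- split => //.
  + by apply: cvg_at_right_filter; exact: cF.
  + by apply: cvg_at_left_filter; exact: cF.
- apply: continuous_in_subspaceT => x; rewrite inE /= in_itv /= => /andP[h1 h2].
  apply: cf; apply: (@shrink_sub 1 n) => //; rewrite /shrink /= in_itv /=.
  move: h1 h2; rewrite mulrAC divff // => -> /le_trans /=; apply.
  by rewrite mulrBl divff // mulrAC divff.
Qed.
End OpenInterval.

(** * The beta function: integrability, recursions and positivity *)

Section BetaIntegral.
Variable R : realType.
Local Notation mu := (@lebesgue_measure R).
Implicit Types (f g F p q : R -> R) (a b r : R).

(** The derivative p - q has no sign, while the exhaustion rests on monotone convergence; the limit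
    is therefore taken for p and q separately, and the difference is formed on the compact
    pieces. *)
Lemma oint_FTC_sub r p q F : 0 < r -> ocont r p -> ocont r q ->
  (forall x, 0 < x < r -> 0 <= p x) -> (forall x, 0 < x < r -> 0 <= q x) ->
  mu.-integrable `]0, r[ (EFin \o p) -> mu.-integrable `]0, r[ (EFin \o q) ->
  (forall x, 0 < x < r -> is_derive x 1 F (p x - q x)) ->
  F x @[x --> 0^'+] --> F 0 -> F x @[x --> r^'-] --> F r ->
  Rintegral mu `]0, r[ p - Rintegral mu `]0, r[ q = F r - F 0.
Proof.
move=> r0 cp cq p0 q0 ip iq dF F0 Fr.
have [e0 er] := shrink_ends r0.
have sub n : shrink r n `<=` `]0, r[%classic.
  by move=> x /(shrink_sub r0); rewrite /= in_itv.
have ms n : measurable (shrink r n) by exact: measurable_itv.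
have ipn n : mu.-integrable (shrink r n) (EFin \o p) by apply: integrableS ip; [exact: measurable_itv|exact: ms|exact: sub].
have iqn n : mu.-integrable (shrink r n) (EFin \o q) by apply: integrableS iq; [exact: measurable_itv|exact: ms|exact: sub].
have Hp := shrink_cvg r0 cp p0; have Hq := shrink_cvg r0 cq q0.
have fp : (\int[mu]_(x in `]0%R, r[) (p x)%:E)%E \is a fin_num.
  exact: integrable_fin_num ip.
have fq : (\int[mu]_(x in `]0%R, r[) (q x)%:E)%E \is a fin_num.
  exact: integrable_fin_num iq.
have fqN : (- \int[mu]_(x in `]0%R, r[) (q x)%:E)%E \is a fin_num by rewrite fin_numN.
have H := cvgeB (fin_num_adde_defl _ fqN) Hp Hq.
have K : ((fun n => \int[mu]_(x in shrink r n) (p x)%:E - \int[mu]_(x in shrink r n) (q x)%:E)%E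
   @ \oo --> (F r - F 0)%:E).
  rewrite (_ : (fun n => _) = EFin \o (fun n => F (r - r / n.+3%:R) - F (r / n.+3%:R))); last first.
    apply/funext => n; rewrite -(integralB_EFin _ (ipn n) (iqn n)); last exact: measurable_itv.
    rewrite (@shrink_FTC _ r (fun x => p x - q x)) //.
    by move=> x h; apply: cvgB; [exact: cp|exact: cq].
  apply: cvg_EFin; first exact: nearW.
  by apply: cvgB; [exact: cvg_comp er Fr | exact: cvg_comp e0 F0].
have E := cvg_unique (@ereal_hausdorff R) (H _) K.
by rewrite /Rintegral -fineB // E.
Qed.

Definition bden a b r : R -> R := fun t => t `^ (a - 1) * (r - t) `^ (b - 1).

Lemma powR_cont a x : 0 < x -> {for x, continuous (fun t : R => t `^ a)}.
Proof.
move=> x0; apply: differentiable_continuous; apply/derivable1_diffP.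
by apply: derivable_powR; rewrite in_itv /= x0.
Qed.

Lemma powR_rsub_cont a r x : x < r -> {for x, continuous (fun t : R => (r - t) `^ a)}.
Proof.
move=> xr; apply: (@cvg_comp _ _ _ (fun t : R => r - t) (fun t => t `^ a)); last first.
  by apply: (@powR_cont a (r - x)); rewrite subr_gt0.
by apply: cvgB; [exact: cvg_cst | exact: cvg_id].
Qed.

Lemma bden_ocont a b r : ocont r (bden a b r).
Proof.
move=> x /andP[x0 xr]; apply: cvgM; first exact: powR_cont.
exact: powR_rsub_cont.
Qed.

Lemma bden_ge0 a b r x : 0 <= bden a b r x.
Proof. by rewrite mulr_ge0 // powR_ge0. Qed.

Lemma powR_right0 a : 0 < a -> (t `^ a) @[t --> (0 : R)^'+] --> (0 : R) `^ a.
Proof. by move=> a0; rewrite powR0 ?gt_eqF //; exact: powR_cvg0. Qed.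

Lemma powR_leftr a r : 0 < a -> ((r - t) `^ a) @[t --> r^'-] --> (r - r) `^ a.
Proof.
move=> a0; rewrite subrr; apply: cvg_comp (powR_right0 a0).
move=> A /= [e /= e0 He]; exists e => // x /=.
rewrite /ball_ /= => h1 h2; apply: He => /=; last by rewrite subr_gt0.
by rewrite /ball_ /= sub0r normrN.
Qed.

Lemma is_derive_rsub_powR a r x : x < r ->
  is_derive x 1 (fun t : R => (r - t) `^ a) (- (a * (r - x) `^ (a - 1))).
Proof.
move=> xr.
have d1 : is_derive x (1 : R) (fun t : R => r - t) (- 1).
  rewrite (_ : (fun t => r - t) = cst r - id) //.
  by apply: is_derive_eq; rewrite sub0r.
have d2 : is_derive (r - x) (1 : R) (fun t : R => t `^ a) (a * (r - x) `^ (a - 1)).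
  by apply: is_derive1_powR; rewrite subr_gt0.
have := @is_derive1_comp _ (fun t => t `^ a) (fun t : R => r - t) x _ _ d2 d1.
by rewrite /GRing.scale /= ?mulN1r ?mulrN1.
Qed.

Lemma bden_int_l a r : 0 < a -> 0 < r -> mu.-integrable `]0, r[ (EFin \o (fun t => t `^ (a - 1))).
Proof.
move=> a0 r0; apply: oint_fin_integrable.
- by move=> x /andP[x0 _]; exact: powR_cont.
- by move=> x _; exact: powR_ge0.
pose F t := a^-1 * t `^ a.
rewrite (_ : (\int[mu]_(x in _) _)%E = (F r - F 0)%:E) ?ltry //.
apply: oint_FTC => //.
- by move=> x /andP[x0 _]; exact: powR_cont.
- by move=> x _; exact: powR_ge0.
- move=> x /andP[x0 _].
  have -> : x `^ (a - 1) = a^-1 *: (a * x `^ (a - 1)).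
    by rewrite /GRing.scale /= mulrA mulVf ?mul1r // gt_eqF.
  by apply: is_deriveZ; exact: is_derive1_powR.
- by apply: cvgMl_tmp; exact: powR_right0.
- by apply: cvgMl_tmp; apply: cvg_at_left_filter; exact: powR_cont.
Qed.

Lemma bden_int_r b r : 0 < b -> 0 < r -> mu.-integrable `]0, r[ (EFin \o (fun t => (r - t) `^ (b - 1))).
Proof.
move=> a0 r0; apply: oint_fin_integrable.
- by move=> x /andP[_ x0]; exact: powR_rsub_cont.
- by move=> x _; exact: powR_ge0.
pose F t := - b^-1 * (r - t) `^ b.
rewrite (_ : (\int[mu]_(x in _) _)%E = (F r - F 0)%:E) ?ltry //.
apply: oint_FTC => //.
- by move=> x /andP[_ x0]; exact: powR_rsub_cont.
- by move=> x _; exact: powR_ge0.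
- move=> x /andP[_ x0].
  have -> : (r - x) `^ (b - 1) = (- b^-1) *: - (b * (r - x) `^ (b - 1)).
    by rewrite /GRing.scale /= mulrNN mulrA mulVf ?mul1r // gt_eqF.
  by apply: is_deriveZ; exact: is_derive_rsub_powR.
- by apply: cvgMl_tmp; apply: cvg_at_right_filter; exact: powR_rsub_cont.
- by apply: cvgMl_tmp; exact: powR_leftr.
Qed.

Lemma powRD_gt0 (x u v : R) : 0 < x -> x `^ (u + v) = x `^ u * x `^ v.
Proof. by move=> x0; rewrite powRD // (gt_eqF x0) implybT. Qed.

Lemma powR_half_bound (c x : R) : 2^-1 <= x <= 1 -> x `^ c <= 1 + 2^-1 `^ c.
Proof.
move=> /andP[h1 h2]; have x0 : 0 < x by apply: lt_le_trans h1.
have [c0|c0] := leP 0 c.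
  apply: (@le_trans _ _ 1); last by rewrite lerDl powR_ge0.
  have h : x `^ c <= 1 `^ c by apply: ge0_ler_powR; rewrite ?nnegrE ?(ltW x0).
  by rewrite powR1 in h.
apply: (@le_trans _ _ (2^-1 `^ c)); last by rewrite lerDr.
rewrite -[c]opprK !(powRN _ (- c)) lef_pV2 ?posrE ?powR_gt0 //.
by apply: ge0_ler_powR; rewrite ?nnegrE ?oppr_ge0 ?(ltW c0) ?(ltW x0).
Qed.

(** On each half of the interval one of the two powers is bounded, whatever the sign of its
    exponent, and the other one is integrable. *)
Lemma bden_int1 a b : 0 < a -> 0 < b -> mu.-integrable `]0, 1[ (EFin \o bden a b 1).
Proof.
move=> a0 b0.
set K := (1 + 2^-1 `^ (b - 1)) + (1 + 2^-1 `^ (a - 1)).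
apply: (@oint_le_integrable _ 1 _ (fun t => K * t `^ (a - 1) + K * (1 - t) `^ (b - 1))).
- exact: bden_ocont.
- apply: (integrableD _ (integrableZl _ K (bden_int_l a0 ltr01)) (integrableZl _ K (bden_int_r b0 ltr01))) => //.
move=> x /andP[x0 x1]; rewrite ger0_norm ?bden_ge0 // /bden.
set u := x `^ _; set v := (1 - x) `^ _.
have u0 : 0 <= u by exact: powR_ge0.
have v0 : 0 <= v by exact: powR_ge0.
have k1 : 0 <= 2^-1 `^ (b - 1) by exact: powR_ge0.
have k2 : 0 <= 2^-1 `^ (a - 1) by exact: powR_ge0.
have [h|h] := leP x 2^-1.
- have hv : v <= 1 + 2^-1 `^ (b - 1) by apply: powR_half_bound; lra.
  rewrite mulrC ler_wpDr ?mulr_ge0 ?addr_ge0 // ler_wpM2r //.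
  by rewrite (le_trans hv) // lerDl addr_ge0.
- have hu : u <= 1 + 2^-1 `^ (a - 1) by apply: powR_half_bound; lra.
  rewrite ler_wpDl ?mulr_ge0 ?addr_ge0 // ler_wpM2r //.
  by rewrite (le_trans hu) // lerDr addr_ge0.
Qed.

Definition betaf a b : R := Rintegral mu `]0, 1[ (bden a b 1).

Lemma bden_scale a b r t : 0 < r -> 0 < t < r ->
  bden a b r t = r `^ (a + b - 2) * bden a b 1 (t / r).
Proof.
move=> r0 /andP[t0 tr]; rewrite /bden.
have -> : 1 - t / r = (r - t) / r by rewrite mulrBl divff // gt_eqF.
rewrite !powRM ?subr_ge0 ?invr_ge0 ?ltW //.
rewrite -!powR_inv1 ?ltW // -!powRrM !mulN1r.
have -> : r `^ (a + b - 2) = r `^ (a - 1) * r `^ (b - 1).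
  by rewrite -powRD_gt0 //; congr (_ `^ _); ring.
rewrite !powRN; field.
by rewrite !gt_eqF ?powR_gt0.
Qed.

Lemma bden_scaleE a b r : 0 < r -> 0 < a -> 0 < b ->
  (\int[mu]_(x in `]0%R, r[) (bden a b r x)%:E = (r `^ (a + b - 1) * betaf a b)%:E)%E.
Proof.
move=> r0 a0 b0.
transitivity (\int[mu]_(x in `]0%R, r[) ((fun t => r `^ (a + b - 2) * bden a b 1 t) (x / r))%:E)%E.
  by apply: eq_integral => x; rewrite inE /= in_itv /= => h; rewrite bden_scale.
rewrite (@oint_scale _ r (fun t => r `^ (a + b - 2) * bden a b 1 t)) //; last 2 first.
- by move=> x h; apply: cvgMl_tmp; exact: bden_ocont.
- by move=> x _; rewrite mulr_ge0 ?bden_ge0 ?powR_ge0.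
under eq_integral do rewrite EFinM.
rewrite integralZl //; last exact: bden_int1.
have -> : (\int[mu]_(x in `]0%R, 1%R[) (bden a b 1 x)%:E = (betaf a b)%:E)%E.
  by rewrite /betaf /Rintegral fineK //; exact: integrable_fin_num (bden_int1 a0 b0).
rewrite -!EFinM; congr EFin; rewrite mulrA; congr (_ * _).
rewrite -{1}(powRr1 (ltW r0)) -powRD_gt0 //.
by congr (_ `^ _); ring.
Qed.

Lemma bden_int a b r : 0 < r -> 0 < a -> 0 < b -> mu.-integrable `]0, r[ (EFin \o bden a b r).
Proof.
move=> r0 a0 b0; apply: oint_fin_integrable; first exact: bden_ocont.
- by move=> x _; exact: bden_ge0.
- by rewrite bden_scaleE // ltry.
Qed.

Lemma Rint_bden a b r : 0 < r -> 0 < a -> 0 < b ->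
  Rintegral mu `]0, r[ (bden a b r) = r `^ (a + b - 1) * betaf a b.
Proof. by move=> r0 a0 b0; rewrite /Rintegral bden_scaleE. Qed.

(** Integration by parts: t^a (1 - t)^b vanishes at both ends, and its derivative is the difference
    of the two integrands. *)
Lemma betaf_parts a b : 0 < a -> 0 < b -> a * betaf a (b + 1) = b * betaf (a + 1) b.
Proof.
move=> a0 b0; have a1 : 0 < a + 1 by rewrite addr_gt0. have b1 : 0 < b + 1 by rewrite addr_gt0.
apply/eqP; rewrite -subr_eq0; apply/eqP.
have i1 := bden_int1 a0 b1; have i2 := bden_int1 a1 b0.
rewrite -!RintegralZl //.
pose F t := t `^ a * (1 - t) `^ b.
transitivity (F 1 - F 0); last first.
  by rewrite /F subrr !powR0 ?gt_eqF // mulr0 mul0r subrr.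
apply: oint_FTC_sub => //.
- by move=> x h; apply: cvgMl_tmp; exact: bden_ocont.
- by move=> x h; apply: cvgMl_tmp; exact: bden_ocont.
- by move=> x _; rewrite mulr_ge0 ?bden_ge0 ?ltW.
- by move=> x _; rewrite mulr_ge0 ?bden_ge0 ?ltW.
- exact: (integrableZl _ a i1).
- exact: (integrableZl _ b i2).
- move=> x /andP[x0 x1].
  have d1 := is_derive1_powR a x0; have d2 := is_derive_rsub_powR b x1.
  have := @is_deriveM _ _ _ _ x 1 _ _ d1 d2.
  rewrite /bden /GRing.scale /= !addrK => d; apply: is_derive_eq d _; ring.
- apply: cvgM; first exact: powR_right0.
  by apply: cvg_at_right_filter; apply: (@powR_rsub_cont b 1 0).
- apply: cvgM; last exact: powR_leftr.
  by apply: cvg_at_left_filter; exact: powR_cont.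
Qed.

Lemma betafD a b : 0 < a -> 0 < b -> betaf a b = betaf (a + 1) b + betaf a (b + 1).
Proof.
move=> a0 b0; have a1 : 0 < a + 1 by rewrite addr_gt0. have b1 : 0 < b + 1 by rewrite addr_gt0.
rewrite -RintegralD //; [|exact: bden_int1|exact: bden_int1].
apply: eq_Rintegral => x; rewrite inE /= in_itv /= => /andP[x0 x1].
have x1' : 0 < 1 - x by rewrite subr_gt0.
rewrite /bden !addrK -(mulr_powRB1 (ltW x0) a0) -(mulr_powRB1 (ltW x1') b0).
by ring.
Qed.

Lemma betafS a b : 0 < a -> 0 < b -> betaf (a + 1) b = a / (a + b) * betaf a b.
Proof.
move=> a0 b0; rewrite (betafD a0 b0).
have -> : betaf a (b + 1) = b / a * betaf (a + 1) b.
  by rewrite mulrAC -betaf_parts // mulrAC divff ?mul1r // gt_eqF.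
by field; rewrite !gt_eqF // addr_gt0.
Qed.

Lemma betafSr a b : 0 < a -> 0 < b -> betaf a (b + 1) = b / (a + b) * betaf a b.
Proof.
move=> a0 b0; have := betaf_parts a0 b0; rewrite betafS // => h.
have a0' : a != 0 by rewrite gt_eqF.
by apply: (mulfI a0'); rewrite h; field; rewrite gt_eqF // addr_gt0.
Qed.

Lemma betaf1 a : 0 < a -> betaf a 1 = a^-1.
Proof.
move=> a0; rewrite /betaf /Rintegral.
have -> : (\int[mu]_(x in `]0%R, 1%R[) (bden a 1 1 x)%:E =
           \int[mu]_(x in `]0%R, 1%R[) (x `^ (a - 1))%:E)%E.
  by apply: eq_integral => x _; rewrite /bden subrr powRr0 mulr1.
pose F (t : R) := a^-1 * t `^ a.
rewrite (_ : (\int[mu]_(x in _) _)%E = (F 1 - F 0)%:E) /=; last first.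
  apply: oint_FTC => //.
  - by move=> x /andP[x0 _]; exact: powR_cont.
  - by move=> x _; exact: powR_ge0.
  - move=> x /andP[x0 _].
    have -> : x `^ (a - 1) = a^-1 *: (a * x `^ (a - 1)).
      by rewrite /GRing.scale /= mulrA mulVf ?mul1r // gt_eqF.
    by apply: is_deriveZ; exact: is_derive1_powR.
  - by apply: cvgMl_tmp; exact: powR_right0.
  - by apply: cvgMl_tmp; apply: cvg_at_left_filter; exact: powR_cont.
by rewrite /F powR1 powR0 ?gt_eqF // mulr1 mulr0 subr0.
Qed.

(** For an integer second parameter the recursion starting from 1 / a shows positivity; a general b
    lies below some integer, and the density decreases in b. *)
Lemma betaf_gt0 a b : 0 < a -> 0 < b -> 0 < betaf a b.
Proof.
move=> a0 b0.
have pos (n : nat) : 0 < betaf a n.+1%:R.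
  elim: n => [|n IH]; first by rewrite betaf1 // invr_gt0.
  by rewrite -[n.+2%:R]natr1 betafSr // mulr_gt0 // divr_gt0 // addr_gt0.
have [n hn] : exists n : nat, b <= n.+1%:R.
  exists (Num.bound b); apply: (le_trans (ltW (archi_boundP (ltW b0)))).
  by rewrite ler_nat leqW.
apply: (lt_le_trans (pos n)); apply: le_Rintegral => //.
- by apply: bden_int1.
- by apply: bden_int1.
- move=> x; rewrite /= in_itv /= => /andP[x0 x1].
  rewrite /bden ler_wpM2l ?powR_ge0 //; apply: ger_powR.
    by rewrite subr_gt0 x1 /= lerBlDr lerDl ltW.
  by rewrite lerB.
Qed.

End BetaIntegral.

(** * Dirichlet integrals over the simplex *)

Section Dirichlet.
Variable R : realType.
Local Notation mu := (@lebesgue_measure R).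

Lemma ord1_max (i : 'I_1) : i = ord_max.
Proof. by rewrite (ord1 i); exact: val_inj. Qed.

Lemma unlift_widen n (i : 'I_n) : unlift ord_max (widen_ord (leqnSn n) i) = Some i.
Proof.
have -> : widen_ord (leqnSn n) i = lift ord_max i by apply: val_inj; rewrite [RHS]lift_max.
by rewrite liftK.
Qed.

Lemma xext_widen d (x : 'I_d -> R) i : xext x (widen_ord (leqnSn d) i) = x i.
Proof. by rewrite /xext unlift_widen. Qed.

Lemma xext_max d (x : 'I_d -> R) : xext x ord_max = 1 - \sum_(j < d) x j.
Proof. by rewrite /xext unlift_none. Qed.

Lemma xext_sum d (x : 'I_d -> R) : \sum_i xext x i = 1.
Proof.
rewrite big_ord_recr /= xext_max.
by under eq_bigr do rewrite xext_widen; rewrite addrC subrK.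
Qed.

Lemma extend_widen d (x : 'I_d -> R) t i : extend_last x t (widen_ord (leqnSn d) i) = x i.
Proof. by rewrite /extend_last unlift_widen. Qed.

Lemma extend_max d (x : 'I_d -> R) t : extend_last x t ord_max = t.
Proof. by rewrite /extend_last unlift_none. Qed.

Lemma extend_sum d (x : 'I_d -> R) t : \sum_i extend_last x t i = \sum_i x i + t.
Proof.
rewrite big_ord_recr /= extend_max.
by under eq_bigr do rewrite extend_widen.
Qed.

Lemma forall_ord_recr d (P : 'I_d.+1 -> Prop) :
  (forall i, P i) <-> ((forall i : 'I_d, P (widen_ord (leqnSn d) i)) /\ P ord_max).
Proof.
split => [h|[h1 h2] i]; first by split => // i; exact: h.
case: (unliftP ord_max i) => [j ->|-> //].
have -> : lift ord_max j = widen_ord (leqnSn d) j by apply: val_inj; rewrite [LHS]lift_max.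
exact: h1.
Qed.

Lemma in_simplexP d (x : 'I_d -> R) : in_simplex x <-> forall i, 0 <= xext x i.
Proof.
rewrite forall_ord_recr xext_max subr_ge0 /in_simplex; split.
- by move=> /andP[/forallP h ->]; split => // i; rewrite xext_widen.
- move=> [h ->]; rewrite andbT; apply/forallP => i.
  by have := h i; rewrite xext_widen.
Qed.

Definition osimplex d (x : 'I_d -> R) := forall i, 0 < xext x i.

Definition dden d (a : 'I_d.+1 -> R) (x : 'I_d -> R) : R :=
  \prod_i (xext x i) `^ (a i - 1).

(** Integrating out the last variable over [0, r], with r the remaining barycentric coordinate,
    gives a multiple of r^(a + b - 1): the last two Dirichlet parameters fuse into their sum. *)
Definition merge_last d (a : 'I_d.+2 -> R) : 'I_d.+1 -> R :=
  extend_last (fun i => a (widen_ord (leqnSn _) (widen_ord (leqnSn _) i)))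
    (a (widen_ord (leqnSn _) ord_max) + a ord_max).

Fixpoint Dir d : ('I_d.+1 -> R) -> R :=
  match d return ('I_d.+1 -> R) -> R with
  | 0 => fun=> 1
  | d'.+1 => fun a => betaf (a (widen_ord (leqnSn _) ord_max)) (a ord_max) * Dir (merge_last a)
  end.

Lemma merge_last_gt0 d (a : 'I_d.+2 -> R) : (forall i, 0 < a i) -> forall i, 0 < merge_last a i.
Proof.
move=> a0; apply/forall_ord_recr; rewrite /merge_last extend_max; split.
  by move=> i; rewrite extend_widen.
by rewrite addr_gt0.
Qed.

Lemma Dir_gt0 d (a : 'I_d.+1 -> R) : (forall i, 0 < a i) -> 0 < Dir a.
Proof.
elim: d a => [|d IH] a a0 //=.
by rewrite mulr_gt0 ?betaf_gt0 // IH //; exact: merge_last_gt0.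
Qed.

Lemma xext_extend d (x : 'I_d -> R) t :
  (forall i : 'I_d, xext (extend_last x t) (widen_ord (leqnSn _) (widen_ord (leqnSn _) i)) = x i) /\
  xext (extend_last x t) (widen_ord (leqnSn _) ord_max) = t /\
  xext (extend_last x t) ord_max = xext x ord_max - t.
Proof.
split; last split; first by move=> i; rewrite xext_widen extend_widen.
  by rewrite xext_widen extend_max.
by rewrite !xext_max extend_sum opprD addrA.
Qed.

Lemma dden_extend d (a : 'I_d.+2 -> R) (x : 'I_d -> R) t :
  dden a (extend_last x t) =
  \prod_(i < d) (x i) `^ (a (widen_ord (leqnSn _) (widen_ord (leqnSn _) i)) - 1) *
  bden (a (widen_ord (leqnSn _) ord_max)) (a ord_max) (xext x ord_max) t.
Proof.
have [h1 [h2 h3]] := xext_extend x t.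
rewrite /dden 2!big_ord_recr /= h2 h3 /bden -mulrA; congr (_ * _).
by apply: eq_bigr => i _; rewrite h1.
Qed.

Lemma dden_merge d (a : 'I_d.+2 -> R) (x : 'I_d -> R) :
  dden (merge_last a) x =
  \prod_(i < d) (x i) `^ (a (widen_ord (leqnSn _) (widen_ord (leqnSn _) i)) - 1) *
  xext x ord_max `^ (a (widen_ord (leqnSn _) ord_max) + a ord_max - 1).
Proof.
rewrite /dden big_ord_recr /= /merge_last extend_max; congr (_ * _).
by apply: eq_bigr => i _; rewrite xext_widen extend_widen.
Qed.

Lemma Rint_setT_oo (g h : R -> R) r : 0 < r ->
  (forall t, 0 < t < r -> g t = h t) -> (forall t, ~~ (0 <= t <= r) -> g t = 0) ->
  mu.-integrable `]0, r[ (EFin \o h) ->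
  Rintegral mu setT g = Rintegral mu `]0, r[ h.
Proof.
move=> r0 gh g0 ih.
have ig : mu.-integrable `]0, r[ (EFin \o g).
  by apply: eq_integrable ih => // x; rewrite inE /= in_itv /= => hx; rewrite gh.
transitivity (Rintegral mu `[0, r] g).
  rewrite [RHS]Rintegral_mkcond; congr fine; apply: eq_integral => x _ /=.
  rewrite patchE; case: ifPn => //; rewrite notin_setE /= in_itv /= => /negP hx.
  by rewrite g0.
transitivity (Rintegral mu `]0, r[ g).
  have mg : measurable_fun `]0, r[%classic (EFin \o g) by exact: (measurable_int mu ig).
  by rewrite /Rintegral integral_itv_bndoo.
by apply: eq_Rintegral => x; rewrite inE /= in_itv /= => hx; rewrite gh.
Qed.

Lemma iint_ge0 d (f : ('I_d -> R) -> R) : (forall x, 0 <= f x) -> 0 <= iint f.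
Proof.
elim: d f => [|d IH] f f0 /=; first exact: f0.
by apply: IH => x; apply: Rintegral_ge0.
Qed.

Lemma bden_sum_int (I : Type) (s : seq I) (c al be : I -> R) r : 0 < r ->
  (forall i, 0 < al i) -> (forall i, 0 < be i) ->
  mu.-integrable `]0, r[ (EFin \o (fun t => \sum_(i <- s) c i * bden (al i) (be i) r t)) /\
  Rintegral mu `]0, r[ (fun t => \sum_(i <- s) c i * bden (al i) (be i) r t) =
  \sum_(i <- s) c i * (r `^ (al i + be i - 1) * betaf (al i) (be i)).
Proof.
move=> r0 al0 be0; elim: s => [|i s [IH1 IH2]].
  split.
    apply: (@eq_integrable _ _ _ mu `]0, r[%classic _ (cst 0%E)) => //; last exact: integrable0.
    by move=> t _; rewrite /= big_nil.
  by rewrite big_nil /Rintegral integral0_eq // => t _; rewrite big_nil.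
have ib := bden_int r0 (al0 i) (be0 i).
have i1 : mu.-integrable `]0, r[ (EFin \o (fun t => c i * bden (al i) (be i) r t)).
  exact: (integrableZl _ (c i) ib).
split.
  apply: (@eq_integrable _ _ _ mu `]0, r[%classic _ _ _ _ (integrableD _ i1 IH1)) => //.
  by move=> t _; rewrite /= big_cons.
rewrite big_cons -IH2 -Rint_bden // -RintegralZl // -RintegralD //.
by apply: eq_Rintegral => t _; rewrite big_cons.
Qed.

(** A whole linear combination is treated at once because additivity of the iterated integral
    requires integrability in every layer. Nothing is asked of f on the boundary of the simplex,
    which meets each layer over the open simplex in two end points; powers of 0 thus never matter,
    and this form of the hypotheses is what the induction on d preserves. *)
Lemma iint_dirichlet (I : Type) (s : seq I) d (c : I -> R) (a : I -> 'I_d.+1 -> R)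
    (f : ('I_d -> R) -> R) : (forall k i, 0 < a k i) ->
  (forall x, osimplex x -> f x = \sum_(k <- s) c k * dden (a k) x) ->
  (forall x, ~~ in_simplex x -> f x = 0) ->
  iint f = \sum_(k <- s) c k * Dir (a k).
Proof.
elim: d c a f => [|d IH] c a f a0 hf f0 /=.
  rewrite hf; last first.
    by move=> i; rewrite (ord1_max i) xext_max big_ord0 subr0.
  apply: eq_bigr => k _; congr (_ * _); rewrite /dden big_ord1.
  by rewrite (ord1_max ord0) xext_max big_ord0 subr0 powR1.
under eq_bigr do rewrite mulrA.
apply: (IH (fun k => c k * betaf (a k (widen_ord (leqnSn _) ord_max)) (a k ord_max)) (fun k => merge_last (a k))).
- by move=> k; exact: merge_last_gt0.
- move=> x ox.
  set r := xext x ord_max; have r0 : 0 < r by exact: ox.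
  pose P k := \prod_(i < d) (x i) `^ (a k (widen_ord (leqnSn _) (widen_ord (leqnSn _) i)) - 1).
  pose al k := a k (widen_ord (leqnSn _) ord_max); pose be k := a k ord_max.
  have [hi hI] := @bden_sum_int _ s (fun k => c k * P k) al be r r0 (fun k => a0 k _) (fun k => a0 k _).
  rewrite (@Rint_setT_oo _ (fun t => \sum_(k <- s) c k * P k * bden (al k) (be k) r t) r) //.
  + rewrite hI; apply: eq_bigr => k _; rewrite dden_merge -/(P k) -/(al k) -/(be k) -/r.
    by ring.
  + move=> t /andP[t0 tr]; have [h1 [h2 h3]] := xext_extend x t.
    rewrite hf; last first.
      apply/forall_ord_recr; split; last by rewrite h3 subr_gt0.
      apply/forall_ord_recr; split; last by rewrite h2.
      by move=> i; rewrite h1 -xext_widen; exact: ox.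
    by apply: eq_bigr => k _; rewrite dden_extend mulrA.
  + move=> t ht; apply: f0; apply: contra ht => /in_simplexP.
    have [h1 [h2 h3]] := xext_extend x t.
    move=> h; have := h (widen_ord (leqnSn _) ord_max); have := h ord_max.
    by rewrite h2 h3 subr_ge0 => -> ->.
- move=> x nx; rewrite /Rintegral integral0_eq // => t _.
  rewrite f0 //; apply: contra nx => /in_simplexP h; apply/in_simplexP.
  have [h1 [h2 h3]] := xext_extend x t.
  apply/forall_ord_recr; split => [i|].
    by rewrite xext_widen -(h1 i); exact: h.
  have := h (widen_ord (leqnSn _) ord_max); have := h ord_max.
  by rewrite h2 h3 subr_ge0 => /[swap]; exact: le_trans.
Qed.

Lemma betafD_poch (a b : R) m n : 0 < a -> 0 < b ->
  betaf (a + m%:R) (b + n%:R) = betaf a b * (poch a m * poch b n / poch (a + b) (m + n)).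
Proof.
move=> a0 b0.
have am0 : 0 < a + m%:R by rewrite ltr_wpDr.
have hm : betaf (a + m%:R) b = betaf a b * (poch a m / poch (a + b) m).
  elim: m {am0} => [|m IH]; first by rewrite addr0 !poch0 divr1 mulr1.
  have am0 : 0 < a + m%:R by rewrite ltr_wpDr.
  have ab0 : 0 < a + b by rewrite addr_gt0.
  rewrite -natr1 addrA betafS // IH !pochS.
  have := poch_neq0 m ab0; move=> h; field.
  by rewrite h /= !gt_eqF // ltr_wpDr.
elim: n => [|n IH]; first by rewrite addr0 addn0 poch0 mulr1.
have bn0 : 0 < b + n%:R by rewrite ltr_wpDr.
have ab0 : 0 < a + b by rewrite addr_gt0.
rewrite -natr1 addrA betafSr // IH addnS !pochS.
have h := poch_neq0 (m + n) ab0.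
have -> : a + m%:R + (b + n%:R) = a + b + (m + n)%:R by rewrite natrD; ring.
have h2 : a + b + (m + n)%:R != 0 by rewrite gt_eqF // ltr_wpDr.
move: h h2; move: (poch (a + b) _) (a + b + _) => u v hu hv; field.
by rewrite hu hv.
Qed.

Lemma DirD_poch d (a : 'I_d.+1 -> R) (n : 'I_d.+1 -> nat) : (forall i, 0 < a i) ->
  Dir (fun i => a i + (n i)%:R) =
  Dir a * ((\prod_i poch (a i) (n i)) / poch (\sum_i a i) (\sum_i n i)).
Proof.
elim: d a n => [|d IH] a n a0 /=.
  by rewrite !big_ord1 mul1r divff // poch_neq0.
pose w i := widen_ord (leqnSn d.+1) i.
rewrite betafD_poch //.
have -> : merge_last (fun i => a i + (n i)%:R) =
  (fun i => merge_last a i + (extend_last (fun i => (n (w (widen_ord (leqnSn _) i)))%:R)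
     (n (w ord_max) + n ord_max)%:R i : R)).
  apply/funext; apply/forall_ord_recr; rewrite /merge_last !extend_max; split.
    by move=> i; rewrite !extend_widen.
  by rewrite natrD; ring.
pose n' := (fun i => if unlift ord_max i is Some j then n (w (widen_ord (leqnSn _) j)) else (n (w ord_max) + n ord_max)%N).
have n'w i : n' (widen_ord (leqnSn d) i) = n (w (widen_ord (leqnSn _) i)) by rewrite /n' unlift_widen.
have n'm : n' ord_max = (n (w ord_max) + n ord_max)%N by rewrite /n' unlift_none.
have -> : (fun i => merge_last a i + (extend_last (fun i => (n (w (widen_ord (leqnSn _) i)))%:R)
     (n (w ord_max) + n ord_max)%:R i : R)) = (fun i => merge_last a i + (n' i)%:R).
  apply/funext; apply/forall_ord_recr; rewrite !extend_max n'm; split => //.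
  by move=> i; rewrite !extend_widen n'w.
rewrite IH; last exact: merge_last_gt0.
have sa : \sum_i merge_last a i = \sum_i a i.
  rewrite big_ord_recr [RHS]big_ord_recr [X in _ = X + _]big_ord_recr /= -addrA; congr (_ + _).
    by apply: eq_bigr => i _; rewrite /merge_last extend_widen.
  by rewrite /merge_last extend_max.
have sn : (\sum_i n' i = \sum_i n i)%N.
  rewrite big_ord_recr [RHS]big_ord_recr [X in _ = (X + _)%N]big_ord_recr /= -addnA; congr (_ + _)%N => //.
  by apply: eq_bigr => i _; rewrite n'w.
rewrite sa sn mulrACA; congr (_ * _); rewrite mulrCA mulrA [X in X / _]mulrC; congr (_ / _).
rewrite mulrC big_ord_recr [RHS]big_ord_recr [X in _ = X * _]big_ord_recr /= n'm /merge_last extend_max.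
rewrite -!mulrA; congr (_ * _).
  by apply: eq_bigr => i _; rewrite extend_widen n'w.
rewrite -/(w ord_max) [LHS]mulrC mulrA divfK // poch_neq0 // addr_gt0 //.
Qed.
End Dirichlet.

(** * Reproducing kernels of polynomials on the simplex *)

Section Kernel.
Variable R : realType.
Variable d : nat.
Implicit Types (kappa : 'I_d.+1 -> R) (x y : 'I_d -> R) (f g q : ('I_d -> R) -> R) (N m n : nat).

Definition bmon (e : 'I_d.+1 -> nat) x : R := \prod_i xext x i ^+ e i.

(* The monomials bmon are in the d+1 barycentric coordinates, hence not independent. *)
Definition bspan N f := exists s : seq (R * ('I_d.+1 -> nat)),
  all (fun k => (\sum_i k.2 i <= N)%N) s /\ forall x, f x = \sum_(k <- s) k.1 * bmon k.2 x.

Lemma eq_bspan N f g : f =1 g -> bspan N f -> bspan N g.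
Proof. by move=> fg [s [h1 h2]]; exists s; split => // x; rewrite -fg. Qed.

Lemma bspan_mono N N' f : (N <= N')%N -> bspan N f -> bspan N' f.
Proof.
move=> h [s [h1 h2]]; exists s; split => //.
by apply: sub_all h1 => k /leq_trans; apply.
Qed.

Lemma bspanD N f g : bspan N f -> bspan N g -> bspan N (fun x => f x + g x).
Proof.
move=> [s [h1 h2]] [t [h3 h4]]; exists (s ++ t); rewrite all_cat h1 h3; split => // x.
by rewrite big_cat /= h2 h4.
Qed.

Lemma bspanZ N c f : bspan N f -> bspan N (fun x => c * f x).
Proof.
move=> [s [h1 h2]]; exists [seq (c * k.1, k.2) | k <- s]; split.
  by rewrite all_map; apply: sub_all h1.
by move=> x; rewrite big_map h2 mulr_sumr; apply: eq_bigr => k _; rewrite mulrA.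
Qed.

Lemma bspan_bmon N (e : 'I_d.+1 -> nat) : (\sum_i e i <= N)%N -> bspan N (bmon e).
Proof.
by move=> h; exists [:: (1, e)]; rewrite /= h; split => // x; rewrite big_seq1 mul1r.
Qed.

Lemma bspan0 N : bspan N (fun=> 0).
Proof. by exists [::]; split => // x; rewrite big_nil. Qed.

Lemma bspan_sum N (I : Type) (s : seq I) (P : pred I) (F : I -> ('I_d -> R) -> R) :
  (forall i, P i -> bspan N (F i)) -> bspan N (fun x => \sum_(i <- s | P i) F i x).
Proof.
move=> h; elim: s => [|i s IH].
  by apply: eq_bspan (bspan0 N) => x; rewrite big_nil.
case: (boolP (P i)) => Pi.
  by apply: eq_bspan (bspanD (h _ Pi) IH) => x; rewrite big_cons Pi.
by apply: eq_bspan IH => x; rewrite big_cons (negbTE Pi).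
Qed.

Lemma bmonD (e e' : 'I_d.+1 -> nat) x : bmon (fun i => e i + e' i)%N x = bmon e x * bmon e' x.
Proof. by rewrite /bmon -big_split; apply: eq_bigr => i _; rewrite exprD. Qed.

Lemma bspanM N N' f g : bspan N f -> bspan N' g -> bspan (N + N') (fun x => f x * g x).
Proof.
move=> [s [h1 h2]] [t [h3 h4]].
exists [seq (k.1 * l.1, fun i => (k.2 i + l.2 i)%N) | k <- s, l <- t]; split.
  elim: s h1 {h2} => [|k s IH] //= /andP[hk hs]; rewrite all_cat IH // andbT all_map.
  apply: sub_all h3 => l hl /=; rewrite big_split /=; exact: leq_add.
move=> x; rewrite h2 h4 big_distrlr /= big_allpairs_dep.
by apply: eq_bigr => k _; apply: eq_bigr => l _; rewrite bmonD mulrACA.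
Qed.

Lemma bspan_cst N c : bspan N (fun=> c).
Proof.
apply: (@eq_bspan _ (fun x => c * bmon (fun=> 0%N) x)).
  by move=> x; rewrite /bmon big1 ?mulr1.
by apply/bspanZ/bspan_bmon; rewrite big1.
Qed.

Lemma poly_bspan N f : is_poly_le N f -> bspan N f.
Proof.
move=> [c hc]; apply: eq_bspan (fun x => esym (hc x)) _.
apply: bspan_sum => a ha.
pose e := (fun i => if unlift ord_max i is Some j then a j : nat else 0%N).
apply: (@eq_bspan _ (fun x => c a * bmon e x)).
  move=> x; rewrite /bmon big_ord_recr /= /e unlift_none expr0 mulr1.
  by congr (_ * _); apply: eq_bigr => i _; rewrite xext_widen unlift_widen.
apply/bspanZ/bspan_bmon; rewrite big_ord_recr /= /e unlift_none addn0.
by under eq_bigr do rewrite unlift_widen.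
Qed.

Definition mspan N f := exists s : seq (R * ('I_d -> nat)),
  all (fun k => (\sum_i k.2 i <= N)%N) s /\
  forall x, f x = \sum_(k <- s) k.1 * \prod_i x i ^+ k.2 i.

(** Several entries of the list may carry the same exponent, so the coefficient at a given exponent
    collects them all. *)
Lemma mspan_poly N f : mspan N f -> is_poly_le N f.
Proof.
move=> [s [hs hf]].
pose fe (k : R * ('I_d -> nat)) : {ffun 'I_d -> 'I_N.+1} := [ffun i => inord (k.2 i)].
exists (fun a => \sum_(k <- s | fe k == a) k.1) => x; rewrite hf.
under [RHS]eq_bigr do rewrite mulr_suml.
rewrite (exchange_big_dep xpredT) //=.
elim: s hs {hf} => [|k s IH] /=; first by rewrite !big_nil.
move=> /andP[hk hs]; rewrite !big_cons IH //; congr (_ + _).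
have le i : (k.2 i <= N)%N by apply: leq_trans hk; rewrite (bigD1 i) //= leq_addr.
have E i : fe k i = k.2 i :> nat by rewrite ffunE inordK // ltnS.
rewrite (big_pred1 (fe k)) /=; last first.
  move=> a /=; rewrite [fe k == a]eq_sym; case: (a =P fe k) => [->|]; rewrite ?andbF // andbT.
  by under eq_bigr do rewrite E.
by congr (_ * _); apply: eq_bigr => i _; rewrite E.
Qed.

Lemma mspanD N f g : mspan N f -> mspan N g -> mspan N (fun x => f x + g x).
Proof.
move=> [s [h1 h2]] [t [h3 h4]]; exists (s ++ t); rewrite all_cat h1 h3; split => // x.
by rewrite big_cat /= h2 h4.
Qed.

Lemma eq_mspan N f g : f =1 g -> mspan N f -> mspan N g.
Proof. by move=> fg [s [h1 h2]]; exists s; split => // x; rewrite -fg. Qed.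

Lemma mspan_sum N (I : Type) (s : seq I) (F : I -> ('I_d -> R) -> R) :
  (forall i, mspan N (F i)) -> mspan N (fun x => \sum_(i <- s) F i x).
Proof.
move=> h; elim: s => [|i s IH].
  by exists [::]; split => // x; rewrite !big_nil.
by apply: eq_mspan (mspanD (h _) IH) => x; rewrite big_cons.
Qed.

Lemma mspanM N N' f g : mspan N f -> mspan N' g -> mspan (N + N') (fun x => f x * g x).
Proof.
move=> [s [h1 h2]] [t [h3 h4]].
exists [seq (k.1 * l.1, fun i => (k.2 i + l.2 i)%N) | k <- s, l <- t]; split.
  elim: s h1 {h2} => [|k s IH] //= /andP[hk hs]; rewrite all_cat IH // andbT all_map.
  apply: sub_all h3 => l hl /=; rewrite big_split /=; exact: leq_add.
move=> x; rewrite h2 h4 big_distrlr /= big_allpairs_dep.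
apply: eq_bigr => k _; apply: eq_bigr => l _; rewrite mulrACA; congr (_ * _).
by rewrite -big_split; apply: eq_bigr => i _; rewrite exprD.
Qed.

Lemma mspan_cst N c : mspan N (fun=> c).
Proof.
exists [:: (c, fun=> 0%N)]; rewrite /= big1 //; split => // x.
by rewrite big_seq1 big1 ?mulr1.
Qed.

Lemma mspan_mono N N' f : (N <= N')%N -> mspan N f -> mspan N' f.
Proof.
move=> h [s [h1 h2]]; exists s; split => //.
by apply: sub_all h1 => k /leq_trans; apply.
Qed.

Lemma mspan_var c (j : 'I_d) : mspan 1 (fun x => c * x j).
Proof.
exists [:: (c, fun i => (i == j) : nat)]; rewrite /= (bigD1 j) //= eqxx big1 => [|i /negbTE -> //].
split => // x; rewrite big_seq1 /= (bigD1 j) //= eqxx expr1 big1 ?mulr1 //.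
by move=> i /negbTE ->.
Qed.

Lemma mspan_xext i : mspan 1 (fun x => xext x i).
Proof.
rewrite /xext; case: unlift => [j|].
  by apply: eq_mspan (mspan_var 1 j) => x; rewrite mul1r.
apply: eq_mspan (mspanD (mspan_cst 1 1) (mspan_sum (index_enum _) (mspan_var (-1)))) => x.
by rewrite -mulr_sumr mulN1r.
Qed.

Lemma mspan_bmon (e : 'I_d.+1 -> nat) : mspan (\sum_i e i)%N (bmon e).
Proof.
have hX i k : mspan k (fun x => xext x i ^+ k).
  elim: k => [|k IH]; first exact: mspan_cst.
  by apply: eq_mspan (mspanM (mspan_xext i) IH) => x; rewrite exprS.
rewrite /bmon; elim: (index_enum _) => [|i r IH].
  rewrite big_nil; apply: eq_mspan (mspan_cst 0 1) => x; by rewrite big_nil.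
by rewrite big_cons; apply: eq_mspan (mspanM (hX i (e i)) IH) => x; rewrite big_cons.
Qed.

Lemma bspan_poly N f : bspan N f -> is_poly_le N f.
Proof.
move=> [s [h1 h2]]; apply: mspan_poly; apply: eq_mspan (fun x => esym (h2 x)) _.
elim: s h1 {h2} => [|k s IH] /=.
  by exists [::]; split => // x; rewrite !big_nil.
move=> /andP[hk hs].
have h : mspan N (fun x => k.1 * bmon k.2 x).
  rewrite -[N]add0n; apply: mspanM; first exact: mspan_cst.
  exact: mspan_mono hk (mspan_bmon _).
by apply: eq_mspan (mspanD h (IH hs)) => x; rewrite big_cons.
Qed.

Definition th kappa (i : 'I_d.+1) : R := kappa i + 2^-1.
Definition thsum kappa : R := \sum_i th kappa i.
Definition Cnorm kappa : R := Dir (th kappa).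
Definition Ifun kappa f : R := iint (fun y => if in_simplex y then f y * wk kappa y else 0).

Lemma ipwE kappa f g : ipw kappa f g = Ifun kappa (fun y => f y * g y).
Proof. by []. Qed.

Section WithKappa.
Variable kappa : 'I_d.+1 -> R.
Hypothesis kappa0 : forall i, 0 <= kappa i.

Lemma th_gt0 i : 0 < th kappa i. Proof. by rewrite /th ltr_wpDl. Qed.

Lemma thsum_gt0 : 0 < thsum kappa.
Proof.
rewrite /thsum big_ord_recr /= ltr_wpDl ?th_gt0 //.
by apply: sumr_ge0 => i _; apply/ltW/th_gt0.
Qed.

Lemma Cnorm_gt0 : 0 < Cnorm kappa. Proof. exact/Dir_gt0/th_gt0. Qed.

Definition moment (e : 'I_d.+1 -> nat) : R :=
  Cnorm kappa * ((\prod_i poch (th kappa i) (e i)) / poch (thsum kappa) (\sum_i e i)).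

Lemma Ifun_bmon (s : seq (R * ('I_d.+1 -> nat))) f :
  (forall x, in_simplex x -> f x = \sum_(k <- s) k.1 * bmon k.2 x) ->
  Ifun kappa f = \sum_(k <- s) k.1 * moment k.2.
Proof.
move=> hf; rewrite /Ifun.
rewrite (@iint_dirichlet R _ s d (fun k => k.1) (fun k i => th kappa i + (k.2 i)%:R)).
- by apply: eq_bigr => k _; rewrite DirD_poch //; exact: th_gt0.
- by move=> k i; rewrite ltr_wpDr // th_gt0.
- move=> x ox; have ix : in_simplex x by apply/in_simplexP => i; exact/ltW/ox.
  rewrite ix hf // mulr_suml; apply: eq_bigr => k _; rewrite -mulrA; congr (_ * _).
  rewrite /bmon /wk /dden -big_split; apply: eq_bigr => i _ /=.
  rewrite -powR_mulrn; last exact/ltW/ox.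
  by rewrite -powRD_gt0 //; congr (_ `^ _); rewrite /th; field.
- by move=> x /negbTE ->.
Qed.

(** Linearity is stated for polynomials, where both sides are read off from the moments. *)
Lemma IfunD N f g : bspan N f -> bspan N g ->
  Ifun kappa (fun x => f x + g x) = Ifun kappa f + Ifun kappa g.
Proof.
move=> [s [_ h2]] [t [_ h4]].
rewrite (@Ifun_bmon s f) // (@Ifun_bmon t g) // -big_cat; apply: Ifun_bmon => x _.
by rewrite big_cat h2 h4.
Qed.

Lemma IfunZ N c f : bspan N f -> Ifun kappa (fun x => c * f x) = c * Ifun kappa f.
Proof.
move=> [s [_ h2]].
rewrite (@Ifun_bmon s f) // (@Ifun_bmon [seq (c * k.1, k.2) | k <- s]).
  by rewrite big_map mulr_sumr; apply: eq_bigr => k _; rewrite mulrA.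
by move=> x _; rewrite big_map h2 mulr_sumr; apply: eq_bigr => k _; rewrite mulrA.
Qed.

Lemma eq_Ifun f g : (forall x, in_simplex x -> f x = g x) -> Ifun kappa f = Ifun kappa g.
Proof.
move=> h; rewrite /Ifun; congr iint; apply/funext => x; case: ifP => // hx.
by rewrite h.
Qed.

Lemma Ifun_sum N (I : Type) (s : seq I) (P : pred I) (F : I -> ('I_d -> R) -> R) :
  (forall i, P i -> bspan N (F i)) ->
  Ifun kappa (fun x => \sum_(i <- s | P i) F i x) = \sum_(i <- s | P i) Ifun kappa (F i).
Proof.
move=> h; elim: s => [|i s IH].
  by rewrite big_nil (@Ifun_bmon [::]) ?big_nil // => x _; rewrite !big_nil.
case: (boolP (P i)) => Pi.
  rewrite big_cons Pi -IH -(@IfunD N) //; last exact: bspan_sum.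
    by apply: eq_Ifun => x _; rewrite big_cons Pi.
  exact: h.
by rewrite big_cons (negbTE Pi) -IH; apply: eq_Ifun => x _; rewrite big_cons (negbTE Pi).
Qed.

Lemma Ifun_ge0 f : (forall x, in_simplex x -> 0 <= f x) -> 0 <= Ifun kappa f.
Proof.
move=> f0; apply: iint_ge0 => x; case: ifP => // hx.
by rewrite mulr_ge0 ?f0 // prodr_ge0 // => i _; exact: powR_ge0.
Qed.

Lemma Ifun_mono e : Ifun kappa (bmon e) = moment e.
Proof.
by rewrite (@Ifun_bmon [:: (1, e)]) ?big_seq1 ?mul1r // => x _; rewrite big_seq1 mul1r.
Qed.

End WithKappa.
End Kernel.

(** * Power series with an exponential factor *)

Section Laguerre.
Variable R : realType.
Implicit Types (a l m n r : nat) (t x A : R) (p q P Q : {poly R}).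

(* lagp a t x is the polynomial p with sum_l x^l (t+l)_a X^l / l! = e^(x X) p. *)
Fixpoint lagp a t x : {poly R} :=
  if a is a'.+1 then (t + a'%:R)%:P * lagp a' t x + x%:P * ('X * lagp a' (t + 1) x) else 1.

Definition expc A (j : nat) : R := A ^+ j / j`!%:R.

(** The congruence P = p e^(A X) modulo X^(m+1). *)
Definition exp_like m P p A :=
  forall l, (l <= m)%N -> P`_l = \sum_(r < l.+1) p`_r * expc A (l - r).

Lemma exp_like1 m : exp_like m 1 1 0.
Proof.
move=> l _; rewrite (bigD1 ord0) //= big1 => [|i i0]; last first.
  by rewrite coef1 (_ : (nat_of_ord i == 0)%N = (i == ord0)) // (negbTE i0) mul0r.
rewrite !coef1 subn0 /expc /= mul1r addr0.
by case: l => [|l] /=; rewrite ?expr0 ?fact0 ?divr1 // exprS !mul0r.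
Qed.

Lemma expcD A B l : \sum_(r < l.+1) expc A r * expc B (l - r) = expc (A + B) l.
Proof.
rewrite /expc addrC exprDn mulr_suml; apply: eq_bigr => r _.
have h : (r <= l)%N by rewrite -ltnS.
rewrite -(bin_fact h) !natrM -[_ *+ 'C(_, _)]mulr_natr.
have := factr_neq0 R r; have := factr_neq0 R (l - r).
have : 'C(l, r)%:R != 0 :> R by rewrite pnatr_eq0 -lt0n bin_gt0.
move: (r`!%:R : R) ('C(l, r)%:R : R) ((l - r)`!%:R : R) (A ^+ _) (B ^+ _) => u v w z z' hv hw hu.
by field; rewrite hu hv hw.
Qed.

Lemma exp_likeM m P p A Q q B : exp_like m P p A -> exp_like m Q q B ->
  exp_like m (P * Q) (p * q) (A + B).
Proof.
move=> hP hQ l lm.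
pose E C := \poly_(j < m.+1) expc C j.
have EC C j : (j <= m)%N -> (E C)`_j = expc C j by move=> h; rewrite coef_poly ltnS h.
have hP' j : (j <= m)%N -> P`_j = (p * E A)`_j.
  move=> h; rewrite hP // coefM; apply: eq_bigr => r _; rewrite EC //.
  exact: leq_trans (leq_subr _ _) h.
have hQ' j : (j <= m)%N -> Q`_j = (q * E B)`_j.
  move=> h; rewrite hQ // coefM; apply: eq_bigr => r _; rewrite EC //.
  exact: leq_trans (leq_subr _ _) h.
have lr (i : 'I_l.+1) : (i <= m)%N by apply: leq_trans lm; rewrite -ltnS.
have lr' (i : 'I_l.+1) : (l - i <= m)%N by apply: leq_trans (leq_subr _ _) lm.
transitivity ((p * E A) * (q * E B))`_l.
  by rewrite !coefM; apply: eq_bigr => i _; rewrite hP' ?hQ'.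
rewrite mulrACA coefM; apply: eq_bigr => i _; congr (_ * _).
rewrite coefM -expcD; apply: eq_bigr => j _.
have h1 : (j <= m)%N by apply: leq_trans (lr' i); rewrite -ltnS.
by rewrite !EC // (leq_trans (leq_subr _ _)).
Qed.

(** From (t + l)_(a+1) = (t + a) (t + l)_a + l (t + l)_a: in the second summand l x^l / l! = x
    x^(l-1) / (l-1)! shifts the index and turns t into t + 1, which is the recursion of [lagp]. *)
Lemma exp_like_lagp m a t x :
  exp_like m (\poly_(l < m.+1) (x ^+ l / l`!%:R * poch (t + l%:R) a)) (lagp a t x) x.
Proof.
elim: a t => [|a IH] t l lm; rewrite coef_poly ltnS lm.
  rewrite poch0 mulr1 /= (bigD1 ord0) //= big1 => [|i i0]; last first.
    by rewrite coef1 (_ : (nat_of_ord i == 0)%N = (i == ord0)) // (negbTE i0) mul0r.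
  by rewrite coef1 subn0 /= mul1r addr0.
under eq_bigr do rewrite /= coefD !coefCM mulrDl.
rewrite big_split /= pochS.
transitivity ((t + a%:R) * (x ^+ l / l`!%:R * poch (t + l%:R) a) +
   l%:R * (x ^+ l / l`!%:R) * poch (t + l%:R) a); first by ring.
congr (_ + _).
  have := IH t l lm; rewrite coef_poly ltnS lm => ->.
  by rewrite mulr_sumr; apply: eq_bigr => i _; rewrite mulrA.
rewrite big_ord_recl coefXM eqxx mulr0 mul0r add0r.
case: l lm => [|l] lm; first by rewrite big_ord0 !mul0r.
have lm' : (l <= m)%N by exact: ltnW.
have := IH (t + 1) l lm'; rewrite coef_poly ltnS lm' => E.
transitivity (x * (x ^+ l / l`!%:R * poch (t + 1 + l%:R) a)).
  have -> : t + 1 + l%:R = t + l.+1%:R by rewrite -addrA nat1r.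
  rewrite [RHS]mulrA; congr (_ * _).
  have h1 := factr_neq0 R l; have h2 : l.+1%:R != 0 :> R by rewrite pnatr_eq0.
  rewrite factS natrM exprS; move: (l`!%:R : R) (l.+1%:R : R) h1 h2 => u v hu hv.
  by field; rewrite hu hv.
rewrite E mulr_sumr; apply: eq_bigr => i _.
by rewrite ?lift0 coefXM /= subSS mulrA.
Qed.

Lemma size_lagp a t x : (size (lagp a t x) <= a.+1)%N.
Proof.
elim: a t => [|a IH] t /=; first by rewrite size_poly1.
apply: (leq_trans (size_polyD _ _)); rewrite geq_max; apply/andP; split.
  apply: (leq_trans (size_polyMleq _ _)).
  apply: (@leq_trans (1 + a.+1).-1); last by [].
  by rewrite -!subn1 leq_sub2r // leq_add // size_polyC_leq1.
apply: (leq_trans (size_polyMleq _ _)).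
apply: (@leq_trans (1 + a.+2).-1) => //.
rewrite -!subn1 leq_sub2r // leq_add // ?size_polyC_leq1 // mulrC.
apply: (leq_trans (size_polyMleq _ _)); rewrite size_polyX addn2 /=.
by rewrite ltnS.
Qed.

Lemma coef_lagp a t x : (lagp a t x)`_a = x ^+ a.
Proof.
elim: a t => [|a IH] t /=; first by rewrite coef1.
rewrite coefD !coefCM coefXM /= IH exprS.
by rewrite nth_default ?mulr0 ?add0r //; exact: size_lagp.
Qed.

Lemma coef_top p q a b : (size p <= a.+1)%N -> (size q <= b.+1)%N ->
  (size (p * q)%R <= (a + b).+1)%N /\ (p * q)`_(a + b)%N = p`_a * q`_b.
Proof.
move=> hp hq; split.
  apply: (leq_trans (size_polyMleq _ _)).
  have := leq_add hp hq; lia.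
rewrite coefM (bigD1 (Ordinal (leq_addr b a : a < (a + b).+1)%N)) //= addKn.
rewrite big1 ?addr0 // => i; rewrite -val_eqE /= => hi.
have [h|h] := ltnP a i; first by rewrite nth_default ?mul0r // (leq_trans hp).
rewrite [q`_ _]nth_default ?mulr0 //; apply: (leq_trans hq).
by move: h hi; have /= := ltn_ord i; lia.
Qed.

(** The exponential factors multiply to e^((sum_i x_i) X). For barycentric coordinates the sum is 1,
    so the m-th coefficient is a combination of 1 / (m - j)!; the leading coefficient of p is the
    monomial that the kernel has to reproduce. *)
Lemma prod_lagp r (a : 'I_r -> nat) (t x : 'I_r -> R) :
  exists p, [/\ (size p <= (\sum_i a i).+1)%N, p`_(\sum_i a i) = \prod_i x i ^+ a i &
   forall m, (\prod_i \poly_(l < m.+1) (x i ^+ l / l`!%:R * poch (t i + l%:R) (a i)))`_m =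
      \sum_(j < m.+1) p`_j * expc (\sum_i x i) (m - j)].
Proof.
exists (\prod_i lagp (a i) (t i) (x i)).
have [h1 h2] : (size (\prod_i lagp (a i) (t i) (x i))%R <= (\sum_i a i).+1)%N /\
   (\prod_i lagp (a i) (t i) (x i))`_(\sum_i a i) = \prod_i x i ^+ a i.
  elim: (index_enum _) => [|i s [IH1 IH2]].
    by rewrite !big_nil size_poly1 coef1.
  rewrite !big_cons; have [e1 e2] := coef_top (size_lagp (a i) (t i) (x i)) IH1.
  by rewrite e1 e2 coef_lagp IH2.
split => // m.
have : exp_like m (\prod_i \poly_(l < m.+1) (x i ^+ l / l`!%:R * poch (t i + l%:R) (a i)))
    (\prod_i lagp (a i) (t i) (x i)) (\sum_i x i).
  elim: (index_enum _) => [|i s IH]; first by rewrite !big_nil; exact: exp_like1.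
  by rewrite !big_cons; apply: exp_likeM IH; exact: exp_like_lagp.
by apply.
Qed.

Lemma coef_prod_poly r m (g : 'I_r -> nat -> R) :
  (\prod_i \poly_(l < m.+1) g i l)`_m =
  \sum_(f : {ffun 'I_r -> 'I_m.+1} | (\sum_i (f i : nat) == m)%N) \prod_i g i (f i).
Proof.
under eq_bigr do rewrite poly_def.
rewrite bigA_distr_bigA /= coef_sum [RHS]big_mkcond /=; apply: eq_bigr => f _.
have -> : \prod_(i < r) (g i (f i) *: 'X^(f i)) = (\prod_i g i (f i)) *: 'X^(\sum_i f i).
  elim: (index_enum _) => [|i s IH]; first by rewrite !big_nil expr0 scale1r.
  by rewrite !big_cons IH -scalerAl -scalerAr scalerA exprD.
by rewrite coefZ coefXn eq_sym; case: eqP; rewrite ?mulr1 ?mulr0.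
Qed.

End Laguerre.

(** * The reproducing kernel and its identification with the projection kernels *)

Section Reproducing.
Variable R : realType.

Lemma sum_ord_ext (F : nat -> R) a b : (a <= b)%N -> (forall j, (a <= j)%N -> F j = 0) ->
  \sum_(j < b) F j = \sum_(j < a) F j.
Proof.
move=> ab F0; rewrite (big_ord_widen b F ab) [RHS]big_mkcond; apply: eq_bigr => j _.
by case: ltnP => // /F0.
Qed.

Lemma ffact_inv m j : \prod_(i < j) (m%:R - i%:R) / m`!%:R =
  (if (j <= m)%N then (m - j)`!%:R^-1 else 0 : R).
Proof.
case: leqP => [jm|mj]; last first.
  by rewrite (bigD1 (Ordinal mj)) //= subrr !mul0r.
have -> : \prod_(i < j) (m%:R - i%:R) = (m ^_ j)%:R :> R.
  elim: j jm => [|j IH] jm; first by rewrite big_ord0.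
  by rewrite big_ord_recr (IH (ltnW jm)) ffactnSr natrM (natrB _ (ltnW jm)).
rewrite -(ffact_fact jm) natrM invfM mulrA divff ?mul1r //.
by rewrite pnatr_eq0 -lt0n ffact_gt0.
Qed.

Variable d : nat.
Implicit Types (kappa : 'I_d.+1 -> R) (x y : 'I_d -> R) (f g q : ('I_d -> R) -> R) (N m n : nat).

(** The sum over multi-indices f of weight m of prod_i c_i^(f_i) / (f_i! (th_i)_(f_i)), encoded as a
    coefficient so that products of series do the bookkeeping. *)
Definition ee kappa m (c : 'I_d.+1 -> R) : R :=
  (\prod_i \poly_(l < m.+1) (c i ^+ l / (l`!%:R * poch (th kappa i) l)))`_m.

Definition kcoef (T : R) n m : R := (-1) ^+ (n - m) * poch T (m + n) / (n - m)`!%:R.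

Definition Kker kappa n x y : R := (Cnorm kappa)^-1 *
  \sum_(m < n.+1) kcoef (thsum kappa) n m * ee kappa m (fun i => xext x i * xext y i).

Lemma KkerC kappa n x y : Kker kappa n x y = Kker kappa n y x.
Proof.
rewrite /Kker; congr (_ * _); apply: eq_bigr => m _; congr (_ * ee _ _ _).
by apply/funext => i; rewrite mulrC.
Qed.

Lemma eeE kappa m x y : ee kappa m (fun i => xext x i * xext y i) =
  \sum_(f : {ffun 'I_d.+1 -> 'I_m.+1} | (\sum_i (f i : nat) == m)%N)
    (\prod_i (xext x i ^+ f i / ((f i)`!%:R * poch (th kappa i) (f i)))) * bmon (fun i => f i) y.
Proof.
rewrite /ee (@coef_prod_poly R _ m (fun i l => _)); apply: eq_bigr => f _.
rewrite /bmon -big_split; apply: eq_bigr => i _ /=.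
by rewrite exprMn mulrAC.
Qed.

Lemma bspan_ee kappa m x : bspan m (fun y => ee kappa m (fun i => xext x i * xext y i)).
Proof.
apply: eq_bspan (fun y => esym (eeE kappa m x y)) _.
apply: bspan_sum => f /eqP hf; apply/bspanZ/bspan_bmon; by rewrite hf.
Qed.

Lemma bspan_Kker kappa n x : bspan n (Kker kappa n x).
Proof.
apply: bspanZ; apply: bspan_sum => m _; apply: bspanZ.
by apply: bspan_mono (bspan_ee _ _ _); rewrite -ltnS.
Qed.

Section WithKappa.
Variable kappa : 'I_d.+1 -> R.
Hypothesis kappa0 : forall i, 0 <= kappa i.
Local Notation T := (thsum kappa).
Local Notation C := (Cnorm kappa).

(** The moment of exponent f + e contains (th_i)_(f_i + e_i), whose first part cancels the
    denominator in [ee]; there remains (th_i + f_i)_(e_i), the coefficient treated by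
    [prod_lagp]. *)
Lemma Ifun_bmon_ee e m x : Ifun kappa (fun y => bmon e y * ee kappa m (fun i => xext x i * xext y i)) =
  C / poch T (m + \sum_i e i) *
  (\prod_i \poly_(l < m.+1) (xext x i ^+ l / l`!%:R * poch (th kappa i + l%:R) (e i)))`_m.
Proof.
rewrite (@eq_Ifun _ _ _ _ (fun y => \sum_(f : {ffun 'I_d.+1 -> 'I_m.+1} | (\sum_i (f i : nat) == m)%N)
    (\prod_i (xext x i ^+ f i / ((f i)`!%:R * poch (th kappa i) (f i)))) * bmon (fun i => f i + e i)%N y)); last first.
  move=> y _; rewrite eeE mulr_sumr; apply: eq_bigr => f _.
  by rewrite bmonD [RHS]mulrA mulrC.
rewrite (@Ifun_sum _ _ _ kappa0 (m + \sum_i e i)); last first.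
  move=> f /eqP hf; apply/bspanZ/bspan_bmon; by rewrite big_split /= hf.
rewrite (@coef_prod_poly R _ m (fun i l => _)) mulr_sumr; apply: eq_bigr => f /eqP hf.
rewrite (@IfunZ _ _ _ kappa0 (m + \sum_i e i)); last first.
  by apply/bspan_bmon; rewrite big_split /= hf.
rewrite Ifun_mono // /moment (_ : (\sum_i (f i + e i))%N = (m + \sum_i e i)%N); last first.
  by rewrite big_split /= hf.
rewrite mulrCA -[RHS]mulrA; congr (_ * _); rewrite mulrA mulrC; congr (_ * _).
rewrite -big_split; apply: eq_bigr => i _ /=; rewrite pochD.
have := poch_neq0 (f i) (th_gt0 kappa0 i); have := factr_neq0 R (f i).
move: ((f i)`!%:R : R) (poch _ (f i)) (poch _ (e i)) (_ ^+ _) => u v w z hu hv.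
by field; rewrite hu hv.
Qed.

(** With a = |e|, 1 / (m - j)! is a falling factorial of m over m!, and (T)_(m+n) / (T)_(m+a) is a
    monic polynomial in m of degree n - a. The sum over m is thus a divided difference of a monic
    polynomial of degree j + n - a <= n; it vanishes unless j = a, and there p has the coefficient
    [bmon e x]. *)
Lemma Kker_bmon e n x : (\sum_i e i <= n)%N ->
  Ifun kappa (fun y => bmon e y * Kker kappa n x y) = bmon e x.
Proof.
set a := (\sum_i e i)%N => an.
have [p [sp lp hp]] := prod_lagp e (th kappa) (xext x).
rewrite -/a in sp lp.
rewrite (@eq_Ifun _ _ _ _ (fun y => \sum_(m < n.+1) C^-1 * kcoef T n m * (bmon e y * ee kappa m (fun i => xext x i * xext y i)))); last first.
  move=> y _; rewrite /Kker mulrCA 2!mulr_sumr; apply: eq_bigr => m _.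
  by rewrite -[RHS]mulrA; congr (_ * _); rewrite mulrCA.
rewrite (@Ifun_sum _ _ _ kappa0 (a + n)); last first.
  move=> m _; apply: bspanZ; apply: bspanM; first exact: bspan_bmon.
  by apply: bspan_mono (bspan_ee _ _ _); rewrite -ltnS.
transitivity (\sum_(m < n.+1) \sum_(j < a.+1) p`_j * ((-1) ^+ (n - m) / (m`!%:R * (n - m)`!%:R) *
   \prod_(c <- [seq - i%:R | i <- iota 0 j] ++ [seq T + a%:R + i%:R | i <- iota 0 (n - a)]) (m%:R + c))).
  apply: eq_bigr => m _.
  rewrite (@IfunZ _ _ _ kappa0 (a + m)); last first.
    by apply: bspanM; [exact: bspan_bmon | exact: bspan_ee].
  rewrite Ifun_bmon_ee hp xext_sum.
  have -> : \sum_(j < m.+1) p`_j * expc 1 (m - j) =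
     \sum_(j < a.+1) p`_j * (\prod_(i < j) (m%:R - i%:R) / m`!%:R).
    pose F j := p`_j * (if (j <= m)%N then (m - j)`!%:R^-1 else 0 : R).
    transitivity (\sum_(j < m.+1) F j).
      by apply: eq_bigr => j _; rewrite /F -ltnS ltn_ord /expc expr1n mul1r.
    transitivity (\sum_(j < a.+1) F j); last by apply: eq_bigr => j _; rewrite ffact_inv.
    rewrite -(@sum_ord_ext F m.+1 (m.+1 + a.+1)) ?leq_addr //; last first.
      by move=> j; rewrite ltnNge /F => /negbTE ->; rewrite mulr0.
    apply: sum_ord_ext; first exact: leq_addl.
    by move=> j hj; rewrite /F nth_default ?mul0r // (leq_trans sp).
  rewrite -/a 2!mulr_sumr; apply: eq_bigr => j _.
  rewrite big_cat /= !big_map.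
  have -> : \prod_(i <- iota 0 j) (m%:R + - i%:R) = \prod_(i < j) (m%:R - i%:R) :> R.
    by rewrite -(big_mkord xpredT (fun i => m%:R - i%:R)) /index_iota subn0.
  have -> : \prod_(i <- iota 0 (n - a)) (m%:R + (T + a%:R + i%:R)) = poch (T + (m + a)%:R) (n - a).
    rewrite /poch -(big_mkord xpredT (fun i => T + (m + a)%:R + i%:R)) /index_iota subn0.
    by apply: eq_bigr => i _; rewrite natrD; ring.
  have E : poch T (m + n) = poch T (m + a) * poch (T + (m + a)%:R) (n - a).
    by rewrite -pochD; congr poch; lia.
  rewrite /kcoef E.
  have h1 := factr_neq0 R m; have h2 := factr_neq0 R (n - m).
  have h3 := poch_neq0 (m + a) (thsum_gt0 kappa0).
  have h4 : C != 0 by rewrite gt_eqF // Cnorm_gt0.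
  move: (poch T (m + a)) (m`!%:R : R) ((n - m)`!%:R : R) C h1 h2 h3 h4 => u v w c hv hw hu hc.
  by field; rewrite hu hv hw hc.
rewrite exchange_big /=.
under eq_bigr => j _ do rewrite -mulr_sumr.
have key (j : 'I_a.+1) : \sum_(m < n.+1) ((-1) ^+ (n - m) / (m`!%:R * (n - m)`!%:R) *
   \prod_(c <- [seq - i%:R | i <- iota 0 j] ++ [seq T + a%:R + i%:R | i <- iota 0 (n - a)]) (m%:R + c))
   = (j == a :> nat)%:R :> R.
  set s := _ ++ _.
  have sz : size s = (j + (n - a))%N by rewrite size_cat !size_map !size_iota.
  have ja : (j <= a)%N by rewrite -ltnS.
  rewrite -/(fdiff (fun m => \prod_(c <- s) (m%:R + c)) n) fdiff_prod sz; last by lia.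
  by congr (_%:R : R); congr nat_of_bool; apply/eqP/eqP; lia.
under eq_bigr => j _ do rewrite key.
rewrite big_ord_recr /= eqxx mulr1 lp big1 ?add0r //.
by move=> i _; rewrite /= ltn_eqF // mulr0.
Qed.

Lemma Kker_repro n x q : bspan n q -> Ifun kappa (fun y => q y * Kker kappa n x y) = q x.
Proof.
move=> [s [h1 h2]].
rewrite (@eq_Ifun _ _ _ _ (fun y => \sum_(k <- s | (\sum_i k.2 i <= n)%N) k.1 * (bmon k.2 y * Kker kappa n x y))); last first.
  move=> y _; rewrite h2 mulr_suml; elim: s h1 {h2} => [|k s IH] /=; first by rewrite !big_nil.
  by move=> /andP[hk hs]; rewrite !big_cons hk IH // mulrA.
rewrite (@Ifun_sum _ _ _ kappa0 (n + n)); last first.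
  move=> k hk; apply/bspanZ/bspanM; [exact: bspan_bmon | exact: bspan_Kker].
rewrite h2; elim: s h1 {h2} => [|k s IH] /=; first by rewrite !big_nil.
move=> /andP[hk hs]; rewrite !big_cons hk IH //; congr (_ + _).
rewrite (@IfunZ _ _ _ kappa0 (n + n)); last by apply/bspanM; [exact: bspan_bmon | exact: bspan_Kker].
by rewrite Kker_bmon.
Qed.

Definition Qker n x y : R := if n is n'.+1 then Kker kappa n x y - Kker kappa n' x y else Kker kappa 0 x y.

Lemma QkerC n x y : Qker n x y = Qker n y x.
Proof. by case: n => [|n] /=; rewrite KkerC // [Kker kappa n x y]KkerC. Qed.

Lemma bspan_Qker n x : bspan n (Qker n x).
Proof.
case: n => [|n] /=; first exact: bspan_Kker.
have h := bspanZ (-1) (bspan_Kker kappa n x).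
apply: eq_bspan (bspanD (bspan_Kker kappa n.+1 x) (bspan_mono (leqnSn n) h)) => y.
by rewrite mulN1r.
Qed.

Lemma Qker_IfunE n x q N : bspan N q -> Ifun kappa (fun y => q y * Qker n x y) =
  Ifun kappa (fun y => q y * Kker kappa n x y) -
  (if n is n'.+1 then Ifun kappa (fun y => q y * Kker kappa n' x y) else 0).
Proof.
move=> hq; case: n => [|n] /=; first by rewrite subr0.
have h1 := bspanM hq (bspan_Kker kappa n.+1 x).
have h2 := bspan_mono (_ : (N + n <= N + n.+1)%N) (bspanM hq (bspan_Kker kappa n x)).
have h3 := bspanZ (-1) (h2 _).
rewrite (@eq_Ifun _ _ _ _ (fun y => q y * Kker kappa n.+1 x y + (-1) * (q y * Kker kappa n x y))); last first.
  by move=> y _; ring.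
rewrite (IfunD kappa0 h1 (h3 _)) ?leq_add2l //.
by rewrite (IfunZ kappa0 _ (h2 _)) ?mulN1r // leq_add2l.
Qed.

Lemma Qker_orth m n x q : (m < n)%N -> bspan m q -> Ifun kappa (fun y => q y * Qker n x y) = 0.
Proof.
move=> mn hq; rewrite (Qker_IfunE _ _ hq); case: n mn => // n; rewrite ltnS => mn.
by rewrite !Kker_repro ?subrr //; apply: bspan_mono hq; rewrite ?leqW.
Qed.

(** The integral of P(x, .) Q_n(y, .) is evaluated twice: P reproduces the second factor at x, and
    K_n - K_(n-1) reproduces the first one at y, where K_(n-1) contributes 0 by orthogonality. *)
Lemma Pn_kernelE P n x y : is_Pn_kernel kappa n P -> in_simplex x -> in_simplex y ->
  P x y = Qker n x y.
Proof.
move=> hP hx hy; have [[Pp Po] Pr] := hP x hx.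
have Pb := poly_bspan Pp.
have QV : in_Vn kappa n (Qker n y).
  split; first exact/bspan_poly/bspan_Qker.
  move=> m mn q /poly_bspan hq; rewrite ipwE -(Qker_orth y mn hq).
  by apply: eq_Ifun => z _; rewrite mulrC.
have := Pr _ QV; rewrite QkerC => <-; rewrite ipwE.
rewrite (@eq_Ifun _ _ _ _ (fun z => P x z * Qker n y z)); last by move=> z _; rewrite mulrC.
rewrite (Qker_IfunE _ _ Pb) Kker_repro //.
case: n hP Po {Pp Pr QV} Pb => [|n] hP Po Pb; first by rewrite subr0.
have := Po n (ltnSn n) (Kker kappa n y) (bspan_poly (bspan_Kker _ _ _)).
by rewrite ipwE => ->; rewrite subr0.
Qed.

End WithKappa.
End Reproducing.

(** * The product formula *)

Section ProductFormula.
Variable R : realType.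
Local Notation mu := (@lebesgue_measure R).
Implicit Types (k B c M A u t : R) (p F P : {poly R}) (l m n q N : nat).

Definition jweight k l : R := poch 2^-1 l / poch (k + 2^-1) l.

(* The expectation of p(t) under the even probability law on [-1,1] with density
   proportional to (1-t^2)^(k-1), which degenerates to (delta_1 + delta_-1)/2 at k = 0. *)
Definition Jm k p : R := \sum_(l < size p) p`_(l.*2) * jweight k l.

Lemma JmE N k p : (size p <= N)%N -> Jm k p = \sum_(l < N) p`_(l.*2) * jweight k l.
Proof.
move=> h; rewrite /Jm -(@sum_ord_ext R (fun l => p`_(l.*2) * jweight k l) _ _ h) //.
by move=> j hj; rewrite nth_default ?mul0r // (leq_trans hj) // -addnn leq_addr.
Qed.

Definition evenv p u : R := \sum_(l < size p) p`_(l.*2) * u ^+ l.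

Lemma even_horner p t : evenv p (t ^+ 2) = (p.[t] + p.[- t]) / 2.
Proof.
have h N (a : nat -> R) : \sum_(i < N.*2) a i * (1 + (-1) ^+ i) = 2 * \sum_(l < N) a l.*2.
  elim: N => [|N IH]; first by rewrite !big_ord0 mulr0.
  have e1 : (-1) ^+ N.*2 = 1 :> R by rewrite -signr_odd odd_double.
  rewrite doubleS 2!big_ord_recr [in RHS]big_ord_recr /= IH exprS e1; ring.
rewrite !horner_coef -big_split /=.
transitivity ((\sum_(i < size p) (p`_i * t ^+ i) * (1 + (-1) ^+ i)) / 2); last first.
  congr (_ / 2); apply: eq_bigr => i _; rewrite [in RHS]exprNn; ring.
rewrite -(@sum_ord_ext R (fun i => (p`_i * t ^+ i) * (1 + (-1) ^+ i)) (size p) (size p).*2).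
- rewrite (h _ (fun i => p`_i * t ^+ i)) mulrC mulKf ?pnatr_eq0 //; apply: eq_bigr => l _.
  by rewrite -muln2 mulnC exprM.
- by rewrite -addnn leq_addr.
- by move=> j hj; rewrite nth_default // !mul0r.
Qed.

Definition jphi B q t : R := ((1 + B * (1 - t ^+ 2)) ^+ q)^-1.

Lemma Jm_bound0 p c B q : 0 <= c -> (forall t, `|t| <= 1 -> `|p.[t]| <= c * jphi B q t) ->
  `|Jm 0 p| <= c.
Proof.
move=> c0 hp.
have -> : Jm 0 p = evenv p (1 ^+ 2).
  apply: eq_bigr => l _; rewrite /jweight add0r divff ?mulr1; last by rewrite poch_neq0.
  by rewrite expr1n expr1n mulr1.
have h t : t ^+ 2 = 1 -> jphi B q t = 1 by rewrite /jphi => ->; rewrite subrr mulr0 addr0 expr1n invr1.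
have h1 := hp 1; have h2 := hp (-1); rewrite h ?expr1n // mulr1 in h1; rewrite h ?sqrrN ?expr1n // mulr1 in h2.
rewrite even_horner normrM [X in _ * X]ger0_norm // ler_pdivrMr // mulr_natr mulr2n.
by apply: (le_trans (ler_normD _ _)); apply: lerD; [apply: h1; rewrite normr1 | apply: h2; rewrite normrN1].
Qed.

Lemma Jm_integral k p : 0 < k ->
  mu.-integrable `]0, 1[ (EFin \o (fun u => evenv p u * bden 2^-1 k 1 u)) /\
  Jm k p * betaf 2^-1 k = Rintegral mu `]0, 1[ (fun u => evenv p u * bden 2^-1 k 1 u).
Proof.
move=> k0; have h0 : (0 : R) < 2^-1 by [].
have al0 l : (0 : R) < 2^-1 + l%:R by rewrite ltr_wpDr.
have [h1 h2] := @bden_sum_int R _ (index_enum 'I_(size p)) (fun l : 'I_(size p) => p`_(l.*2))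
   (fun l : 'I_(size p) => 2^-1 + l%:R) (fun=> k) 1 ltr01 (fun l : 'I_(size p) => al0 l) (fun=> k0).
have E u : 0 < u < 1 -> \sum_(l < size p) p`_(l.*2) * bden (2^-1 + l%:R) k 1 u = evenv p u * bden 2^-1 k 1 u.
  move=> /andP[u0 u1]; rewrite /evenv mulr_suml; apply: eq_bigr => l _.
  rewrite /bden -!mulrA; congr (_ * _); rewrite mulrA; congr (_ * _).
  by rewrite -powR_mulrn ?ltW // -powRD_gt0 //; congr (_ `^ _); ring.
split.
  apply: eq_integrable h1 => // u; rewrite inE /= in_itv /= => hu.
  by rewrite E.
transitivity (Rintegral mu `]0, 1[ (fun u => \sum_(l < size p) p`_(l.*2) * bden (2^-1 + l%:R) k 1 u)).
  rewrite h2 /Jm mulr_suml; apply: eq_bigr => l _.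
  rewrite powR1 mul1r -mulrA; congr (_ * _).
  have := betafD_poch l 0 h0 k0; rewrite addr0 addn0 poch0 mulr1 => ->.
  by rewrite /jweight mulrC [k + _]addrC.
by apply: eq_Rintegral => u; rewrite inE /= in_itv /= => hu; rewrite E.
Qed.

(** The exponent - k - 1 is the one for which ((1 - u) / (1 + B (1 - u)))^k is an antiderivative up
    to a constant factor. *)
Definition jtail k B u : R := (1 - u) `^ (k - 1) * (1 + B * (1 - u)) `^ (- k - 1).

Lemma jtail_ocont k B : 0 <= B -> ocont 1 (jtail k B).
Proof.
move=> B0 u /andP[u0 u1]; apply: cvgM; first exact: powR_rsub_cont.
apply: (@cvg_comp _ _ _ (fun u => 1 + B * (1 - u)) (fun u => u `^ (- k - 1))); last first.
  by apply: (@powR_cont R); rewrite ltr_wpDr // mulr_ge0 // subr_ge0 ltW.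
apply: cvgD; first exact: cvg_cst.
by apply: cvgMl_tmp; apply: cvgB; [exact: cvg_cst | exact: cvg_id].
Qed.

Lemma jtail_int k B : 0 < k -> 0 <= B ->
  mu.-integrable `]0, 1[ (EFin \o jtail k B) /\
  Rintegral mu `]0, 1[ (jtail k B) = k^-1 * (1 + B) `^ (- k).
Proof.
move=> k0 B0.
pose F u := - k^-1 * ((1 - u) `^ k * (1 + B * (1 - u)) `^ (- k)).
have pos u : u <= 1 -> 0 < 1 + B * (1 - u) by move=> h; rewrite ltr_wpDr // mulr_ge0 // subr_ge0.
have cB u a : u <= 1 -> {for u, continuous (fun u => (1 + B * (1 - u)) `^ a)}.
  move=> hu; apply: (@cvg_comp _ _ _ (fun u => 1 + B * (1 - u)) (fun u => u `^ a)); last first.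
    by apply: (@powR_cont R); exact: pos.
  apply: cvgD; first exact: cvg_cst.
  by apply: cvgMl_tmp; apply: cvgB; [exact: cvg_cst | exact: cvg_id].
have H : (\int[mu]_(u in `]0%R, 1%R[) (jtail k B u)%:E = (F 1 - F 0)%:E)%E.
  apply: oint_FTC => //.
  - exact: jtail_ocont.
  - by move=> u _; rewrite mulr_ge0 ?powR_ge0.
  - move=> u /andP[u0 u1]; have u1' : 0 < 1 - u by rewrite subr_gt0.
    have p0 := pos u (ltW u1).
    have d1 := is_derive_rsub_powR k u1.
    have d0 : is_derive u (1 : R) (fun u => 1 + B * (1 - u)) (- B).
      rewrite (_ : (fun u => 1 + B * (1 - u)) = cst (1 + B) - B \*: id); last first.
        by apply/funext => v; rewrite mulrBr mulr1 addrA.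
      by apply: is_derive_eq; rewrite sub0r /GRing.scale /= mulr1.
    have d2 := @is_derive1_powR R (- k) _ p0.
    have d3 := @is_derive1_comp R (fun u => u `^ (- k)) (fun u => 1 + B * (1 - u)) u _ _ d2 d0.
    have d4 := @is_deriveM _ _ _ _ u 1 _ _ d1 d3.
    have d5 := @is_deriveZ _ _ _ _ (- k^-1) u 1 _ d4.
    apply: (is_derive_eq d5); rewrite /GRing.scale /= /jtail.
    have -> : (1 - u) `^ k = (1 - u) * (1 - u) `^ (k - 1) by rewrite mulr_powRB1 // ltW.
    have -> : (1 + B * (1 - u)) `^ (- k) = (1 + B * (1 - u)) * (1 + B * (1 - u)) `^ (- k - 1).
      rewrite -{2}(powRr1 (ltW p0)) -powRD_gt0 //; congr (_ `^ _); ring.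
    have k0' : k != 0 by rewrite gt_eqF.
    by field.
  - apply: cvgMl_tmp; apply: cvgM.
      by apply: cvg_at_right_filter; apply: (@powR_rsub_cont R k 1 0).
    by apply: cvg_at_right_filter; exact: cB.
  - apply: cvgMl_tmp; apply: cvgM; first exact: powR_leftr.
    by apply: cvg_at_left_filter; exact: cB.
split.
  apply: oint_fin_integrable; first exact: jtail_ocont.
    by move=> u _; rewrite mulr_ge0 ?powR_ge0.
  by rewrite H ltry.
rewrite /Rintegral H /= /F subrr powR0 ?gt_eqF // mul0r mulr0 subr0 powR1 mul1r mulr1.
by rewrite sub0r mulNr opprK.
Qed.

(** In u = t^2 the law has density proportional to u^(-1/2) (1 - u)^(k-1). For u >= 1/2 the first
    power is bounded and q >= k + 1 leads to [jtail]; for u < 1/2, 1 + B (1 - u) >= (1 + B) / 2. At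
    k = 0 the law consists of two point masses, where the majorant is 1 and the claimed gain is
    trivial. *)
Lemma Jm_bound k q : 0 <= k -> k + 1 <= q%:R -> exists2 C, 0 < C & forall p c B,
  0 <= c -> 0 <= B -> (forall t, `|t| <= 1 -> `|p.[t]| <= c * jphi B q t) ->
  `|Jm k p| <= C * (c * (1 + B) `^ (- k)).
Proof.
rewrite le_eqVlt => /orP[/eqP <- _|k0 kq].
  exists 1 => // p c B c0 B0 hp; rewrite oppr0 powRr0 mulr1 mul1r.
  exact: Jm_bound0 hp.
have b0 : 0 < betaf (2^-1 : R) k by exact: betaf_gt0.
pose K : R := 1 + 2^-1 `^ (2^-1 - 1).
have K0 : 0 < K by rewrite ltr_pwDl // powR_ge0.
exists ((K / k + 2 `^ k * betaf 2^-1 k) / betaf 2^-1 k).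
  by rewrite divr_gt0 // addr_gt0 ?mulr_gt0 ?invr_gt0 ?powR_gt0.
move=> p c B c0 B0 hp.
have [hi hI] := Jm_integral p k0; have [ti tI] := jtail_int k0 B0.
have B1 : 0 < 1 + B by rewrite ltr_wpDr.
rewrite -(ler_pM2r b0) -{1}(gtr0_norm b0) -normrM hI mulrAC divfK; last by rewrite gt_eqF.
apply: (le_trans (le_normr_Rintegral _ hi)) => //.
pose G u := c * K * jtail k B u + c * 2 `^ k * (1 + B) `^ (- k) * bden 2^-1 k 1 u.
have bi := bden_int1 (_ : (0 : R) < 2^-1) k0.
have i1 : mu.-integrable `]0, 1[ (EFin \o (fun u => c * K * jtail k B u)).
  exact: (integrableZl _ (c * K) ti).
have i2 : mu.-integrable `]0, 1[ (EFin \o (fun u => c * 2 `^ k * (1 + B) `^ (- k) * bden 2^-1 k 1 u)).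
  by apply: (integrableZl _ (c * 2 `^ k * (1 + B) `^ (- k)) (bi _)).
apply: (@le_trans _ _ (Rintegral mu `]0, 1[ G)); last first.
  rewrite RintegralD // !RintegralZl ?tI //; last exact: bi.
  by rewrite -/(betaf _ _) le_eqVlt; apply/orP; left; apply/eqP; field; rewrite gt_eqF.
apply: le_Rintegral => //.
- exact: integrable_norm hi.
- exact: (integrableD _ i1 i2).
move=> u; rewrite /= in_itv /= => /andP[u0 u1].
have u1' : 0 < 1 - u by rewrite subr_gt0.
have hw : 1 <= 1 + B * (1 - u) by rewrite lerDl mulr_ge0 // ltW.
have hw0 : 0 < 1 + B * (1 - u) by apply: lt_le_trans hw.
have eb : `|evenv p u| <= c * ((1 + B * (1 - u)) ^+ q)^-1.
  have su : Num.sqrt u ^+ 2 = u by rewrite sqr_sqrtr // ltW.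
  have nu : `|Num.sqrt u| <= 1.
    by rewrite ger0_norm ?sqrtr_ge0 // -[leRHS]sqrtr1 ler_wsqrtr // ltW.
  rewrite -su even_horner normrM [X in _ * X]ger0_norm // ler_pdivrMr // mulr_natr mulr2n.
  apply: (le_trans (ler_normD _ _)); apply: lerD; first exact: hp.
  by rewrite -[X in 1 - X]sqrrN; apply: hp; rewrite normrN.
rewrite normrM [X in _ * X]ger0_norm ?bden_ge0 // /G.
have qk a : 1 <= a -> (a ^+ q)^-1 <= a `^ (- k - 1).
  move=> a1; have a0 : 0 < a by apply: lt_le_trans a1.
  rewrite -opprD powRN lef_pV2 ?posrE ?exprn_gt0 ?powR_gt0 // -(powR_mulrn q (ltW a0)).
  exact: ler_powR.
have h1 : 0 <= c * 2 `^ k * (1 + B) `^ (- k) * bden 2^-1 k 1 u.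
  by rewrite !mulr_ge0 ?powR_ge0 ?bden_ge0.
have h2 : 0 <= c * K * jtail k B u by rewrite !mulr_ge0 ?powR_ge0 // ltW.
have [hu|hu] := leP 2^-1 u.
- rewrite ler_wpDr //.
  apply: (@le_trans _ _ (c * (1 + B * (1 - u)) `^ (- k - 1) * bden 2^-1 k 1 u)).
    by rewrite ler_wpM2r ?bden_ge0 // (le_trans eb) // ler_wpM2l // qk.
  have hu' : u `^ (2^-1 - 1) <= K by apply: powR_half_bound; rewrite hu ltW.
  rewrite /jtail /bden; move: (powR_ge0 (1 - u) (k - 1)) (powR_ge0 (1 + B * (1 - u)) (- k - 1)) hu'.
  move: (u `^ _) ((1 - u) `^ _) ((1 + B * (1 - u)) `^ _) => Z Y X Y0 X0 hZ.
  have -> : c * X * (Z * Y) = (c * X * Y) * Z by ring.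
  have -> : c * K * (Y * X) = (c * X * Y) * K by ring.
  by rewrite ler_wpM2l // !mulr_ge0.
- rewrite ler_wpDl // ler_wpM2r ?bden_ge0 // (le_trans eb) // -mulrA ler_wpM2l //.
  apply: (le_trans (qk _ hw)).
  apply: (@le_trans _ _ ((1 + B * (1 - u)) `^ (- k))).
    by apply: ler_powR => //; lra.
  have -> : 2 `^ k * (1 + B) `^ (- k) = (((1 + B) / 2) `^ k)^-1.
    rewrite powRM ?invr_ge0 ?ltW // -(powR_inv1 (_ : 0 <= 2)) // -powRrM mulN1r !powRN.
    by rewrite invfM invrK mulrC.
  rewrite powRN lef_pV2 ?posrE ?powR_gt0 ?divr_gt0 //.
  apply: ge0_ler_powR; rewrite ?nnegrE ?divr_ge0 ?(ltW k0) ?(ltW B1) ?(ltW hw0) //.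
  have : 0 <= B * (2^-1 - u) by rewrite mulr_ge0 // subr_ge0 ltW.
  lra.
Qed.

End ProductFormula.

(** * Means over t as operators on polynomials *)

Section Averaging.
Variable R : realType.
Implicit Types (k B c M A u t w : R) (p F P G : {poly R}) (l m n q N : nat).

(* (Oop k c F)(A) is the expectation of F(A + c t), t being distributed as in Jm k. *)
Definition Oop k c F : {poly R} :=
  \sum_(l < size F) (jweight k l * c ^+ l.*2) *: F^`N(l.*2).

Lemma OopE N k c F : (size F <= N)%N ->
  Oop k c F = \sum_(l < N) (jweight k l * c ^+ l.*2) *: F^`N(l.*2).
Proof.
move=> h; rewrite /Oop (big_ord_widen N (fun l => (jweight k l * c ^+ l.*2) *: F^`N(l.*2)) h).
rewrite big_mkcond; apply: eq_bigr => l _; case: ltnP => // hl.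
rewrite nderivn_poly0 ?scaler0 // (leq_trans hl) // -addnn leq_addr //.
Qed.

Lemma OopD k c F G : Oop k c (F + G) = Oop k c F + Oop k c G.
Proof.
set N := maxn (size (F + G)) (maxn (size F) (size G)).
rewrite !(@OopE N) ?leq_max ?leqnn ?orbT // -big_split; apply: eq_bigr => l _ /=.
by rewrite nderivnD scalerDr.
Qed.

Lemma OopZ k c w F : Oop k c (w *: F) = w *: Oop k c F.
Proof.
set N := maxn (size (w *: F)) (size F).
rewrite !(@OopE N) ?leq_max ?leqnn ?orbT // scaler_sumr; apply: eq_bigr => l _ /=.
by rewrite nderivnZ !scalerA mulrC.
Qed.

Lemma comp_affine F c A : F \Po (A%:P + c *: 'X) = \poly_(i < size F) (F^`N(i).[A] * c ^+ i).
Proof.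
rewrite /comp_poly nderiv_taylor; last exact: mulrC.
rewrite size_map_polyC poly_def; apply: eq_bigr => i _.
by rewrite nderivn_map horner_map /= exprZn mul_polyC scalerA.
Qed.

Lemma horner_Oop k c F A : (Oop k c F).[A] = Jm k (F \Po (A%:P + c *: 'X)).
Proof.
have hs : (size (F \Po (A%:P + c *: 'X)) <= size F)%N by rewrite comp_affine size_poly.
rewrite (JmE _ hs) /Oop horner_sum; apply: eq_bigr => l _; rewrite hornerZ comp_affine coef_poly.
case: ltnP => hl; first by rewrite mulrC (mulrC (jweight _ _)) mulrA.
by rewrite nderivn_poly0 // horner0 mulr0 mul0r.
Qed.

(* The Oop operators map X^(2m)/(2m)! to polynomials of this shape. *)
Definition Phi m P : {poly R} :=
  \poly_(i < m.*2.+1) (if odd i then 0 else P`_(m - i./2) / i`!%:R).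

Definition gser k w m : {poly R} := \poly_(l < m.+1) (w ^+ l / (l`!%:R * poch (k + 2^-1) l)).

(** The moments (1/2)_l cancel against (2l)! = 4^l l! (1/2)_l, whence also c^2 = 4 w. Successive
    means over different coordinates so become a product of power series, which is the product
    defining [ee]. *)
Lemma Oop_Phi m k c w P : c ^+ 2 = 4 * w -> 0 <= k -> Oop k c (Phi m P) = Phi m (gser k w m * P).
Proof.
move=> cw k0; apply/polyP => i.
have sP : (size (Phi m P) <= m.*2.+1)%N by exact: size_poly.
rewrite (OopE k c sP) coef_sum /Phi coef_poly.
have cE l : (c ^+ l.*2) = 4 ^+ l * w ^+ l by rewrite -muln2 mulnC exprM cw exprMn.
have kh : 0 < k + 2^-1 by rewrite ltr_wpDl.
under eq_bigr do rewrite coefZ coef_nderivn coef_poly.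
case: ifPn => [hi|hi]; last first.
  rewrite big1 // => l _; case: ltnP => h; last by rewrite mul0rn mulr0.
  by move: hi; rewrite (leq_ltn_trans _ h) // leq_addl.
case: ifPn => oi.
  rewrite big1 // => l _; rewrite oddD odd_double oi /=.
  by case: ifP => _; rewrite mul0rn mulr0.
have ie : i = i./2.*2 by rewrite -[LHS]odd_double_half (negbTE oi).
set r := i./2 in ie *; have rm : (r <= m)%N by move: hi; lia.
rewrite coefM mulr_suml.
transitivity (\sum_(l < (m - r).+1) (gser k w m)`_l * P`_(m - r - l) / i`!%:R); last by [].
pose F l : R := jweight k l * c ^+ l.*2 *
   ((if (l.*2 + i < m.*2.+1)%N then if odd (l.*2 + i) then 0 else P`_(m - (l.*2 + i)./2) / (l.*2 + i)`!%:R else 0) *+ 'C(l.*2 + i, l.*2)).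
transitivity (\sum_(l < m.*2.+1) F l); first by [].
rewrite (@sum_ord_ext R F (m - r).+1); last 2 first.
- by rewrite ltnS; lia.
- by move=> j hj; rewrite /F ifF ?mul0rn ?mulr0 //; apply/negbTE; rewrite -leqNgt; lia.
apply: eq_bigr => l _; have hl : (l <= m - r)%N by rewrite -ltnS.
rewrite /F ifT; last by lia.
rewrite oddD odd_double (negbTE oi) /= coef_poly ltnS ifT; last by lia.
have -> : (m - (l.*2 + i)./2 = m - r - l)%N by rewrite ie -doubleD doubleK; lia.
rewrite cE /jweight -(mulr_natr (P`_(m - r - l) / _)).
have hb : (l.*2 <= l.*2 + i)%N by exact: leq_addr.
have := bin_fact hb; rewrite addKn => <-; rewrite !natrM poch_half.
have h1 := factr_neq0 R l; have h2 := factr_neq0 R i.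
have h3 : 'C(l.*2 + i, l.*2)%:R != 0 :> R by rewrite pnatr_eq0 -lt0n bin_gt0.
have h4 : poch (k + 2^-1) l != 0 by exact: poch_neq0.
have h5 : poch (2^-1) l != 0 :> R by exact: poch_neq0.
have h6 : 4 ^+ l != 0 :> R by rewrite expf_neq0 // pnatr_eq0.
move: (l`!%:R : R) (i`!%:R : R) ('C(_, _)%:R : R) (poch (k + _) l) (poch 2^-1 l : R) (4 ^+ l : R) (w ^+ l) P`_(_ - _) h1 h2 h3 h4 h5 h6.
move=> x1 x2 x3 x4 x5 x6 x7 x8 h1 h2 h3 h4 h5 h6.
by field; rewrite h1 h2 h3 h4 h5 h6.
Qed.

Lemma horner0_Phi m P : (Phi m P).[0] = P`_m.
Proof. by rewrite horner_coef0 coef_poly /= subn0 fact0 divr1. Qed.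

Definition Ydiv n : {poly R} := (n`!%:R)^-1 *: 'X^n.

Lemma Ydiv_Phi m : Ydiv m.*2 = Phi m 1.
Proof.
apply/polyP => i; rewrite coefZ coefXn coef_poly coef1.
case: (ltngtP i m.*2) => hi; last first.
- by rewrite hi ltnSn odd_double doubleK subnn mulr1 mul1r.
- by rewrite ltnS leqNgt hi mulr0.
- rewrite ltnS (ltnW hi) mulr0; case: ifP => // oi.
  by rewrite (_ : (m - i./2 == 0)%N = false) ?mul0r //; apply/negbTE; lia.
Qed.

Section Family.
Variable I : eqType.
Variables (kap c : I -> R).

Definition Ep (s : seq I) F : {poly R} := foldr (fun i G => Oop (kap i) (c i) G) F s.

Lemma EpD s F G : Ep s (F + G) = Ep s F + Ep s G.
Proof. by elim: s => //= i s ->; rewrite OopD. Qed.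

Lemma EpZ s w F : Ep s (w *: F) = w *: Ep s F.
Proof. by elim: s => //= i s ->; rewrite OopZ. Qed.

Lemma Ep0 s : Ep s 0 = 0.
Proof. by have := EpZ s 0 0; rewrite !scale0r. Qed.

Lemma Ep_sum s (J : Type) (r : seq J) (H : J -> {poly R}) :
  Ep s (\sum_(j <- r) H j) = \sum_(j <- r) Ep s (H j).
Proof. by elim: r => [|j r IH]; rewrite ?big_nil ?Ep0 // !big_cons EpD IH. Qed.

Lemma Ep_Ydiv s m (w : I -> R) : (forall i, 0 <= kap i) -> (forall i, c i ^+ 2 = 4 * w i) ->
  (Ep s (Ydiv m.*2)).[0] = (\prod_(i <- s) gser (kap i) (w i) m)`_m.
Proof.
move=> k0 cw; rewrite -horner0_Phi; congr (_.[0]); rewrite Ydiv_Phi.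
elim: s => [|i s IH] /=; first by rewrite big_nil.
by rewrite IH (@Oop_Phi _ _ _ (w i)) // big_cons.
Qed.

(** One coordinate is averaged at a time; A carries the part of the argument already fixed, so the
    induction is over all A and M. As the indices are distinct, each t_i is chosen independently of
    the others. *)
Lemma Ep_bound q (B D : I -> R) (C : I -> R) :
  (forall i, 0 <= B i) -> (forall i, 0 <= D i) -> (forall i, 0 <= C i) ->
  (forall i p M, 0 <= M -> (forall t, `|t| <= 1 -> `|p.[t]| <= M * (D i * jphi (B i) q t)) ->
     `|Jm (kap i) p| <= M * C i) ->
  forall s F M A, uniq s -> 0 <= M ->
  (forall t : I -> R, (forall i, `|t i| <= 1) ->
     `|F.[A + \sum_(i <- s) c i * t i]| <= M * \prod_(i <- s) (D i * jphi (B i) q (t i))) ->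
  `|(Ep s F).[A]| <= M * \prod_(i <- s) C i.
Proof.
move=> B0 D0 C0 HJ; elim=> [|i s IH] F M A.
  move=> _ M0 /(_ (fun=> 0)); rewrite !big_nil addr0; apply => i.
  by rewrite normr0.
rewrite [uniq _]/= => /andP[nis us] M0 hF.
rewrite /= horner_Oop big_cons mulrCA mulrC.
apply: HJ.
  by rewrite mulr_ge0 // prodr_ge0.
move=> t t1; rewrite horner_comp hornerD hornerZ hornerX hornerC mulrAC.
have p0 : 0 <= jphi (B i) q t.
  by rewrite invr_ge0 exprn_ge0 // addr_ge0 // mulr_ge0 // subr_ge0 -real_normK ?num_real // exprn_ile1.
apply: IH => //; first by rewrite !mulr_ge0.
move=> t' ht'.
pose t'' j := if j == i then t else t' j.
have := hF t'' _; rewrite !big_cons /t'' eqxx.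
have E (a b : R) (h : I -> R -> R): \sum_(j <- s) h j (if j == i then t else t' j) = \sum_(j <- s) h j (t' j).
  apply: eq_big_seq => j js; case: eqP => // ji; by move: nis; rewrite -ji js.
have E2 (h : I -> R -> R): \prod_(j <- s) h j (if j == i then t else t' j) = \prod_(j <- s) h j (t' j).
  apply: eq_big_seq => j js; case: eqP => // ji; by move: nis; rewrite -ji js.
rewrite (E 0 0 (fun j x => c j * x)) (E2 (fun j x => D j * jphi (B j) q x)) addrA.
move=> H; have {}H := H _; rewrite -!mulrA !mulrA in H *; apply: H.
by move=> j; case: ifP.
Qed.

End Family.
End Averaging.

(** * One-variable kernels *)

Section ZonalKernel.
Variable R : realType.
Implicit Types (T s z : R) (n m j N : nat).

(* Christoffel-Darboux kernel at the endpoint s = 1 for the weight s^(-1/2) (1-s)^(T-3/2). *)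
Definition Kp T n s : R := \sum_(m < n.+1) kcoef T n m / (m`!%:R * poch 2^-1 m) * s ^+ m.
Definition Qp T n s : R := if n is n'.+1 then Kp T n s - Kp T n' s else Kp T 0 s.
(** The polynomial z -> [Kp T n (z ^+ 2)] written in the variable 2 z; the 2 matches the step 2 sqrt
    (x_i y_i) forced by c^2 = 4 w. *)
Definition Yp T n : {poly R} := \sum_(m < n.+1) kcoef T n m *: Ydiv R m.*2.

Lemma horner_Yp T n z : (Yp T n).[2 * z] = Kp T n (z ^+ 2).
Proof.
rewrite /Yp horner_sum; apply: eq_bigr => m _.
rewrite !hornerZ hornerXn exprMn -mulrA; congr (_ * _).
rewrite poch_half -muln2 (mulnC m 2) !exprM.
have h1 := factr_neq0 R m; have h5 : poch 2^-1 m != 0 :> R by exact: poch_neq0.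
have h6 : (2 ^+ 2) ^+ m != 0 :> R by rewrite !expf_neq0 // pnatr_eq0.
have -> : 4 = 2 ^+ 2 :> R by rewrite expr2 -natrM.
move: ((2 ^+ 2) ^+ m : R) (m`!%:R : R) (poch _ m) h1 h5 h6 => u v w h1 h5 h6.
by field; rewrite h1 h5 h6.
Qed.

Lemma Kp_sum T n s : \sum_(j < n.+1) Qp T j s = Kp T n s.
Proof.
elim: n => [|n IH]; first by rewrite big_ord1.
by rewrite big_ord_recr IH /= addrC subrK.
Qed.

Lemma signrB m n : (m <= n)%N -> (-1) ^+ (n - m) = (-1) ^+ n * (-1) ^+ m :> R.
Proof. by move=> mn; rewrite -signr_odd oddB // signr_addb !signr_odd. Qed.

Lemma Kp_one T n : 0 < T ->
  Kp T n 1 = poch T n / n`!%:R * (poch (T + 2^-1) n / poch 2^-1 n).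
Proof.
move=> T0; have c0 i : (2^-1 : R) + i%:R != 0 by rewrite gt_eqF // ltr_wpDr.
have := chu_vandermonde (T + n%:R) n c0 => E.
(* Reversing the order of the factors gives (1/2 - T - n)_n = (-1)^n (T + 1/2)_n. *)
have -> : poch (T + 2^-1) n / poch 2^-1 n = (-1) ^+ n * (poch (2^-1 - (T + n%:R)) n / poch 2^-1 n).
  rewrite mulrA; congr (_ / _).
  have -> : (-1) ^+ n = \prod_(i < n) (-1) :> R by rewrite prodr_const card_ord.
  rewrite /poch (reindex_inj rev_ord_inj) /= -big_split; apply: eq_bigr => i _ /=.
  by rewrite natrB; [rewrite -natr1; field | exact: ltn_ord].
rewrite -E !mulr_sumr; apply: eq_bigr => m _; rewrite expr1n mulr1 /kcoef.
have mn : (m <= n)%N by rewrite -ltnS.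
rewrite [(m + n)%N]addnC pochD -(bin_fact mn) !natrM.
rewrite (signrB mn).
have h1 := factr_neq0 R m; have h2 := factr_neq0 R (n - m).
have h3 : 'C(n, m)%:R != 0 :> R by rewrite pnatr_eq0 -lt0n bin_gt0.
have h4 : poch 2^-1 m != 0 :> R by exact: poch_neq0.
move: (m`!%:R : R) ((n - m)`!%:R : R) ('C(_, _)%:R : R) (poch 2^-1 m : R) (poch T n) (poch (T + _) m) ((-1) ^+ n : R) ((-1) ^+ m : R) h1 h2 h3 h4.
move=> x1 x2 x3 x4 x5 x6 x7 x8 h1 h2 h3 h4.
by field; rewrite h1 h2 h3 h4.
Qed.

Lemma Kp_one_gt0 T n : 0 < T -> 0 < Kp T n 1.
Proof.
move=> T0; rewrite Kp_one // mulr_gt0 ?divr_gt0 ?poch_gt0 ?factr_gt0 //.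
by rewrite addr_gt0.
Qed.

(* Summation by parts raises the parameter T. *)
Lemma Kp_Qp T n s : 0 < T -> Kp T n s = T / (2 * n%:R + T) * Qp (T + 1) n s.
Proof.
move=> T0; have c0 : 2 * n%:R + T != 0 by rewrite gt_eqF // ltr_wpDl // mulr_ge0.
apply: (mulfI c0); rewrite mulrA mulrCA divff // mulr1.
case: n c0 => [|n] c0.
  rewrite /Qp /Kp !big_ord1 /kcoef /= subnn !addn0 !poch0; ring.
rewrite /Qp /Kp [in RHS]big_ord_recr [in LHS]big_ord_recr /=.
rewrite addrAC -sumrB mulrDr [RHS]mulrDr; congr (_ + _).
  rewrite !mulr_sumr; apply: eq_bigr => m _; rewrite -mulrBl !mulrA; congr (_ * _).
  rewrite -mulrBl !mulrA; congr (_ / _).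
  have mn : (m <= n)%N by rewrite -ltnS.
  rewrite /kcoef subSn // factS natrM exprS addnS pochS.
  have pE : T * poch (T + 1) (m + n) = poch T (m + n) * (T + (m + n)%:R) by rewrite -pochSl pochS.
  have T0' : T != 0 by rewrite gt_eqF.
  have -> : poch T (m + n) = T * poch (T + 1) (m + n) / (T + (m + n)%:R).
    by rewrite pE mulfK // gt_eqF // ltr_wpDr.
  have h1 := factr_neq0 R (n - m); have h2 : (n - m).+1%:R != 0 :> R by rewrite pnatr_eq0.
  have h3 : T + (m + n)%:R != 0 by rewrite gt_eqF // ltr_wpDr.
  have h4 : poch (T + 1) (m + n).+1 = poch (T + 1) (m + n) * (T + 1 + (m + n)%:R) by rewrite pochS.
  rewrite h4 -(natr1 n); move: h2 h3; rewrite -(natr1 (n - m)) natrB // natrD => h2 h3.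
  move: (poch (T + 1) (m + n)) ((n - m)`!%:R : R) h1 => x1 x2 h1.
  move: (m%:R : R) (n%:R : R) h2 h3 => x3 x4 h2 h3.
  by field; rewrite h1 h2 h3.
rewrite !mulrA; congr (_ * _); congr (_ / _).
rewrite /kcoef subnn fact0 expr0 !mulr1 !divr1 -pochSl pochS mulrC.
by rewrite natrD; congr (_ * _); ring.
Qed.

Lemma Kp_abel T (a : nat -> R) N s : 0 < T -> a N = 0 ->
  \sum_(j < N) a j * Qp T j s =
  \sum_(j < N) (T * (a j - a j.+1) / (2 * j%:R + T)) * Qp (T + 1) j s.
Proof.
move=> T0 aN.
have E M : \sum_(j < M) a j * Qp T j s =
    \sum_(j < M) (a j - a j.+1) * Kp T j s + (if M is M'.+1 then a M * Kp T M' s else 0).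
  elim: M => [|M IH]; first by rewrite !big_ord0 addr0.
  rewrite !big_ord_recr /= IH; case: M {IH} => [|M] /=; last by ring.
  by rewrite !big_ord0; ring.
rewrite E; case: N aN {E} => [|N] aN; first by rewrite !big_ord0 addr0.
rewrite aN mul0r addr0; apply: eq_bigr => j _; rewrite Kp_Qp //.
by rewrite mulrA; congr (_ * _); rewrite mulrCA mulrA.
Qed.

Fixpoint adiff T (a : nat -> R) (k : nat) : nat -> R :=
  if k is k'.+1 then fun j => (T + k'%:R) * (adiff T a k' j - adiff T a k' j.+1) / (2 * j%:R + (T + k'%:R))
  else a.

Lemma adiff_vanish T a k N : (forall j, (N <= j)%N -> a j = 0) ->
  forall j, (N <= j)%N -> adiff T a k j = 0.
Proof.
move=> h; elim: k => [|k IH] j hj /=; first exact: h.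
by rewrite !IH ?leqW // subrr mulr0 mul0r.
Qed.

Lemma adiff_sum T a N k s : 0 < T -> (forall j, (N <= j)%N -> a j = 0) ->
  \sum_(j < N) a j * Qp T j s = \sum_(j < N) adiff T a k j * Qp (T + k%:R) j s.
Proof.
move=> T0 h; elim: k => [|k ->]; first by rewrite addr0.
rewrite Kp_abel; first by rewrite -(natr1 k) addrA.
- by rewrite ltr_wpDr.
- exact: adiff_vanish h _ _.
Qed.

Lemma Kker_Ep d (kappa : 'I_d.+1 -> R) n x y : (forall i, 0 <= kappa i) ->
  in_simplex x -> in_simplex y ->
  Kker kappa n x y = (Cnorm kappa)^-1 *
    (Ep kappa (fun i => 2 * Num.sqrt (xext x i * xext y i)) (index_enum _) (Yp (thsum kappa) n)).[0].
Proof.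
move=> k0 /in_simplexP hx /in_simplexP hy; rewrite /Kker /Yp Ep_sum horner_sum; congr (_ * _).
apply: eq_bigr => m _; rewrite EpZ hornerZ; congr (_ * _).
rewrite (@Ep_Ydiv R _ kappa _ _ m (fun i => xext x i * xext y i)) //.
by move=> i; rewrite exprMn sqr_sqrtr ?mulr_ge0 // expr2 -natrM.
Qed.

Lemma sum_sqrt_le1 d (x y : 'I_d -> R) : in_simplex x -> in_simplex y ->
  \sum_i Num.sqrt (xext x i * xext y i) <= 1.
Proof.
move=> /in_simplexP hx /in_simplexP hy.
apply: (@le_trans _ _ (\sum_i (xext x i + xext y i) / 2)).
  apply: ler_sum => i _; rewrite sqrtrM //.
  have := sqr_ge0 (Num.sqrt (xext x i) - Num.sqrt (xext y i)).
  by rewrite sqrrB !sqr_sqrtr // ler_pdivlMr //; lra.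
by rewrite -mulr_suml big_split /= !xext_sum; lra.
Qed.

(** Cauchy-Schwarz for f(x) as the integral of f against the kernel, obtained from the nonnegativity
    of the integral of (f - w K)^2 with the optimal w = f(x) / K. *)
Lemma CS_kernel d (kappa : 'I_d.+1 -> R) n f x : (forall i, 0 <= kappa i) -> bspan n f ->
  f x ^+ 2 <= Kker kappa n x x * Ifun kappa (fun y => f y ^+ 2).
Proof.
move=> k0 hf.
set K := Kker kappa n x x; set I2 := Ifun _ _.
have hK := bspan_Kker kappa n x.
have key w : 0 <= I2 - 2 * w * f x + w ^+ 2 * K.
  have : 0 <= Ifun kappa (fun y => (f y - w * Kker kappa n x y) ^+ 2).
    by apply: Ifun_ge0 => y _; exact: sqr_ge0.
  have b1 := bspanM hf hf; have b2 := bspanM hf hK; have b3 := bspanM hK hK.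
  rewrite (@eq_Ifun _ _ _ _ (fun y => (f y * f y + (- (2 * w)) * (f y * Kker kappa n x y)) + w ^+ 2 * (Kker kappa n x y * Kker kappa n x y))); last first.
    by move=> y _; ring.
  rewrite (IfunD k0 (bspanD b1 (bspanZ _ b2)) (bspanZ _ b3)) (IfunD k0 b1 (bspanZ _ b2)).
  rewrite (IfunZ k0 _ b2) (IfunZ k0 _ b3) !Kker_repro // -/K.
  have -> : Ifun kappa (fun y => f y * f y) = I2.
    by apply: eq_Ifun => y _; rewrite expr2.
  by rewrite mulNr.
have K0 : 0 <= K.
  rewrite /K -(Kker_repro k0 x hK); apply: Ifun_ge0 => y _; rewrite -expr2; exact: sqr_ge0.
(* If K = 0 the quadratic in w is affine, and it can be nonnegative for all w only when f(x) = 0. *)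
have [Kz|Kp0] := eqVneq K 0.
  have [->|fx] := eqVneq (f x) 0; first by rewrite expr0n /= Kz mul0r.
  have := key ((I2 + 1) / (2 * f x)); rewrite Kz mulr0 addr0.
  rewrite (_ : 2 * _ * f x = I2 + 1); last by field.
  by lra.
have {}Kp0 : 0 < K by rewrite lt_neqAle eq_sym Kp0.
have := key (f x / K).
rewrite (_ : _ + _ = I2 - f x ^+ 2 / K); last by field; rewrite gt_eqF.
by rewrite subr_ge0 ler_pdivrMr // mulrC.
Qed.

End ZonalKernel.

(** * The one-variable kernels as the case d = 1 *)

Section OneDim.
Variable R : realType.
Implicit Types (T s z : R) (n m j N k : nat).

Definition pt s : 'I_1 -> R := fun=> s.
(** With these parameters the th_i are 1/2 and T - 1/2, of sum T; at the end point s = 1 the other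
    coordinate is 0, so only the series with th = 1/2 survives, and this is [Kp]. *)
Definition kap1 T : 'I_2 -> R := fun i => if i == ord_max then T - 1 else 0.

Lemma big_ord2 (S : Type) (idx : S) (op : Monoid.law idx) (F : 'I_2 -> S) :
  \big[op/idx]_i F i = op (F (widen_ord (leqnSn _) ord_max)) (F ord_max).
Proof. by rewrite big_ord_recr /= big_ord1 (ord1_max ord0). Qed.

Lemma kap1E T : kap1 T (widen_ord (leqnSn _) ord_max) = 0 /\ kap1 T ord_max = T - 1.
Proof. by rewrite /kap1 eqxx. Qed.

Lemma xext1 s : xext (pt s) (widen_ord (leqnSn _) ord_max) = s /\ xext (pt s) ord_max = 1 - s.
Proof. by rewrite xext_widen xext_max big_ord1. Qed.

Lemma pt_eta (y : 'I_1 -> R) : y = pt (y ord_max).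
Proof. by apply/funext => i; rewrite (ord1_max i). Qed.

Lemma pt_simplex s : in_simplex (pt s) = (0 <= s <= 1).
Proof.
apply/idP/idP => [/in_simplexP h|/andP[h1 h2]].
  have := h (widen_ord (leqnSn _) ord_max); have := h ord_max.
  by rewrite (xext1 s).1 (xext1 s).2 subr_ge0 => -> ->.
apply/in_simplexP/forall_ord_recr; rewrite (xext1 s).2 subr_ge0; split => // i.
by rewrite xext_widen.
Qed.

Lemma kap1_ge0 T i : 1 <= T -> 0 <= kap1 T i.
Proof. by move=> T1; rewrite /kap1; case: ifP => // _; rewrite subr_ge0. Qed.

Lemma thsum_kap1 T : thsum (kap1 T) = T.
Proof. by rewrite /thsum big_ord2 /th (kap1E T).1 (kap1E T).2 /=; field. Qed.

Lemma Kker1 T n s : Kker (kap1 T) n (pt 1) (pt s) = (Cnorm (kap1 T))^-1 * Kp T n s.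
Proof.
rewrite /Kker thsum_kap1; congr (_ * _); apply: eq_bigr => m _; rewrite /ee big_ord2 /=.
rewrite !(xext1 _).1 !(xext1 _).2 subrr mul0r mul1r /th (kap1E T).1 add0r.
have -> : \poly_(l < m.+1) (0 ^+ l / (l`!%:R * poch (kap1 T ord_max + 2^-1) l)) = 1 :> {poly R}.
  apply/polyP => l; rewrite coef_poly coef1 expr0n.
  by case: l => [|l] /=; rewrite ?fact0 ?poch0 ?mul0r ?mulr1 ?divr1 //; case: ifP.
by rewrite mulr1 coef_poly ltnSn mulrA mulrAC.
Qed.

Lemma Qker1 T n s : Qker (kap1 T) n (pt 1) (pt s) = (Cnorm (kap1 T))^-1 * Qp T n s.
Proof. by case: n => [|n] /=; rewrite !Kker1 // mulrBr. Qed.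

Section WithT.
Variable T : R.
Hypothesis T1 : 1 <= T.
Local Notation C := (Cnorm (kap1 T)).
Let k0 i : 0 <= kap1 T i. Proof. exact: kap1_ge0. Qed.
Let C0 : 0 < C. Proof. exact/Cnorm_gt0/k0. Qed.

Lemma Qker1_orthonormal i j :
  Ifun (kap1 T) (fun y => Qker (kap1 T) i (pt 1) y * Qker (kap1 T) j (pt 1) y) =
  (i == j)%:R * Qker (kap1 T) i (pt 1) (pt 1).
Proof.
have sym i' j' : Ifun (kap1 T) (fun y => Qker (kap1 T) i' (pt 1) y * Qker (kap1 T) j' (pt 1) y) =
   Ifun (kap1 T) (fun y => Qker (kap1 T) j' (pt 1) y * Qker (kap1 T) i' (pt 1) y).
  by apply: eq_Ifun => y _; rewrite mulrC.
case: (ltngtP i j) => ij; last 1 first.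
- rewrite -ij mul1r {j ij}; have hb := bspan_Qker (kap1 T) i (pt 1).
  rewrite (Qker_IfunE k0 _ _ hb) Kker_repro //.
  case: i hb => [|i] hb; first by rewrite subr0.
  rewrite (@eq_Ifun _ _ _ _ (fun y => Kker (kap1 T) i (pt 1) y * Qker (kap1 T) i.+1 (pt 1) y)); last first.
    by move=> y _; rewrite mulrC.
  by rewrite (Qker_orth k0 _ (ltnSn i) (bspan_Kker _ _ _)) subr0.
- by rewrite mul0r (Qker_orth k0 _ ij (bspan_Qker _ _ _)).
- by rewrite mul0r sym (Qker_orth k0 _ ij (bspan_Qker _ _ _)).
Qed.

Lemma bspan_Qp j : bspan j (fun y : 'I_1 -> R => Qp T j (y ord_max)).
Proof.
have := bspanZ C (bspan_Qker (kap1 T) j (pt 1)); apply: eq_bspan => y.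
by rewrite {1}(pt_eta y) Qker1 mulrA divff ?mul1r // gt_eqF.
Qed.

Lemma Qp_orth i j : Ifun (kap1 T) (fun y : 'I_1 -> R => Qp T i (y ord_max) * Qp T j (y ord_max)) =
  (i == j)%:R * (C * Qp T i 1).
Proof.
have E j' y : Qp T j' (y ord_max) = C * Qker (kap1 T) j' (pt 1) y.
  by rewrite {2}(pt_eta y) Qker1 mulrA divff ?mul1r // gt_eqF.
have hb := bspanM (bspan_Qker (kap1 T) i (pt 1)) (bspan_Qker (kap1 T) j (pt 1)).
transitivity (Ifun (kap1 T) (fun y => C ^+ 2 * (Qker (kap1 T) i (pt 1) y * Qker (kap1 T) j (pt 1) y))).
  by apply: eq_Ifun => y _; rewrite !E; ring.
rewrite (IfunZ k0 _ hb) Qker1_orthonormal Qker1.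
by field; rewrite gt_eqF.
Qed.

Lemma Qp_one_ge0 j : 0 <= Qp T j 1.
Proof.
have := Qp_orth j j; rewrite eqxx mul1r => h.
rewrite -(pmulr_rge0 _ C0) -h; apply: Ifun_ge0 => y _.
by rewrite -expr2 sqr_ge0.
Qed.

Lemma Qp_parseval (a : nat -> R) N :
  Ifun (kap1 T) (fun y : 'I_1 -> R => (\sum_(j < N) a j * Qp T j (y ord_max)) ^+ 2) =
  C * \sum_(j < N) a j ^+ 2 * Qp T j 1.
Proof.
have hb j : bspan j (fun y : 'I_1 -> R => Qp T j (y ord_max)) := bspan_Qp j.
have hN (j : 'I_N) : bspan N (fun y : 'I_1 -> R => Qp T j (y ord_max)).
  by apply: bspan_mono (hb j); exact/ltnW/ltn_ord.
rewrite (@eq_Ifun _ _ _ _ (fun y : 'I_1 -> R => \sum_(i < N) a i * (\sum_(j < N) a j * (Qp T i (y ord_max) * Qp T j (y ord_max))))); last first.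
  move=> y _; rewrite expr2 mulr_suml; apply: eq_bigr => i _; rewrite -mulrA mulr_sumr; congr (_ * _).
  by apply: eq_bigr => j _; rewrite mulrCA.
have hi (i : 'I_N) : bspan (N + N) (fun y : 'I_1 -> R => \sum_(j < N) a j * (Qp T i (y ord_max) * Qp T j (y ord_max))).
  by apply: bspan_sum => j _; apply/bspanZ/bspanM.
rewrite (@Ifun_sum _ _ _ k0 (N + N)); last by move=> i _; exact: bspanZ.
rewrite mulr_sumr; apply: eq_bigr => i _; rewrite (IfunZ k0 _ (hi i)).
rewrite (@Ifun_sum _ _ _ k0 (N + N)); last by move=> j _; apply/bspanZ/bspanM.
rewrite (bigD1 i) //= big1 ?addr0; last first.
  move=> j ji; rewrite (IfunZ k0 _ (bspanM (hN i) (hN j))) Qp_orth.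
  by rewrite (_ : (i == j :> nat) = false) ?mul0r ?mulr0 //; rewrite eq_sym; exact/negbTE.
rewrite (IfunZ k0 _ (bspanM (hN i) (hN i))) Qp_orth eqxx mul1r; ring.
Qed.

Lemma wk_kap1 k s : 0 <= s <= 1 ->
  wk (kap1 (T + k%:R)) (pt s) = (1 - s) ^+ k * wk (kap1 T) (pt s).
Proof.
move=> /andP[s0 s1]; rewrite /wk !big_ord2 /= !(xext1 s).1 !(xext1 s).2 !(kap1E _).1 !(kap1E _).2.
rewrite mulrCA; congr (_ * _).
case: k => [|k]; first by rewrite addr0 expr0 mul1r.
have [->|h] := eqVneq s 1.
  rewrite subrr expr0n /= mul0r powR0 //.
  rewrite gt_eqF // -natr1; have := ler0n R k; move: T1; lra.
have p : 0 < 1 - s by rewrite subr_gt0 lt_neqAle h.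
by rewrite -powR_mulrn ?(ltW p) // -powRD_gt0 //; congr (_ `^ _); ring.
Qed.

Lemma Ifun_kap1 k f : Ifun (kap1 (T + k%:R)) f =
  Ifun (kap1 T) (fun y : 'I_1 -> R => (1 - y ord_max) ^+ k * f y).
Proof.
rewrite /Ifun; congr iint; apply/funext => y; case: ifP => // hy.
rewrite (pt_eta y) pt_simplex in hy *.
by rewrite wk_kap1 // mulrCA mulrA.
Qed.

Lemma Cnorm_kap1 k : Cnorm (kap1 (T + k%:R)) = C * (poch (T - 2^-1) k / poch T k).
Proof.
have k0' i : 0 <= kap1 (T + k%:R) i by apply: kap1_ge0; rewrite (le_trans T1) // lerDl.
have wf : (widen_ord (leqnSn 1) ord_max == ord_max :> 'I_2) = false by [].
pose e k' (i : 'I_2) := if i == ord_max then k' else 0%N.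
have ek k' : bmon (e k') =1 (fun y : 'I_1 -> R => (1 - y ord_max) ^+ k').
  by move=> y; rewrite /bmon big_ord2 /= /e eqxx wf expr0 mul1r {1}(pt_eta y) (xext1 _).2.
have m0 : moment (kap1 (T + k%:R)) (e 0%N) = Cnorm (kap1 (T + k%:R)).
    by rewrite /moment !big_ord2 /= /e eqxx wf addn0 !poch0 mul1r divr1 mulr1.
rewrite -m0 -Ifun_mono // Ifun_kap1.
transitivity (Ifun (kap1 T) (bmon (e k))).
  by apply: eq_Ifun => y _; rewrite !ek expr0 mulr1.
rewrite Ifun_mono // /moment !big_ord2 /= /e eqxx wf poch0 mul1r add0n thsum_kap1 /th (kap1E T).2.
by congr (_ * (poch _ _ / _)); field.
Qed.

(* The kernel at the endpoint is bounded by its value at 1: its maximum M on [0,1] satisfies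
   M^2 <= const * Kp(1) M by Cauchy-Schwarz and the product formula. *)
Lemma Kp_bound : exists2 D, 0 < D & forall n,
  (forall s, 0 <= s <= 1 -> `|Kp T n s| <= D * Kp T n 1) /\
  (forall s, 0 <= s <= 1 -> Kker (kap1 T) n (pt s) (pt s) <= D * Kp T n 1).
Proof.
have [q hq] : exists q, forall i, kap1 T i + 1 <= q%:R.
  exists (Num.bound T) => i; apply: (@le_trans _ _ T).
    by rewrite /kap1; case: ifP => _; rewrite ?subrK // add0r.
  by apply/ltW/archi_boundP; apply: le_trans T1.
have hJ i := Jm_bound (k0 i) (hq i).
pose Cj i := s2val (cid2 (hJ i)).
have Cj0 i : 0 < Cj i by rewrite /Cj; case: cid2.
have CjP i p M : 0 <= M -> (forall t, `|t| <= 1 -> `|p.[t]| <= M * (1 * jphi 0 q t)) -> `|Jm (kap1 T i) p| <= M * Cj i.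
  move=> M0 hp; rewrite /Cj; case: cid2 => c c0 /= /(_ p M 0 M0 (lexx 0)).
  rewrite addr0 powR1 mulr1 mulrC; apply => t ht.
  by have := hp t ht; rewrite mul1r.
pose E := \prod_(i <- index_enum 'I_2) Cj i.
have E0 : 0 < E by apply: prodr_gt0.
(* By the product formula the diagonal value is a mean of values of [Kp] on [0, 1]; taking B = 0 in
   [Jm_bound] leaves just the constants of the means. *)
have diag n M s : 0 <= s <= 1 -> 0 <= M -> (forall u, 0 <= u <= 1 -> `|Kp T n u| <= M) ->
    Kker (kap1 T) n (pt s) (pt s) <= C^-1 * (E * M).
  move=> hs M0 hM; have ps : in_simplex (pt s) by rewrite pt_simplex.
  rewrite (Kker_Ep _ k0 ps ps) ler_pM2l ?invr_gt0 //; apply: le_trans (ler_norm _) _.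
  rewrite mulrC; apply: (@Ep_bound R _ (kap1 T) _ q (fun=> 0) (fun=> 1) Cj) => //.
  - by move=> i; exact: ltW.
  - exact: index_enum_uniq.
  move=> t ht; rewrite add0r [X in _ * X]big1 => [|i _]; last first.
    by rewrite /= /jphi mul0r addr0 expr1n invr1 mul1r.
  rewrite mulr1 thsum_kap1; under eq_bigr do rewrite -mulrA.
  rewrite -mulr_sumr horner_Yp; apply: hM; rewrite sqr_ge0 /= -real_normK ?num_real //.
  rewrite exprn_ile1 //; apply: le_trans (sum_sqrt_le1 ps ps).
  apply: le_trans (ler_norm_sum _ _ _) _; apply: ler_sum => i _.
  by rewrite normrM ger0_norm ?sqrtr_ge0 // ler_piMr ?sqrtr_ge0.
pose D := E + 1.
have main n s : 0 <= s <= 1 -> `|Kp T n s| <= E * Kp T n 1.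
  move=> hs.
  have cont : {within `[0, 1], continuous (fun s => `|Kp T n s|)}.
    apply: continuous_subspaceT => u; apply: (@cvg_comp _ _ _ (Kp T n) (fun u : R => `|u|)); last exact: norm_continuous.
    rewrite /Kp; apply: cvg_big => //; first exact: add_continuous.
    by move=> l _; apply: cvgMl_tmp; exact: exprn_continuous.
  have [s0 hs0 smax] := EVT_max ler01 cont.
  rewrite in_itv /= in hs0.
  set M := `|Kp T n s0|.
  apply: (@le_trans _ _ M); first by apply: smax; rewrite in_itv.
  have M0 : 0 <= M by exact: normr_ge0.
  have hM u : 0 <= u <= 1 -> `|Kp T n u| <= M by move=> hu; apply: smax; rewrite in_itv.
  have hd := diag n M s0 hs0 M0 hM.
  have := CS_kernel (pt s0) k0 (bspan_Kker (kap1 T) n (pt 1)).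
  have -> : Ifun (kap1 T) (fun y => Kker (kap1 T) n (pt 1) y ^+ 2) = C^-1 * Kp T n 1.
    rewrite -Kker1 -(Kker_repro k0 _ (bspan_Kker (kap1 T) n (pt 1))).
    by apply: eq_Ifun => y _; rewrite expr2.
  rewrite Kker1 exprMn -[Kp T n s0 ^+ 2]real_normK ?num_real // -/M => h.
  have K10 : 0 < Kp T n 1 by apply: Kp_one_gt0; apply: lt_le_trans T1.
  have h2 : C^-1 ^+ 2 * M ^+ 2 <= (C^-1 * (E * M)) * (C^-1 * Kp T n 1).
    by apply: (le_trans h); rewrite ler_wpM2r // mulr_ge0 ?(ltW K10) // invr_ge0 (ltW C0).
  have {}h2 : M * M <= (E * Kp T n 1) * M.
    rewrite -(ler_pM2l (_ : 0 < C^-1 ^+ 2)) ?exprn_gt0 ?invr_gt0 //.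
    by apply: le_trans h2 _; rewrite le_eqVlt; apply/orP; left; apply/eqP; ring.
  have [->|Mn] := eqVneq M 0; first by rewrite mulr_ge0 // ltW.
  by rewrite -(ler_pM2r (_ : 0 < M)) // lt_neqAle eq_sym Mn.
exists (E + C^-1 * (E * E)); first by rewrite addr_gt0 // !mulr_gt0 // invr_gt0.
move=> n; have K10 : 0 < Kp T n 1 by apply: Kp_one_gt0; apply: lt_le_trans T1.
split => s hs.
  apply: le_trans (main n s hs) _; rewrite ler_pM2r // lerDl.
  by rewrite !mulr_ge0 ?invr_ge0 // ltW.
apply: le_trans (diag n _ s hs _ (main n)) _; first by rewrite mulr_ge0 // ltW.
rewrite !mulrA ler_pM2r // lerDr ltW //.
Qed.

End WithT.

(* Nikolskii inequality for (1-s)^l G combined with Parseval for the raised parameter T + 2l. *)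
Lemma zonal_bound T : 1 <= T -> exists2 D, 0 < D & forall (a : nat -> R) N l s,
  (forall j, (N <= j)%N -> a j = 0) -> 0 <= s <= 1 ->
  ((1 - s) ^+ l * \sum_(j < N) a j * Qp T j s) ^+ 2 <=
  D * Kp T (l + N) 1 * (poch (T - 2^-1) l.*2 / poch T l.*2) *
  \sum_(j < N) adiff T a l.*2 j ^+ 2 * Qp (T + l.*2%:R) j 1.
Proof.
move=> T1; have k0 i : 0 <= kap1 T i by exact: kap1_ge0.
set C := Cnorm (kap1 T); have C0 : 0 < C by exact/Cnorm_gt0/k0.
have [D D0 HD] := Kp_bound T1.
exists (D * C); first by rewrite mulr_gt0.
move=> a N l s ha hs.
pose f (y : 'I_1 -> R) := (1 - y ord_max) ^+ l * \sum_(j < N) a j * Qp T j (y ord_max).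
have hf : bspan (l + N) f.
  apply: bspanM.
    have h1 : bspan 1 (fun y : 'I_1 -> R => 1 - y ord_max).
      apply: (@eq_bspan _ _ _ (bmon (fun i => (i == ord_max) : nat))).
        by move=> y; rewrite /bmon big_ord2 /= expr1 mul1r xext_max big_ord1 (ord1_max ord0).
      by apply: bspan_bmon; rewrite big_ord2.
    have hm m : bspan m (fun y : 'I_1 -> R => (1 - y ord_max) ^+ m).
      elim: m => [|m IH]; first by apply: eq_bspan (bspan_cst _ 0 1) => y; rewrite expr0.
      by apply: eq_bspan (bspanM h1 IH) => y; rewrite exprS.
    exact: hm.
  apply: bspan_sum => j _; apply: bspanZ; apply: bspan_mono (bspan_Qp T1 j).
  exact/ltnW/ltn_ord.
have := CS_kernel (pt s) k0 hf; rewrite /f {1}/pt => /le_trans; apply.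
have T0 : 0 < T by apply: lt_le_trans T1.
have Tk : 1 <= T + l.*2%:R by rewrite (le_trans T1) // lerDl.
have -> : Ifun (kap1 T) (fun y : 'I_1 -> R => ((1 - y ord_max) ^+ l * \sum_(j < N) a j * Qp T j (y ord_max)) ^+ 2) =
   C * (poch (T - 2^-1) l.*2 / poch T l.*2) * \sum_(j < N) adiff T a l.*2 j ^+ 2 * Qp (T + l.*2%:R) j 1.
  rewrite -(Cnorm_kap1 T1 l.*2) -(Qp_parseval Tk) (Ifun_kap1 T1); apply: eq_Ifun => y _.
  by rewrite (adiff_sum l.*2 _ T0 ha) exprMn -exprM muln2.
have [_ /(_ s hs) h] := HD (l + N)%N.
have K0 : 0 < Kp T (l + N) 1 by exact: Kp_one_gt0.
have X0 : 0 <= C * (poch (T - 2^-1) l.*2 / poch T l.*2) * \sum_(j < N) adiff T a l.*2 j ^+ 2 * Qp (T + l.*2%:R) j 1.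
  rewrite -(Cnorm_kap1 T1 l.*2); apply: mulr_ge0.
    by apply/ltW/Cnorm_gt0 => i; exact: kap1_ge0.
  by apply: sumr_ge0 => j _; rewrite mulr_ge0 ?sqr_ge0 ?Qp_one_ge0.
apply: (le_trans (ler_wpM2r X0 h)).
by rewrite le_eqVlt; apply/orP; left; apply/eqP; ring.
Qed.

End OneDim.

(** * Iterated differences of the cutoff function *)

Section Differences.
Variable R : realType.
Implicit Types (T u w : R) (U : nat -> R) (i k m n : nat).

Definition jet (g : nat -> R -> R) := forall i u, 0 < u -> is_derive u 1 (g i) (g i.+1 u).

(** The derivatives of h defined by (2u + T) h(u) = T (g_0(u) - g_0(u + 1)): applying Leibniz's rule
    i times to this equation gives the recursion. *)
Fixpoint jdiff (g : nat -> R -> R) T i : R -> R := fun u =>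
  if i is i'.+1 then (T * (g i u - g i (u + 1)) - 2 * i%:R * jdiff g T i' u) / (2 * u + T)
  else T * (g 0%N u - g 0%N (u + 1)) / (2 * u + T).

Lemma jdiffE g T i u : 0 < T -> 0 < u ->
  jdiff g T i u * (2 * u + T) = T * (g i u - g i (u + 1)) - 2 * i%:R * jdiff g T i.-1 u.
Proof.
move=> T0 u0; have q0 : 2 * u + T != 0 by rewrite gt_eqF // addr_gt0 // mulr_gt0.
by case: i => [|i] /=; rewrite divfK // mulr0 mul0r subr0.
Qed.

Lemma is_derive_shift (g : R -> R) (h dg u : R) : is_derive (u + h) 1 g dg ->
  is_derive u 1 (fun v => g (v + h)) dg.
Proof.
move=> dgu.
have d1 : is_derive u (1 : R) (fun v : R => v + h) 1.
  rewrite (_ : (fun v => v + h) = id + cst h) //; by apply: is_derive_eq; rewrite addr0.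
have := @is_derive1_comp R g (fun v => v + h) u _ _ dgu d1.
by rewrite mulr1.
Qed.

Lemma jet_jdiff g T : 0 < T -> jet g -> jet (jdiff g T).
Proof.
move=> T0 jg i u u0.
have u1 : 0 < u + 1 by rewrite addr_gt0.
have q0 : 2 * u + T != 0 by rewrite gt_eqF // addr_gt0 // mulr_gt0.
have dq : is_derive u (1 : R) (fun v : R => 2 * v + T) 2.
  rewrite (_ : (fun v => 2 * v + T) = 2 \*: id + cst T) //.
  by apply: is_derive_eq; rewrite addr0 /GRing.scale /= mulr1.
have dqV : is_derive u (1 : R) (fun v : R => (2 * v + T)^-1) (- (2 / (2 * u + T) ^+ 2)).
  have := @is_deriveV R (fun v => 2 * v + T) u 2 1 q0 dq.
  by rewrite /GRing.scale /= mulNr mulrC.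
have dg j : is_derive u 1 (fun v => g j v - g j (v + 1)) (g j.+1 u - g j.+1 (u + 1)).
  by apply: is_deriveB; [exact: jg | apply: is_derive_shift; exact: jg].
elim: i => [|i IH].
  have d1 := @is_deriveZ _ _ _ _ T u 1 _ (dg 0%N).
  have := @is_deriveM _ _ _ _ u 1 _ _ d1 dqV.
  move=> d; apply: (is_derive_eq d); rewrite /= /GRing.scale /=.
  by field.
have d1 := @is_deriveZ _ _ _ _ T u 1 _ (dg i.+1).
have d2 := @is_deriveZ _ _ _ _ (2 * i.+1%:R) u 1 _ IH.
have d3 := @is_deriveB _ _ _ _ _ u 1 _ _ d1 d2.
have := @is_deriveM _ _ _ _ u 1 _ _ d3 dqV.
move=> d; apply: (is_derive_eq d); rewrite /= /GRing.scale /=.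
rewrite !fctE /= /GRing.scale /= -(natr1 i.+1); by field.
Qed.

Lemma MVT_shift (g dg : R -> R) u : (forall v, u <= v -> is_derive v 1 g (dg v)) ->
  exists2 v, u <= v & g u - g (u + 1) = - dg v.
Proof.
move=> h; have lt : u < u + 1 by rewrite ltrDl.
have cont : {within `[u, u + 1], continuous g}.
  apply: continuous_in_subspaceT => v; rewrite inE /= in_itv /= => /andP[uv _].
  have dv := h v uv; apply: differentiable_continuous; exact/derivable1_diffP.
have [v] := @MVT R g dg u (u + 1) lt (fun v hv => h v (ltW (proj1 (andP (hv : (u < v < u + 1)))))) cont.
rewrite in_itv /= => /andP[uv _]; rewrite addrAC subrr add0r mulr1 => E.
by exists v; [exact: ltW | rewrite -E opprB].
Qed.

(** The difference is one more derivative by the mean value theorem. The Leibniz term 2 i h^(i-1)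
    has one derivative less and one factor 1 / w too many; the growth condition on U exchanges one
    for the other. Both terms are then at most T U, and 2u + T >= 2w absorbs their sum. *)
Lemma jdiff_bound g T U w m : 0 < T -> 0 < w -> jet g ->
  (forall i u, (0 < i + m)%N -> w <= u -> `|g i u| <= U (i + m)%N) ->
  (forall i, (0 < i)%N -> 2 * i.+1%:R * U i <= w * U i.+1) ->
  (forall i, 0 <= U i) ->
  forall i u, w <= u -> `|jdiff g T i u| <= T * w^-1 * U (i + m.+1)%N.
Proof.
move=> T0 w0 jg hg hU U0 i u wu.
have u0 : 0 < u by apply: lt_le_trans wu.
have q0 : 0 < 2 * u + T by rewrite addr_gt0 // mulr_gt0.
have step j : `|g j u - g j (u + 1)| <= U (j + m.+1)%N.
  have [v uv ->] := @MVT_shift (g j) (g j.+1) u (fun v uv => jg j v (lt_le_trans u0 uv)).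
  by rewrite normrN addnS -addSn; apply: hg => //; apply: le_trans uv.
elim: i => [|i IH].
  rewrite /= normrM normrM (gtr0_norm T0) normfV (gtr0_norm q0) ler_pdivrMr //.
  apply: (@le_trans _ _ (T * U m.+1)); first by rewrite ler_wpM2l ?(ltW T0) //; exact: (step 0%N).
  rewrite -!mulrA ler_wpM2l ?(ltW T0) // mulrCA ler_peMr // -ler_pdivrMl ?invr_gt0 // invrK mulr1.
  by move: wu T0 w0; lra.
have := jdiffE g i.+1 T0 u0; rewrite [i.+1.-1]/= => E.
rewrite -(ler_pM2r q0) -{1}(gtr0_norm q0) -normrM E.
apply: le_trans (ler_normB _ _) _.
rewrite normrM (gtr0_norm T0) normrM (ger0_norm (_ : 0 <= 2 * i.+1%:R)) //.
set V := U (i.+1 + m.+1)%N.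
have h1 : T * `|g i.+1 u - g i.+1 (u + 1)| <= T * V by rewrite ler_wpM2l ?(ltW T0) //; exact: step.
have h2 : 2 * i.+1%:R * U (i + m.+1)%N <= w * V.
  apply: le_trans (hU (i + m.+1)%N _); last by rewrite addnS.
  by rewrite ler_wpM2r // ler_wpM2l // ler_nat; lia.
have h3 : 2 * i.+1%:R * `|jdiff g T i u| <= T * V.
  apply: (@le_trans _ _ (2 * i.+1%:R * (T * w^-1 * U (i + m.+1)%N))); first by rewrite ler_wpM2l.
  rewrite (_ : _ * (_ * _) = T * (2 * i.+1%:R * U (i + m.+1)%N / w)); last by ring.
  by rewrite ler_wpM2l ?(ltW T0) // ler_pdivrMr // (mulrC V).
apply: (le_trans (lerD h1 h3)).
have -> : T * w^-1 * V * (2 * u + T) = T * V * ((2 * u + T) / w) by ring.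
have -> : T * V + T * V = T * V * 2 by ring.
rewrite ler_wpM2l ?mulr_ge0 ?(ltW T0) ?U0 // ler_pdivlMr //.
by move: wu T0; lra.
Qed.

Fixpoint Dfam (g : nat -> R -> R) T k : nat -> R -> R :=
  if k is k'.+1 then jdiff (Dfam g T k') (T + k'%:R) else g.

Lemma jet_Dfam g T k : 0 < T -> jet g -> jet (Dfam g T k).
Proof.
move=> T0 jg; elim: k => [|k IH] //=; apply: jet_jdiff => //.
by rewrite ltr_wpDr.
Qed.

Lemma Dfam_bound g T U w k : 0 < T -> 0 < w -> jet g ->
  (forall i u, (0 < i)%N -> w <= u -> `|g i u| <= U i) ->
  (forall i, (0 < i)%N -> 2 * i.+1%:R * U i <= w * U i.+1) ->
  (forall i, 0 <= U i) ->
  forall i u, (0 < i + k)%N -> w <= u -> `|Dfam g T k i u| <= poch T k * w^-1 ^+ k * U (i + k)%N.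
Proof.
move=> T0 w0 jg hg hU U0; elim: k => [|k IH] i u ik wu /=.
  by rewrite poch0 expr0 !mul1r addn0; apply: hg => //; rewrite addn0 in ik.
have p0 : 0 <= poch T k * w^-1 ^+ k by rewrite mulr_ge0 ?exprn_ge0 ?invr_ge0 ?(ltW w0) // ltW // poch_gt0.
have Tk : 0 < T + k%:R by rewrite ltr_wpDr.
have := @jdiff_bound (Dfam g T k) (T + k%:R) (fun j => poch T k * w^-1 ^+ k * U j) w k Tk w0 (jet_Dfam k T0 jg).
move=> /(_ _ _ _ i u wu) H; apply: le_trans (H _ _ _) _.
- by move=> j v jk wv; exact: IH.
- move=> j j0; rewrite mulrCA [leRHS]mulrCA; exact: ler_wpM2l p0 _ _ (hU j j0).
- by move=> j; rewrite mulr_ge0.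
- rewrite pochS exprS le_eqVlt; apply/orP; left; apply/eqP; ring.
Qed.

Lemma Dfam_adiff g T k j : Dfam g T k 0 j%:R = adiff T (fun j => g 0%N j%:R) k j.
Proof.
elim: k j => [|k IH] j //=.
by rewrite IH natr1 IH.
Qed.

(** Serves the small indices j, for which the factors 1 / (2j + T) gain nothing but the cutoff is
    still constant. *)
Lemma adiff_flat T (a : nat -> R) c k j M : (forall j, (j < M)%N -> a j = c) ->
  (0 < k)%N -> (j + k < M)%N -> adiff T a k j = 0.
Proof.
move=> h; elim: k j => [|k IH] j //= _ jk; case: k IH jk => [|k] IH jk.
  by rewrite /= !h ?subrr ?mulr0 ?mul0r //; move: jk; lia.
by rewrite !IH ?subrr ?mulr0 ?mul0r //; move: jk; lia.
Qed.

End Differences.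

(** * Size of Pochhammer symbols and of the kernels at s = 1 *)

Section Growth.
Variable R : realType.
Implicit Types (T a b p x : R) (k l m n N J : nat).

Lemma ln_succ_ge n : (0 < n)%N -> (n.+1%:R : R)^-1 <= ln (n.+1%:R / n%:R).
Proof.
move=> n0; have np : 0 < n%:R :> R by rewrite ltr0n.
have h : 0 < n.+1%:R / n%:R :> R by rewrite divr_gt0.
rewrite -ler_expR lnK //.
have := @expR_ge1Dx R (- n.+1%:R^-1); rewrite expRN => H.
have e : 1 - n.+1%:R^-1 = (n.+1%:R / n%:R)^-1 :> R.
  by rewrite invf_div -natr1; field; rewrite natr1 pnatr_eq0.
by move: H; rewrite e lef_pV2 ?posrE ?expR_gt0.
Qed.

Lemma powR_succ_ge p n : 0 <= p -> (0 < n)%N ->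
  n%:R `^ p * (1 + p / n.+1%:R) <= n.+1%:R `^ p :> R.
Proof.
move=> p0 n0; have np : 0 < n%:R :> R by rewrite ltr0n.
have -> : n.+1%:R `^ p = n%:R `^ p * (n.+1%:R / n%:R) `^ p :> R.
  by rewrite -powRM ?divr_ge0 //; congr (_ `^ _); rewrite mulrC divfK // gt_eqF.
rewrite ler_wpM2l ?powR_ge0 // /powR gt_eqF ?divr_gt0 //.
apply: le_trans (expR_ge1Dx _); rewrite lerD2l ler_wpM2l //; exact: ln_succ_ge.
Qed.

(** The quotient of the next factors is 1 + (a - b) / (b + n + 1) <= 1 + (a - b) / (n + 2), as b >=
    1, and [powR_succ_ge] bounds this by a quotient of consecutive powers. *)
Lemma poch_growth1 a b n : 1 <= b -> b <= a ->
  poch a n.+1 <= a / b * n.+1%:R `^ (a - b) * poch b n.+1.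
Proof.
move=> b1 ba; have b0 : 0 < b by apply: lt_le_trans b1.
have a0 : 0 < a by apply: lt_le_trans ba.
have p0 : 0 <= a - b by rewrite subr_ge0.
elim: n => [|n IH].
  by rewrite powR1 mulr1 !pochS !poch0 !mul1r !addr0 divfK // gt_eqF.
rewrite pochS [poch b n.+2]pochS.
have an : 0 <= a + n.+1%:R by rewrite addr_ge0 // ltW.
apply: le_trans (ler_wpM2r an IH) _.
rewrite -!mulrA ler_wpM2l ?(ltW a0) // ler_wpM2l ?invr_ge0 ?(ltW b0) //.
rewrite [leLHS]mulrCA [leRHS]mulrCA ler_wpM2l //; first by rewrite ltW // poch_gt0.
have bn : 0 < b + n.+1%:R by rewrite ltr_wpDr.
apply: le_trans (ler_wpM2r (ltW bn) (powR_succ_ge p0 (ltn0Sn n))).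
rewrite -mulrA ler_wpM2l ?powR_ge0 // mulrDl mul1r.
have -> : a + n.+1%:R = (b + n.+1%:R) + (a - b) by ring.
rewrite lerD2l -mulrA ler_peMr // mulrC ler_pdivlMr // mul1r -natr1.
by rewrite addrC lerD2r.
Qed.

(** An elementary form of the Gamma function asymptotics. Splitting off the first factor raises both
    parameters by 1, which brings b into the range b >= 1 of the previous lemma. *)
Lemma poch_growth a b : 0 < b -> b <= a -> exists2 C, 1 <= C &
  forall n, poch a n <= C * (maxn 1 n)%:R `^ (a - b) * poch b n.
Proof.
move=> b0 ba; have a0 : 0 < a by apply: lt_le_trans ba.
have ab : 1 <= a / b by rewrite ler_pdivlMr // mul1r.
have ab1 : 1 <= (a + 1) / (b + 1).
  by rewrite ler_pdivlMr ?addr_gt0 // mul1r lerD2r.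
have p0 : 0 <= a - b by rewrite subr_ge0.
exists (a / b * ((a + 1) / (b + 1))); first by rewrite mulr_ege1.
case=> [|[|n]].
- by rewrite maxn0 powR1 !poch0 !mulr1 mulr_ege1.
- rewrite maxnn powR1 !pochS !poch0 !mul1r !addr0 mulr1 mulrAC divfK ?gt_eqF //.
  by rewrite ler_peMr // ltW.
rewrite (_ : maxn 1 n.+2 = n.+2) // pochSl [poch b n.+2]pochSl.
have h := @poch_growth1 (a + 1) (b + 1) n _ _.
apply: (@le_trans _ _ (a * ((a + 1) / (b + 1) * n.+1%:R `^ (a + 1 - (b + 1)) * poch (b + 1) n.+1))).
  rewrite ler_wpM2l ?(ltW a0) // h // ?lerD2r //.
  by rewrite lerDr ltW.
have -> : a + 1 - (b + 1) = a - b by ring.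
have -> : a / b * ((a + 1) / (b + 1)) * n.+2%:R `^ (a - b) * (b * poch (b + 1) n.+1) =
  a * ((a + 1) / (b + 1) * n.+2%:R `^ (a - b) * poch (b + 1) n.+1).
  by field; rewrite !gt_eqF // addr_gt0.
rewrite ler_wpM2l ?(ltW a0) // ler_wpM2r ?(ltW (poch_gt0 _ _)) ?addr_gt0 //.
rewrite ler_wpM2l ?(le_trans ler01) //.
by apply: ge0_ler_powR; rewrite ?nnegrE // ler_nat.
Qed.

Lemma poch_le_pow a k M : 0 < a -> a + k%:R <= M + 1 -> poch a k <= M ^+ k.
Proof.
move=> a0 h; rewrite /poch; have -> : M ^+ k = \prod_(i < k) M by rewrite prodr_const card_ord.
apply: ler_prod => i _; rewrite addr_ge0 ?(ltW a0) //=.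
have : (i.+1%:R : R) <= k%:R by rewrite ler_nat.
by rewrite -natr1; move: h; lra.
Qed.

Lemma Kp_growth T : 1 <= T -> exists2 C, 0 < C & forall n N, (0 < n)%N -> (N <= 3 * n)%N ->
  Kp T N 1 <= C * n%:R `^ (2 * T - 1).
Proof.
move=> T1; have T0 : 0 < T by apply: lt_le_trans T1.
have h0 : (0 : R) < 2^-1 by [].
have [C1 C11 H1] := poch_growth ltr01 T1.
have hT : 2^-1 <= T + 2^-1 by rewrite lerDr ltW.
have [C2 C21 H2] := poch_growth h0 hT.
have C10 : 0 < C1 by apply: lt_le_trans C11.
have C20 : 0 < C2 by apply: lt_le_trans C21.
exists (C1 * C2 * 3 `^ (2 * T - 1)); first by rewrite !mulr_gt0 // powR_gt0.
move=> n N n0 Nn; rewrite Kp_one //.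
set M := (maxn 1 N)%:R : R.
have M0 : 0 < M by rewrite ltr0n leq_max.
have Mn : M <= 3 * n%:R by rewrite -natrM ler_nat geq_max Nn andbT; lia.
have np : 0 < n%:R :> R by rewrite ltr0n.
have e1 : poch T N / N`!%:R <= C1 * M `^ (T - 1).
  by rewrite ler_pdivrMr ?factr_gt0 // -poch1.
have e2 : poch (T + 2^-1) N / poch 2^-1 N <= C2 * M `^ T.
  by rewrite ler_pdivrMr ?poch_gt0 //; have := H2 N; rewrite addrK.
apply: (@le_trans _ _ ((C1 * M `^ (T - 1)) * (C2 * M `^ T))).
  by apply: ler_pM => //; rewrite divr_ge0 // ltW ?poch_gt0 ?factr_gt0 ?addr_gt0.
have -> : C1 * M `^ (T - 1) * (C2 * M `^ T) = C1 * C2 * M `^ (2 * T - 1).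
  rewrite mulrACA -powRD_gt0 //; congr (_ * _ `^ _); ring.
rewrite -[leRHS]mulrA -powRM // ler_wpM2l ?mulr_ge0 ?(ltW C10) ?(ltW C20) //.
by apply: ge0_ler_powR => //; rewrite ?nnegrE ?(ltW M0) ?mulr_ge0 //; lra.
Qed.

(** The constant must not depend on k. The symbols in k join those in J to Pochhammer symbols of
    length about k + J: the part of length J is compared with J! and (1/2)_J by powers of n with
    fixed exponents, and every further factor is at most 3 n. *)
Lemma Qp_growth T : 1 <= T -> exists2 C, 0 < C & forall n J k, (0 < k <= n)%N -> (J <= 2 * n)%N ->
  poch (T - 2^-1) k * poch T k * Qp (T + k%:R) J 1 <=
  C * n%:R `^ (2 * T - 2) * (3 * n%:R) ^+ k.*2.
Proof.
move=> T1; have T0 : 0 < T by apply: lt_le_trans T1.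
have h0 : (0 : R) < 2^-1 by [].
have [C1 C11 H1] := poch_growth ltr01 T1.
have hT : 2^-1 <= T - 2^-1 by lra.
have [C2 C21 H2] := poch_growth h0 hT.
have C10 : 0 < C1 by apply: lt_le_trans C11.
have C20 : 0 < C2 by apply: lt_le_trans C21.
have Th : 0 < T - 2^-1 by apply: lt_le_trans hT.
exists ((5 + T) * C1 * C2 * (3 `^ (2 * T - 2))).
  by rewrite !mulr_gt0 ?powR_gt0 // addr_gt0.
move=> n J [//|k] /andP[_ kn] Jn.
have hM : (k.+1 + J <= 3 * n)%N by clear -kn Jn; lia.
set T' := T + k%:R; have T'0 : 0 < T' by rewrite ltr_wpDr.
set M := (k.+1 + J)%:R : R.
have M1 : 1 <= M by rewrite ler1n.
have M0 : 0 < M by apply: lt_le_trans M1.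
have n1 : 1 <= n%:R :> R by rewrite ler1n; exact: leq_ltn_trans kn.
have Mn : M <= 3 * n%:R by rewrite -natrM ler_nat.
have c0 : 2 * J%:R + T' != 0 by rewrite gt_eqF // ltr_wpDl // mulr_ge0.
have -> : T + k.+1%:R = T' + 1 by rewrite /T' -addrA natr1.
have -> : Qp (T' + 1) J 1 = (2 * J%:R + T') / T' * Kp T' J 1.
  rewrite (Kp_Qp J 1 T'0) mulrA (_ : (2 * J%:R + T') / T' * (T' / (2 * J%:R + T')) = 1) ?mul1r //.
  by field; rewrite c0 gt_eqF.
rewrite Kp_one //.
have -> : T' + 2^-1 = T - 2^-1 + k.+1%:R by rewrite /T' -natr1; field.
have f0 := factr_neq0 R J; have pJ : poch 2^-1 J != 0 :> R by exact: poch_neq0.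
have -> : poch (T - 2^-1) k.+1 * poch T k.+1 * ((2 * J%:R + T') / T' *
    (poch T' J / J`!%:R * (poch (T - 2^-1 + k.+1%:R) J / poch 2^-1 J))) =
    (2 * J%:R + T') * (poch T (k + J) / J`!%:R) * (poch (T - 2^-1) (k.+1 + J) / poch 2^-1 J).
  rewrite [poch T k.+1]pochS [poch T (k + J)]pochD [poch _ (k.+1 + J)]pochD -/T'.
  move: (poch T k) (poch T' J) (poch _ k.+1) (poch _ J) (poch _ J) (J`!%:R : R) f0 pJ => x1 x2 x3 x4 x5 x6 h6 h5.
  by field; rewrite h5 h6 gt_eqF.
have e0 : 2 * J%:R + T' <= (5 + T) * n%:R.
  have hJ : (J%:R : R) <= 2 * n%:R by rewrite -natrM ler_nat.
  have hk : (k%:R : R) <= n%:R by rewrite ler_nat ltnW.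
  rewrite /T' mulrDl; have : T <= T * n%:R by rewrite ler_peMr // ltW.
  by move: hJ hk; lra.
have mx N : (N <= k.+1 + J)%N -> (maxn 1 N)%:R <= M by move=> h; rewrite ler_nat geq_max h.
have e1 : poch T (k + J) / J`!%:R <= C1 * M `^ (T - 1) * M ^+ k.
  rewrite ler_pdivrMr ?factr_gt0 //; apply: le_trans (H1 _) _.
  rewrite -[leRHS]mulrA; apply: ler_pM.
  - by rewrite mulr_ge0 ?powR_ge0 ?(ltW C10).
  - by rewrite ltW // poch_gt0.
  - rewrite ler_wpM2l ?(ltW C10) //; apply: ge0_ler_powR; rewrite ?nnegrE ?subr_ge0 ?(ltW M0) ?ler0n //.
    by apply: mx; rewrite leqW // addSn.
  - rewrite addnC pochD poch1 mulrC ler_wpM2r ?(ltW (factr_gt0 _ _)) //.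
    by apply: poch_le_pow; [rewrite ltr_wpDr | rewrite /M natrD -natr1; lra].
have e2 : poch (T - 2^-1) (k.+1 + J) / poch 2^-1 J <= C2 * M `^ (T - 1) * M ^+ k.+1.
  rewrite ler_pdivrMr ?poch_gt0 //; apply: le_trans (H2 _) _.
  rewrite -[leRHS]mulrA; apply: ler_pM.
  - by rewrite mulr_ge0 ?powR_ge0 ?(ltW C20).
  - by rewrite ltW // poch_gt0.
  - rewrite ler_wpM2l ?(ltW C20) //.
    rewrite (_ : T - 2^-1 - 2^-1 = T - 1); last by field.
    by apply: ge0_ler_powR; rewrite ?nnegrE ?subr_ge0 ?(ltW M0) ?ler0n // mx.
  - rewrite addnC pochD mulrC ler_wpM2r ?(ltW (poch_gt0 _ _)) //.
    by apply: poch_le_pow; [rewrite ltr_wpDr | rewrite /M natrD; lra].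
have g0 : 0 <= 2 * J%:R + T' by rewrite addr_ge0 ?mulr_ge0 // ltW.
have g1 : 0 <= poch T (k + J) / J`!%:R by rewrite divr_ge0 // ltW // poch_gt0.
have g2 : 0 <= poch (T - 2^-1) (k.+1 + J) / poch 2^-1 J by rewrite divr_ge0 // ltW // poch_gt0.
apply: (@le_trans _ _ ((5 + T) * n%:R * (C1 * M `^ (T - 1) * M ^+ k) * (C2 * M `^ (T - 1) * M ^+ k.+1))).
  by apply: ler_pM => //; [exact: mulr_ge0 | exact: ler_pM].
have -> : (5 + T) * n%:R * (C1 * M `^ (T - 1) * M ^+ k) * (C2 * M `^ (T - 1) * M ^+ k.+1) =
   (5 + T) * C1 * C2 * (M `^ (2 * T - 2) * (n%:R * M ^+ k.*2.+1)).
  have -> : 2 * T - 2 = (T - 1) + (T - 1) by ring.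
  by rewrite (powRD_gt0 (T - 1) (T - 1) M0) -addnn !exprS exprD; ring.
rewrite -!mulrA ler_wpM2l ?addr_ge0 ?(ltW T0) // ler_wpM2l ?(ltW C10) // ler_wpM2l ?(ltW C20) //.
rewrite [leRHS]mulrA -powRM //; apply: ler_pM.
- exact: powR_ge0.
- by rewrite mulr_ge0 // exprn_ge0 // ltW.
- by apply: ge0_ler_powR; rewrite ?nnegrE ?(ltW M0) //; lra.
- rewrite doubleS [(3 * n%:R) ^+ _]exprS; apply: ler_pM => //.
  + by rewrite exprn_ge0 // ltW.
  + by rewrite ler_peMl // ler1n.
  + by rewrite lerXn2r // ?nnegrE ?(ltW M0) // mulr_ge0.
Qed.

End Growth.

(** * Decay of the one-variable kernel *)

Section ZonalDecay.
Variable R : realType.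
Implicit Types (T s t u : R) (H : nat -> R) (g : nat -> R -> R) (i k l m n N j : nat).

Definition jet_scale g n : nat -> R -> R := fun i u => n%:R^-1 ^+ i * g i (u / n%:R).

Lemma jet_scaleP g n : (0 < n)%N -> jet g -> jet (jet_scale g n).
Proof.
move=> n0 jg i u u0; have np : 0 < n%:R :> R by rewrite ltr0n.
have d1 : is_derive u (1 : R) (fun v : R => v / n%:R) (n%:R^-1).
  rewrite (_ : (fun v => v / n%:R) = n%:R^-1 \*: id); last first.
    by apply/funext => y /=; rewrite mulrC.
  by apply: is_derive_eq; rewrite /GRing.scale /= mulr1.
have d2 := @is_derive1_comp R (g i) (fun v => v / n%:R) u _ _ (jg i _ (divr_gt0 u0 np)) d1.
have d3 := @is_deriveZ _ _ _ _ (n%:R^-1 ^+ i) u 1 _ d2.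
by apply: (is_derive_eq d3); rewrite /GRing.scale /= /jet_scale exprS; ring.
Qed.

(** For j >= n/4, [Dfam_bound] applies with w = n/4 and U_i = n^(-i) H_i, and its growth condition
    becomes 8 (i+1) H_i <= H_(i+1). For j < n/4, 4 k <= n keeps j, ..., j + k below n/2, where the
    cutoff is constant. *)
Lemma jet_cutoff_adiff T g H n k c0 : 0 < T -> jet g ->
  (forall i t, (0 < i)%N -> 0 < t -> `|g i t| <= H i) ->
  (forall i, (0 < i)%N -> 8 * i.+1%:R * H i <= H i.+1) -> (forall i, 0 <= H i) ->
  (forall t, 0 <= t < 2^-1 -> g 0%N t = c0) -> (0 < n)%N -> (0 < k)%N -> (4 * k <= n)%N ->
  forall j, `|adiff T (fun j => g 0%N (j%:R / n%:R)) k j| <=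
     poch T k * (4 / n%:R ^+ 2) ^+ k * H k.
Proof.
move=> T0 jg hH hr H0 hc n0 k0 kn j.
have np : 0 < n%:R :> R by rewrite ltr0n.
have rhs0 : 0 <= poch T k * (4 / n%:R ^+ 2) ^+ k * H k.
  by rewrite !mulr_ge0 ?exprn_ge0 ?divr_ge0 ?exprn_ge0 ?(ltW (poch_gt0 _ _)).
have [jn|nj] := ltnP (4 * j) n.
  pose M := (uphalf n).
  rewrite (@adiff_flat R T _ c0 k j M) ?normr0 //.
    move=> i iM; apply: hc; rewrite divr_ge0 //= ltr_pdivrMr // mulrC ltr_pdivlMr //.
    rewrite -natrM ltr_nat; move: iM; rewrite /M; lia.
  rewrite /M; move: jn kn; lia.
have -> : (fun j => g 0%N (j%:R / n%:R)) = (fun j => jet_scale g n 0 j%:R).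
  by apply/funext => i; rewrite /jet_scale expr0 mul1r.
rewrite -Dfam_adiff.
have w0 : 0 < n%:R / 4 :> R by rewrite divr_gt0.
pose U i := n%:R^-1 ^+ i * H i.
have vp i : 0 < n%:R^-1 ^+ i :> R by rewrite exprn_gt0 // invr_gt0.
have := @Dfam_bound R (jet_scale g n) T U (n%:R / 4) k T0 w0 (jet_scaleP n0 jg) _ _ _ 0%N j%:R.
rewrite add0n => h; apply: le_trans (h _ _ _ k0 _) _.
- move=> i u i0 wu; rewrite normrM ger0_norm ?(ltW (vp _)) // ler_wpM2l ?(ltW (vp _)) //.
  by apply: hH => //; rewrite divr_gt0 // (lt_le_trans w0).
- move=> i i0; have := hr i i0; rewrite /U exprS => hi.
  have -> : n%:R / 4 * (n%:R^-1 * n%:R^-1 ^+ i * H i.+1) = n%:R^-1 ^+ i * (H i.+1 / 4).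
    by field; rewrite gt_eqF.
  rewrite mulrCA ler_wpM2l ?(ltW (vp _)) // ler_pdivlMr //.
  by move: hi; rewrite -natr1; set x := (i%:R : R); set y := H i; lra.
- by move=> i; rewrite mulr_ge0 ?(ltW (vp _)).
- by rewrite ler_pdivrMr // -natrM ler_nat mulnC.
- rewrite /U mulrA -[X in X * _]mulrA -exprMn le_eqVlt; apply/orP; left; apply/eqP.
  by congr (_ * _ ^+ _ * _); field; rewrite gt_eqF.
Qed.

(** Each of the k = 2l derivatives costs 12 / n, that is, 4 / n^2 from the weighted difference times
    3 n from the raised parameter T + k of the kernels. The condition 8 l <= n is 4 k <= n. *)
Lemma zonal_decay T : 1 <= T -> exists2 C, 0 < C & forall g H n l c0 s, jet g ->
  (forall i t, (0 < i)%N -> 0 < t -> `|g i t| <= H i) ->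
  (forall i, (0 < i)%N -> 8 * i.+1%:R * H i <= H i.+1) -> (forall i, 0 <= H i) ->
  (forall t, 0 <= t < 2^-1 -> g 0%N t = c0) -> (forall t, 2 < t -> g 0%N t = 0) ->
  (forall t, 0 <= t -> `|g 0%N t| <= H 0%N) ->
  (0 < n)%N -> (8 * l <= n)%N -> 0 <= s <= 1 ->
  (1 - s) ^+ l * `|\sum_(j < (2 * n).+1) g 0%N (j%:R / n%:R) * Qp T j s| <=
  C * n%:R `^ (2 * T - 1) * ((12 / n%:R) ^+ l.*2 * H l.*2).
Proof.
move=> T1; have T0 : 0 < T by apply: lt_le_trans T1.
have [D D0 HD] := zonal_bound T1.
have [C1 C10 HC1] := Kp_growth T1.
have [C2 C20 HC2] := Qp_growth T1.
have K0 : 0 < D * C1 * (C1 + 3 * C2) by rewrite !mulr_gt0 // addr_gt0 // mulr_gt0.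
exists (Num.sqrt (D * C1 * (C1 + 3 * C2))); first by rewrite sqrtr_gt0.
move=> g H n l c0 s jg hH hr H0 hc hz h0 n0 ln hs.
have np : 0 < n%:R :> R by rewrite ltr0n.
set N := (2 * n).+1; pose a j := g 0%N (j%:R / n%:R).
have ha j : (N <= j)%N -> a j = 0.
  by move=> Nj; apply: hz; rewrite ltr_pdivlMr // -natrM ltr_nat.
have s1 : 0 <= 1 - s by rewrite subr_ge0; case/andP: hs.
have Q0 k j : 0 <= Qp (T + k%:R) j 1 by apply: Qp_one_ge0; rewrite (le_trans T1) // lerDl.
set P := n%:R `^ (2 * T - 1).
have P0 : 0 <= P by exact: powR_ge0.
have P2 : P = n%:R * n%:R `^ (2 * T - 2).
  by rewrite -[X in X * _](powRr1 (ltW np)) -(powRD_gt0 1 _ np) /P; congr (_ `^ _); ring.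
have lN : (l + N <= 3 * n)%N by rewrite /N; clear -ln n0; lia.
have KN : Kp T (l + N) 1 <= C1 * P by apply: HC1.
have key : poch (T - 2^-1) l.*2 / poch T l.*2 * (\sum_(j < N) adiff T a l.*2 j ^+ 2 * Qp (T + l.*2%:R) j 1) <=
   (C1 + 3 * C2) * P * ((12 / n%:R) ^+ l.*2 * H l.*2) ^+ 2.
  (* For l = 0 no difference is taken: the coefficients are bounded by H_0 and the kernels add up to
     [Kp T (2 * n) 1]. *)
  case: l ln {lN KN} => [|l] ln.
    rewrite !poch0 divr1 mul1r /= expr0 mul1r.
    apply: (@le_trans _ _ (H 0%N ^+ 2 * Kp T (2 * n) 1)).
      rewrite -Kp_sum mulr_sumr; apply: ler_sum => j _; rewrite addr0.
      have Qj := Q0 0%N j; rewrite addr0 in Qj.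
      rewrite ler_wpM2r // -[a j ^+ 2]real_normK ?num_real // lerXn2r // ?nnegrE //.
      by apply: h0; rewrite divr_ge0.
    have h1 := HC1 n (2 * n)%N n0 (leq_mul (isT : 2 <= 3)%N (leqnn n)).
    rewrite mulrC ler_wpM2r ?sqr_ge0 // (le_trans h1) // ler_wpM2r //.
    by rewrite lerDl mulr_ge0 // ltW.
  set k := l.+1.*2; have k0 : (0 < k)%N by [].
  have kn : (4 * k <= n)%N by rewrite /k -muln2; clear -ln; lia.
  have kn' : (0 < k <= n)%N by rewrite k0 /=; clear -kn; lia.
  have hd := jet_cutoff_adiff T0 jg hH hr H0 hc n0 k0 kn.
  have pk : 0 < poch T k by exact: poch_gt0.
  have pk' : 0 < poch (T - 2^-1) k by apply: poch_gt0; lra.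
  pose B := 3 * C2 * P * ((12 / n%:R) ^+ k * H k) ^+ 2.
  apply: (@le_trans _ _ B); last first.
    rewrite /B ler_wpM2r ?sqr_ge0 // ler_wpM2r // lerDr ltW //.
  have rk : 0 <= poch T k * (4 / n%:R ^+ 2) ^+ k * H k.
    exact: le_trans (normr_ge0 _) (hd 0%N).
  have term (j : 'I_N) : poch (T - 2^-1) k / poch T k * (adiff T a k j ^+ 2 * Qp (T + k%:R) j 1) <=
      C2 * n%:R `^ (2 * T - 2) * ((12 / n%:R) ^+ k * H k) ^+ 2.
    have jn : (j <= 2 * n)%N by rewrite -ltnS.
    have hq := HC2 n j k kn' jn.
    apply: (@le_trans _ _ (poch (T - 2^-1) k / poch T k * ((poch T k * (4 / n%:R ^+ 2) ^+ k * H k) ^+ 2 * Qp (T + k%:R) j 1))).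
      rewrite ler_wpM2l ?divr_ge0 ?(ltW pk) ?(ltW pk') // ler_wpM2r //.
      rewrite -[adiff T a k j ^+ 2]real_normK ?num_real // lerXn2r ?nnegrE //; exact: hd.
    have -> : poch (T - 2^-1) k / poch T k * ((poch T k * (4 / n%:R ^+ 2) ^+ k * H k) ^+ 2 * Qp (T + k%:R) j 1) =
       ((4 / n%:R ^+ 2) ^+ k * H k) ^+ 2 * (poch (T - 2^-1) k * poch T k * Qp (T + k%:R) j 1).
      by field; rewrite gt_eqF.
    apply: le_trans (ler_wpM2l (sqr_ge0 _) hq) _.
    rewrite le_eqVlt; apply/orP; left; apply/eqP.
    have -> : (3 * n%:R) ^+ k.*2 = ((3 * n%:R) ^+ k) ^+ 2 :> R by rewrite -exprM muln2.
    have -> : 12 / n%:R = (4 / n%:R ^+ 2) * (3 * n%:R) :> R by field; rewrite gt_eqF.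
    by rewrite [(_ / _ * (3 * n%:R)) ^+ k]exprMn; ring.
  rewrite mulr_sumr.
  apply: (@le_trans _ _ (\sum_(j < N) C2 * n%:R `^ (2 * T - 2) * ((12 / n%:R) ^+ k * H k) ^+ 2)).
    by apply: ler_sum => j _; exact: term.
  rewrite sumr_const card_ord /B P2.
  rewrite -[X in X <= _]mulr_natl.
  have hN : N%:R <= 3 * n%:R :> R by rewrite -natrM ler_nat /N; clear -n0; lia.
  rewrite (_ : 3 * C2 * _ * _ = (3 * n%:R) * (C2 * n%:R `^ (2 * T - 2) * ((12 / n%:R) ^+ k * H k) ^+ 2)); last by ring.
  have Z0 : 0 <= C2 * n%:R `^ (2 * T - 2) * ((12 / n%:R) ^+ k * H k) ^+ 2.
    by apply: mulr_ge0; [apply: mulr_ge0; [exact: ltW | exact: powR_ge0] | exact: sqr_ge0].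
  exact: (ler_wpM2r Z0 hN).
set X := (1 - s) ^+ l * _.
set Y := (12 / n%:R) ^+ l.*2 * H l.*2.
have Y0 : 0 <= Y by rewrite mulr_ge0 // exprn_ge0 // divr_ge0.
have X0 : 0 <= X by rewrite mulr_ge0 // exprn_ge0.
have XE : X ^+ 2 = ((1 - s) ^+ l * \sum_(j < N) a j * Qp T j s) ^+ 2.
  by rewrite /X exprMn [in RHS]exprMn real_normK ?num_real.
have X2 : X ^+ 2 <= D * C1 * (C1 + 3 * C2) * (P * Y) ^+ 2.
  rewrite XE; apply: le_trans (HD a N l s ha hs) _.
  set S := \sum_(j < N) _ in key *; set q := poch (T - 2^-1) _ / _ in key *.
  rewrite (_ : _ * (P * Y) ^+ 2 = D * ((C1 * P) * ((C1 + 3 * C2) * P * Y ^+ 2))); last by ring.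
  rewrite -!(mulrA D) ler_wpM2l ?(ltW D0) // -mulrA; apply: ler_pM => //.
    by rewrite ltW // Kp_one_gt0.
  rewrite mulr_ge0 //; first by rewrite divr_ge0 // ltW // poch_gt0 //; lra.
  by apply: sumr_ge0 => j _; rewrite mulr_ge0 ?sqr_ge0.
rewrite -mulrA; have Z0 : 0 <= Num.sqrt (D * C1 * (C1 + 3 * C2)) * (P * Y).
  by rewrite mulr_ge0 ?sqrtr_ge0 // mulr_ge0.
rewrite -/Y -/X -(@ler_pXn2r _ 2) // ?nnegrE //.
by rewrite [leRHS]exprMn sqr_sqrtr ?(ltW K0).
Qed.

End ZonalDecay.

(** * The kernel estimate *)

Section RhoBound.
Variable R : realType.

(** With r = acos w: for w >= 1/2 the mean value theorem gives sin r >= w r >= r / 2, hence r^2 <= 4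
    (1 - w^2); for w < 1/2 the crude bound r <= pi / 2 <= 2 suffices. *)
Lemma acos_sqr_le (w : R) : 0 <= w <= 1 -> (acos w) ^+ 2 <= 16 * (1 - w ^+ 2).
Proof.
move=> /andP[w0 w1]; have w11 : -1 <= w <= 1 by rewrite w1 andbT; move: w0; lra.
set r := acos w; have r0 : 0 <= r by exact: acos_ge0.
have rpi : r <= pi by exact: acos_lepi.
have cr : cos r = w by rewrite /r acosK // in_itv.
have pi0 : 0 <= pi :> R by exact: pi_ge0.
have [/andP[_ p2] _] := @pihalf_02_cos_pihalf R.
have rp2 : r <= pi / 2.
  rewrite leNgt; apply/negP => h.
  have := @ltr_cos R (pi / 2) r; rewrite !in_itv /= r0 rpi.
  rewrite divr_ge0 //= ler_pdivrMr // ler_peMr // ?ler1n // => /(_ isT isT) E.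
  by move: E; rewrite cos_pihalf cr h ltNge w0.
have [hw|hw] := leP (2^-1) w; last first.
  have r4 : r ^+ 2 <= 2 ^+ 2 by rewrite lerXn2r ?nnegrE // (le_trans rp2).
  have : w ^+ 2 <= 2^-1 ^+ 2 by rewrite lerXn2r ?nnegrE // ltW.
  have -> : 2^-1 ^+ 2 = 4^-1 :> R by field.
  by move: r4; lra.
have [->|rn] := eqVneq r 0; first by rewrite expr0n /= mulr_ge0 // subr_ge0 expr_le1.
have rp : 0 < r by rewrite lt_neqAle eq_sym rn.
have cont : {within `[0, r], continuous (@sin R)}.
  by apply: continuous_subspaceT; exact: continuous_sin.
have [c] := @MVT R sin cos 0 r rp (fun x _ => is_derive_sin x) cont.
rewrite in_itv /= subr0 sin0 subr0 => /andP[c0 c1] E.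
have cc : w <= cos c.
  rewrite leNgt; apply/negP => h.
  have := @ltr_cos R r c; rewrite !in_itv /= r0 rpi (ltW c0) (le_trans (ltW c1) rpi) cr h => /(_ isT isT).
  by rewrite ltNge (ltW c1).
have sr : r <= 2 * sin r.
  rewrite E; apply: (@le_trans _ _ (2 * (2^-1 * r))); first by rewrite mulrA divff ?mul1r.
  by rewrite ler_pM2l // ler_pM2r // (le_trans hw).
rewrite -cr -sin2cos2; apply: (@le_trans _ _ ((2 * sin r) ^+ 2)).
  by rewrite lerXn2r ?nnegrE // (le_trans r0).
by rewrite exprMn; have := sqr_ge0 (sin r); lra.
Qed.

End RhoBound.

(** * From the one-variable kernel to the simplex: ingredients *)

Section KernelEstimate.
Variable R : realType.
Variables (d : nat) (kappa : 'I_d.+1 -> R).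
Hypothesis d0 : (0 < d)%N.
Hypothesis kappa0 : forall i, 0 <= kappa i.
Implicit Types (x y : 'I_d -> R) (n l q j : nat).
Local Notation T := (thsum kappa).

(** Splits the growth n^(2T-1) of the one-variable kernel into n^d and the powers n^(2 kappa_i) that
    become part of the weights. *)
Lemma thsumE : 2 * T - 1 = 2 * (\sum_i kappa i) + d%:R.
Proof.
rewrite /thsum /th big_split /= sumr_const card_ord -[_ *+ d.+1]mulr_natl -natr1; by field.
Qed.

Lemma thsum_ge1 : 1 <= T.
Proof.
have : 0 <= \sum_i kappa i by apply: sumr_ge0.
have : 1 <= d%:R :> R by rewrite ler1n.
by have := thsumE; lra.
Qed.

Definition Yq j : {poly R} := if j is j'.+1 then Yp T j - Yp T j' else Yp T 0.

Lemma horner_Yq j z : (Yq j).[2 * z] = Qp T j (z ^+ 2).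
Proof. by case: j => [|j]; rewrite /= ?hornerD ?hornerN !horner_Yp. Qed.

Lemma EpN (I : eqType) (kap c : I -> R) s F : Ep kap c s (- F) = - Ep kap c s F.
Proof. by rewrite -scaleN1r EpZ scaleN1r. Qed.

Lemma Qker_Ep j x y : in_simplex x -> in_simplex y ->
  Qker kappa j x y = (Cnorm kappa)^-1 *
    (Ep kappa (fun i => 2 * Num.sqrt (xext x i * xext y i)) (index_enum _) (Yq j)).[0].
Proof.
move=> hx hy; case: j => [|j]; rewrite /= ?Kker_Ep //.
by rewrite EpD EpN hornerD hornerN mulrBr.
Qed.

Lemma Lkernel_Ep P (f : R -> R) n x y : (forall j, is_Pn_kernel kappa j (P j)) ->
  in_simplex x -> in_simplex y ->
  Lkernel P f n x y = (Cnorm kappa)^-1 *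
    (Ep kappa (fun i => 2 * Num.sqrt (xext x i * xext y i)) (index_enum _)
      (\sum_(j < (2 * n).+1) f (j%:R / n%:R) *: Yq j)).[0].
Proof.
move=> hP hx hy; rewrite Ep_sum horner_sum mulr_sumr; apply: eq_bigr => j _.
by rewrite (Pn_kernelE kappa0 (hP j) hx hy) Qker_Ep // EpZ hornerZ mulrCA.
Qed.

Definition scoord n x i : R := n%:R * Num.sqrt (xext x i).

(* With X = n sqrt x_i, Y = n sqrt y_i this bounds n^2 (1 - z^2) from below in one coordinate. *)
Lemma one_sub_zsq n x y (t : 'I_d.+1 -> R) i : in_simplex x -> in_simplex y ->
  (forall i, `|t i| <= 1) ->
  (scoord n x i - scoord n y i) ^+ 2 / 2 + scoord n x i * scoord n y i / 2 * (1 - t i ^+ 2) <=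
  n%:R ^+ 2 * (1 - (\sum_i Num.sqrt (xext x i * xext y i) * t i) ^+ 2).
Proof.
move=> /[dup] hx /in_simplexP x0 /[dup] hy /in_simplexP y0 ht.
set z := \sum_i _.
pose sx i := Num.sqrt (xext x i); pose sy i := Num.sqrt (xext y i).
have sx0 (j : 'I_d.+1) : 0 <= sx j by exact: sqrtr_ge0.
have sy0 (j : 'I_d.+1) : 0 <= sy j by exact: sqrtr_ge0.
have sxE (j : 'I_d.+1) : sx j ^+ 2 = xext x j by rewrite sqr_sqrtr.
have syE (j : 'I_d.+1) : sy j ^+ 2 = xext y j by rewrite sqr_sqrtr.
have zb : `|z| <= \sum_i sx i * sy i * `|t i|.
  apply: le_trans (ler_norm_sum _ _ _) _; apply: ler_sum => j _.
  by rewrite sqrtrM // normrM ger0_norm // mulr_ge0.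
(* The barycentric coordinates of x and of y both sum to 1, so 1 is half of their total and the
   squares are completed coordinate by coordinate. *)
have S1 : \sum_i ((sx i - sy i) ^+ 2 / 2 + sx i * sy i * (1 - `|t i|)) = 1 - \sum_i sx i * sy i * `|t i|.
  transitivity (\sum_i (xext x i / 2 + xext y i / 2 - sx i * sy i * `|t i|)).
    by apply: eq_bigr => j _; rewrite -sxE -syE; field.
  by rewrite sumrB big_split /= -!mulr_suml !xext_sum; congr (_ - _); field.
have z1 : `|z| <= 1.
  apply: le_trans zb _; rewrite -subr_ge0 -S1; apply: sumr_ge0 => j _.
  by rewrite addr_ge0 ?divr_ge0 ?sqr_ge0 ?mulr_ge0 // subr_ge0.
have zz : 1 - `|z| <= 1 - z ^+ 2.
  by rewrite lerD2l lerN2 -real_normK ?num_real // expr2 ler_piMr.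
have zi : (sx i - sy i) ^+ 2 / 2 + sx i * sy i * (1 - `|t i|) <= 1 - `|z|.
  apply: (@le_trans _ _ (1 - \sum_i sx i * sy i * `|t i|)); last by rewrite lerD2l lerN2.
  rewrite -S1 (bigD1 i) //= lerDl; apply: sumr_ge0 => j _.
  by rewrite addr_ge0 ?divr_ge0 ?sqr_ge0 ?mulr_ge0 // subr_ge0.
have ti : (1 - t i ^+ 2) / 2 <= 1 - `|t i|.
  rewrite -[t i ^+ 2]real_normK ?num_real //; have := sqr_ge0 (1 - `|t i|); rewrite sqrrB expr1n mul1r; lra.
have -> : (scoord n x i - scoord n y i) ^+ 2 / 2 + scoord n x i * scoord n y i / 2 * (1 - t i ^+ 2) =
   n%:R ^+ 2 * ((sx i - sy i) ^+ 2 / 2 + sx i * sy i * ((1 - t i ^+ 2) / 2)).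
  by rewrite /scoord -/(sx i) -/(sy i); field.
rewrite ler_wpM2l ?exprn_ge0 //; apply: le_trans zz; apply: le_trans zi.
by rewrite lerD2l ler_wpM2l // mulr_ge0.
Qed.

(** With X = n sqrt x_i and Y = n sqrt y_i this is used for B = XY / 2, V = 1 + (X - Y)^2 / 2 and u
    = (1 + X^2) (1 + Y^2). The gain (1 + B)^(-k) of the mean is too small when X and Y are far
    apart, and the power of V makes up for it. *)
Lemma weight_factor (k B V u : R) q : 0 <= k -> k + 1 <= q%:R -> 0 <= B -> 1 <= V -> 0 < u ->
  u <= (2 * (1 + B)) ^+ 2 * (2 * V) ->
  (V ^+ q)^-1 * (1 + B) `^ (- k) <= 8 `^ (k / 2) * u `^ (- (k / 2)).
Proof.
move=> k0 kq B0 V1 u0 hu.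
have V0 : 0 < V by apply: lt_le_trans V1.
have B1 : 0 < 1 + B by rewrite ltr_wpDr.
have k2 : 0 <= k / 2 by rewrite divr_ge0.
have h : u `^ (k / 2) <= 8 `^ (k / 2) * ((1 + B) `^ k * V ^+ q).
  apply: (@le_trans _ _ ((8 * ((1 + B) ^+ 2 * V)) `^ (k / 2))).
    apply: ge0_ler_powR; rewrite ?nnegrE ?(ltW u0) ?mulr_ge0 ?exprn_ge0 ?(ltW B1) ?(ltW V0) //.
    by apply: le_trans hu _; rewrite le_eqVlt; apply/orP; left; apply/eqP; ring.
  have b2 : 0 <= (1 + B) ^+ 2 by rewrite exprn_ge0 // ltW.
  have -> : (8 * ((1 + B) ^+ 2 * V)) `^ (k / 2) = 8 `^ (k / 2) * (((1 + B) ^+ 2) `^ (k / 2) * V `^ (k / 2)).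
    have p8 : 0 <= 8 :> R by [].
    by rewrite -(@powRM _ _ V _ b2 (ltW V0)) -(@powRM _ 8 _ _ p8) // mulr_ge0 // ltW.
  rewrite ler_wpM2l ?powR_ge0 //.
  apply: ler_pM; rewrite ?powR_ge0 //.
    by rewrite -(@powR_mulrn _ (1 + B)) ?(ltW B1) // -powRrM mulrCA divff // mulr1.
  by rewrite -(@powR_mulrn _ V) ?(ltW V0) //; apply: ler_powR => //; lra.
have p1 : 0 < (1 + B) `^ k by apply: powR_gt0.
have p2 : 0 < V ^+ q by apply: exprn_gt0.
have p3 : 0 < u `^ (k / 2) by apply: powR_gt0.
rewrite !powRN -invfM ler_pdivlMr // mulrC ler_pdivrMr ?mulr_gt0 //.
by apply: le_trans h _; rewrite [V ^+ q * _]mulrC.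
Qed.

(** The product of the decay bounds with exponents l and M, hence a bound for the square of the sum;
    144 = 12^2. The constant depends on M but not on l, which later grows with n rho. *)
Lemma zonal_two_scale M : exists2 C, 0 < C & forall (g : nat -> R -> R) (H : nat -> R) n l c0 s,
  jet g -> (forall i t, (0 < i)%N -> 0 < t -> `|g i t| <= H i) ->
  (forall i, (0 < i)%N -> 8 * i.+1%:R * H i <= H i.+1) -> (forall i, 0 <= H i) ->
  (forall t, 0 <= t < 2^-1 -> g 0%N t = c0) -> (forall t, 2 < t -> g 0%N t = 0) ->
  (forall t, 0 <= t -> `|g 0%N t| <= H 0%N) ->
  (0 < n)%N -> (8 * l <= n)%N -> 0 <= s <= 1 ->
  (n%:R ^+ 2 * (1 - s) / 144) ^+ l * (1 + n%:R ^+ 2 * (1 - s)) ^+ M *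
    (\sum_(j < (2 * n).+1) g 0%N (j%:R / n%:R) * Qp T j s) ^+ 2 <=
  C * ((H 0%N + H M.*2) * H l.*2 * (n%:R `^ (2 * T - 1)) ^+ 2).
Proof.
have [C C0 HC] := zonal_decay thsum_ge1.
pose e := 1 + 144 ^+ M + (8 * M)%:R ^+ M.*2 : R.
have e0 : 0 < e by rewrite /e -addrA ltr_pwDl // addr_ge0 ?exprn_ge0.
exists (C * (C * (2 ^+ M * e))); first by rewrite !mulr_gt0 ?exprn_gt0.
move=> g H n l c0 s jg h1 h2 h3 h4 h5 h6 n0 ln /andP[s0 s1].
have B l' : (8 * l' <= n)%N -> _ := fun h => HC g H n l' c0 s jg h1 h2 h3 h4 h5 h6 n0 h (introT andP (conj s0 s1)).
set G := \sum_(j < _) _; set N := n%:R `^ _.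
have N0 : 0 <= N by apply: powR_ge0.
have nR : 0 < n%:R :> R by rewrite ltr0n.
have {}B l' : (8 * l' <= n)%N -> (n%:R ^+ 2 * (1 - s)) ^+ l' * `|G| <= C * (N * (144 ^+ l' * H l'.*2)).
  move=> h; have := B l' h; rewrite -/G -/N => {}h.
  rewrite exprMn -mulrA; apply: (@le_trans _ _ ((n%:R ^+ 2) ^+ l' * (C * N * ((12 / n%:R) ^+ l'.*2 * H l'.*2)))).
    by rewrite ler_wpM2l // exprn_ge0 // exprn_ge0 // ltW.
  rewrite le_eqVlt; apply/orP; left; apply/eqP.
  have -> : 144 ^+ l' = (n%:R ^+ 2) ^+ l' * (12 / n%:R) ^+ l'.*2 :> R.
    rewrite -mul2n exprM -exprMn; congr (_ ^+ _); field; by rewrite gt_eqF.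
  by ring.
set v := n%:R ^+ 2 * (1 - s) in B *.
have v0 : 0 <= v by rewrite mulr_ge0 ?exprn_ge0 // subr_ge0.
have G0 : 0 <= `|G| by [].
have E1 : (v / 144) ^+ l * `|G| <= C * (N * H l.*2).
  have -> : (v / 144) ^+ l * `|G| = (144 ^+ l)^-1 * (v ^+ l * `|G|) by rewrite expr_div_n; ring.
  by rewrite mulrC ler_pdivrMr ?exprn_gt0 //; apply: le_trans (B l ln) _; rewrite le_eqVlt; apply/orP; left; apply/eqP; ring.
have EG : `|G| <= C * (N * H 0%N) by have := B 0%N isT; rewrite !expr0 !mul1r.
have E2 : (1 + v) ^+ M * `|G| <= C * (N * ((H 0%N + H M.*2) * (2 ^+ M * e))).
  have p1 : (1 + v) ^+ M <= 2 ^+ M * (1 + v ^+ M).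
    have [v1|v1] := leP v 1.
      apply: (@le_trans _ _ (2 ^+ M)); last by rewrite ler_peMr ?exprn_ge0 // lerDl exprn_ge0.
      by rewrite lerXn2r ?nnegrE ?addr_ge0 //; move: v1; lra.
    apply: (@le_trans _ _ ((2 * v) ^+ M)).
      by rewrite lerXn2r ?nnegrE ?addr_ge0 ?mulr_ge0 //; move: v1; lra.
    by rewrite exprMn ler_wpM2l ?exprn_ge0 // lerDr.
  have p2 : v ^+ M * `|G| <= C * (N * ((H 0%N + H M.*2) * (144 ^+ M + (8 * M)%:R ^+ M.*2))).
    (* For n < 8 M there is no decay estimate of order M, but then v <= n^2 is bounded by (8 M)^2
       and the bound without decay is enough. *)
    have [h|h] := leqP (8 * M) n.
      apply: le_trans (B M h) _; rewrite ler_wpM2l ?(ltW C0) // ler_wpM2l // mulrC.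
      by apply: ler_pM; rewrite ?exprn_ge0 ?lerDr ?lerDl ?exprn_ge0.
    apply: (@le_trans _ _ ((8 * M)%:R ^+ M.*2 * (C * (N * H 0%N)))).
      apply: ler_pM; rewrite ?exprn_ge0 //.
      rewrite -mul2n exprM lerXn2r ?nnegrE ?exprn_ge0 //.
      apply: (@le_trans _ _ (n%:R ^+ 2)).
        by rewrite ler_piMr ?exprn_ge0 // lerBlDr lerDl.
      by rewrite lerXn2r ?nnegrE // ler_nat ltnW.
    rewrite mulrCA ler_wpM2l ?(ltW C0) // mulrCA ler_wpM2l // mulrC.
    by apply: ler_pM; rewrite ?exprn_ge0 ?lerDr ?lerDl ?exprn_ge0.
  apply: (@le_trans _ _ (2 ^+ M * (1 + v ^+ M) * `|G|)); first by rewrite ler_wpM2r.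
  rewrite -mulrA mulrDl mul1r.
  have : `|G| + v ^+ M * `|G| <= C * (N * ((H 0%N + H M.*2) * e)).
    have q0 : `|G| <= C * (N * ((H 0%N + H M.*2) * 1)).
      by apply: le_trans EG _; rewrite ler_wpM2l ?(ltW C0) // ler_wpM2l // mulr1 lerDl.
    apply: le_trans (lerD q0 p2) _; rewrite le_eqVlt; apply/orP; left; apply/eqP; rewrite /e; ring.
  move=> h; apply: (@le_trans _ _ (2 ^+ M * (C * (N * ((H 0%N + H M.*2) * e))))).
    by rewrite ler_wpM2l ?exprn_ge0.
  by rewrite le_eqVlt; apply/orP; left; apply/eqP; ring.
rewrite -[G ^+ 2]real_normK ?num_real //.
have -> : (v / 144) ^+ l * (1 + v) ^+ M * `|G| ^+ 2 = (v / 144) ^+ l * `|G| * ((1 + v) ^+ M * `|G|) by ring.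
apply: (@le_trans _ _ (C * (N * H l.*2) * (C * (N * ((H 0%N + H M.*2) * (2 ^+ M * e)))))).
  by apply: ler_pM => //; rewrite mulr_ge0 // exprn_ge0 ?divr_ge0 ?addr_ge0.
by rewrite le_eqVlt; apply/orP; left; apply/eqP; ring.
Qed.

(** Since x_i + n^(-2) = n^(-2) (1 + (n sqrt x_i)^2), each coordinate takes n^(2 kappa_i) out of
    n^(2T-1), and n^d remains. *)
Lemma sqrt_Wk n x y : (0 < n)%N -> in_simplex x -> in_simplex y ->
  n%:R `^ (2 * T - 1) * \prod_i ((1 + scoord n x i ^+ 2) * (1 + scoord n y i ^+ 2)) `^ (- (kappa i / 2)) =
  n%:R ^+ d / (Num.sqrt (Wk kappa n x) * Num.sqrt (Wk kappa n y)).
Proof.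
move=> n0 hx hy; have nR : 0 < n%:R :> R by rewrite ltr0n.
have scE z i : in_simplex z -> xext z i + n%:R ^- 2 = n%:R ^- 2 * (1 + scoord n z i ^+ 2).
  move=> /in_simplexP hz; rewrite /scoord exprMn sqr_sqrtr //; field; by rewrite gt_eqF.
have p0 z i : 0 < 1 + scoord n z i ^+ 2 by rewrite ltr_pwDl // sqr_ge0.
have nn z : 0 <= n%:R `^ z :> R by exact: powR_ge0.
have sq z : in_simplex z -> Num.sqrt (Wk kappa n z) = \prod_i (n%:R `^ (- kappa i) * (1 + scoord n z i ^+ 2) `^ (kappa i / 2)).
  move=> hz; have -> : Wk kappa n z = (\prod_i (n%:R `^ (- kappa i) * (1 + scoord n z i ^+ 2) `^ (kappa i / 2))) ^+ 2.
    rewrite -prodrXl; apply: eq_bigr => i _; rewrite scE // powRM ?(ltW (p0 z i)) ?invr_ge0 ?exprn_ge0 //.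
    rewrite [RHS]exprMn; congr (_ * _).
      have -> : n%:R ^- 2 = n%:R `^ (- 2) :> R by rewrite powRN (@powR_mulrn _ n%:R 2) // ltW.
      by rewrite -(@powR_mulrn _ (_ `^ _) 2) // -!powRrM; congr (_ `^ _); ring.
    by rewrite -(@powR_mulrn _ (_ `^ _) 2) ?powR_ge0 // -powRrM; congr (_ `^ _); field.
  by rewrite sqrtr_sqr ger0_norm //; apply: prodr_ge0 => i _; rewrite mulr_ge0 ?powR_ge0.
have pD a b : n%:R `^ (a + b) = n%:R `^ a * n%:R `^ b :> R.
  by rewrite powRD // (gt_eqF nR) implybT.
rewrite !sq // -big_split -prodfV /= thsumE addrC pD powR_mulrn ?(ltW nR) // -mulrA; congr (_ * _).
have -> : n%:R `^ (2 * \sum_i kappa i) = \prod_i n%:R `^ (2 * kappa i) :> R.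
  rewrite mulr_sumr; elim/big_rec2: _ => [|i a b _ <-]; first by rewrite powRr0.
  by rewrite pD.
rewrite -big_split; apply: eq_bigr => i _ /=.
have -> : n%:R `^ (2 * kappa i) = (n%:R `^ (- kappa i) * n%:R `^ (- kappa i))^-1 :> R.
  by rewrite -pD -powRN; congr (_ `^ _); ring.
have [px py] := (ltW (p0 x i), ltW (p0 y i)).
by rewrite (powRN _ (kappa i / 2)) (powRM _ px py) -invfM mulrACA.
Qed.

End KernelEstimate.

(** * The kernel estimate with l derivatives *)

Section KernelBound.
Variable R : realType.
Variables (d : nat) (kappa : 'I_d.+1 -> R).
Hypothesis d0 : (0 < d)%N.
Hypothesis kappa0 : forall i, 0 <= kappa i.
Implicit Types (x y : 'I_d -> R) (n l q j : nat).
Local Notation T := (thsum kappa).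

(** By [one_sub_zsq] each of the two bases in a coordinate is at most 1 + n^2 (1 - z^2); d + 1
    coordinates with two q-th powers each give the exponent. A fixed power of decay in z thus yields
    the product majorant that [Ep_bound] expects. *)
Lemma prod_jphi_le n x y q (t : 'I_d.+1 -> R) : in_simplex x -> in_simplex y ->
  (forall i, `|t i| <= 1) ->
  1 <= (1 + n%:R ^+ 2 * (1 - (\sum_i Num.sqrt (xext x i * xext y i) * t i) ^+ 2)) ^+ (d.+1 * (q + q)) *
    \prod_i (((1 + (scoord n x i - scoord n y i) ^+ 2 / 2) ^+ q)^-1 *
      jphi (scoord n x i * scoord n y i / 2) q (t i)).
Proof.
move=> hx hy ht; set v := n%:R ^+ 2 * _.
have key i := @one_sub_zsq R d n x y t i hx hy ht.
have sc0 (z : 'I_d -> R) (i : 'I_d.+1) : 0 <= scoord n z i by rewrite mulr_ge0 ?sqrtr_ge0.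
have -> : (1 + v) ^+ (d.+1 * (q + q)) = \prod_(i < d.+1) ((1 + v) ^+ q * (1 + v) ^+ q).
  by rewrite prodr_const card_ord -exprD -exprM mulnC.
rewrite -big_split /=; elim/big_rec: _ => [//|i a _ IH].
rewrite -[X in X <= _]mulr1; apply: ler_pM => //.
have t1 : 0 <= 1 - t i ^+ 2.
  by rewrite subr_ge0 -real_normK ?num_real // exprn_ile1.
have := key i; rewrite -/v; set V := _ / 2; set B := _ / 2 => h.
have V0 : 0 <= V by rewrite /V divr_ge0 ?sqr_ge0.
have B0 : 0 <= B * (1 - t i ^+ 2) by apply: mulr_ge0 => //; apply: divr_ge0 => //; apply: mulr_ge0; exact: sc0.
have v0 : 0 <= v by apply: le_trans h; rewrite addr_ge0.
rewrite /jphi mulrACA -[X in X <= _]mulr1; apply: ler_pM => //.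
  rewrite ler_pdivlMr ?exprn_gt0 ?ltr_pwDl // mul1r lerXn2r ?nnegrE ?addr_ge0 //.
  by rewrite lerD2l; apply: le_trans h; rewrite lerDl.
rewrite ler_pdivlMr ?exprn_gt0 ?ltr_pwDl // mul1r lerXn2r ?nnegrE ?addr_ge0 //.
by rewrite lerD2l; apply: le_trans h; rewrite lerDr.
Qed.

(** Since |z| <= w = cos rho, the factor u^l is a lower bound for the decay of order l at every t
    and leaves the mean; the remaining power M goes through [Ep_bound] and [weight_factor]. The
    constant 48 combines 16 from [acos_sqr_le] with 144 from [zonal_two_scale]: 48^2 = 16 * 144. *)
Theorem kernel_estimate : exists q, exists2 C, 0 < C &
  forall (P : nat -> ('I_d -> R) -> ('I_d -> R) -> R) (g : nat -> R -> R) (H : nat -> R) n l c0 x y,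
  (forall j, is_Pn_kernel kappa j (P j)) ->
  jet g -> (forall i t, (0 < i)%N -> 0 < t -> `|g i t| <= H i) ->
  (forall i, (0 < i)%N -> 8 * i.+1%:R * H i <= H i.+1) -> (forall i, 0 <= H i) ->
  (forall t, 0 <= t < 2^-1 -> g 0%N t = c0) -> (forall t, 2 < t -> g 0%N t = 0) ->
  (forall t, 0 <= t -> `|g 0%N t| <= H 0%N) ->
  (0 < n)%N -> (8 * l <= n)%N -> in_simplex x -> in_simplex y ->
  (n%:R * rho x y / 48) ^+ l.*2 * Lkernel P (g 0%N) n x y ^+ 2 <=
  C * ((H 0%N + H q) * H l.*2) *
    (n%:R ^+ d / (Num.sqrt (Wk kappa n x) * Num.sqrt (Wk kappa n y))) ^+ 2.
Proof.
have [q hq] : exists q, forall i, kappa i + 1 <= q%:R.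
  exists (Num.bound (1 + \sum_i kappa i)) => i.
  have s0 : 0 <= \sum_i kappa i by apply: sumr_ge0.
  apply: le_trans (ltW (archi_boundP _)); rewrite ?addr_ge0 // addrC lerD2l.
  by rewrite (bigD1 i) //= lerDl sumr_ge0.
pose Q (i : 'I_d.+1) (C : R) := 0 < C /\ forall (p : {poly R}) (c B : R),
    0 <= c -> 0 <= B -> (forall t : R, `|t| <= 1 -> `|p.[t]| <= c * jphi B q t) ->
    `|Jm (kappa i) p| <= C * (c * (1 + B) `^ (- kappa i)).
have /choice[CJ HCJ] : forall i, exists C, Q i C.
  by move=> i; have [C C0 HC] := Jm_bound (kappa0 i) (hq i); exists C.
pose M := (d.+1 * (q + q))%N.
have [C C0 HC] := @zonal_two_scale R d kappa d0 kappa0 M.*2.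
exists M.*2.*2.
pose K := (Cnorm kappa)^-1 * \prod_i (CJ i * 8 `^ (kappa i / 2)).
exists (C * K ^+ 2).
  rewrite mulr_gt0 // exprn_gt0 // mulr_gt0 ?invr_gt0 ?Cnorm_gt0 //.
  by apply: prodr_gt0 => i _; rewrite mulr_gt0 ?powR_gt0 //; case: (HCJ i).
move=> P g H n l c0 x y hP jg h1 h2 h3 h4 h5 h6 n0 ln hx hy.
pose w := \sum_i Num.sqrt (xext x i * xext y i).
pose u := n%:R ^+ 2 * (1 - w ^+ 2) / 144.
have /andP[w0 w1] : 0 <= w <= 1.
  by rewrite sumr_ge0 ?sum_sqrt_le1 // => i _; exact: sqrtr_ge0.
have u0 : 0 <= u by rewrite divr_ge0 // mulr_ge0 ?exprn_ge0 // subr_ge0 expr_le1.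
apply: (@le_trans _ _ (u ^+ l * Lkernel P (g 0%N) n x y ^+ 2)).
  have r0 : 0 <= rho x y by apply: acos_ge0; rewrite -/w w1 andbT; move: w0; clear; lra.
  have r1 : 0 <= n%:R * rho x y / 48 by rewrite divr_ge0 // mulr_ge0.
  rewrite ler_wpM2r ?sqr_ge0 // -mul2n exprM lerXn2r ?nnegrE ?exprn_ge0 //.
  have := @acos_sqr_le R w; rewrite w0 w1 => /(_ isT) hr.
  have -> : (n%:R * rho x y / 48) ^+ 2 = n%:R ^+ 2 * (rho x y ^+ 2 / 16) / 144 by field.
  by rewrite ler_pM2r // ler_wpM2l ?exprn_ge0 // ler_pdivrMr // mulrC.
pose F : {poly R} := \sum_(j < (2 * n).+1) g 0%N (j%:R / n%:R) *: Yq kappa j.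
pose N := n%:R `^ (2 * T - 1) : R.
pose S := Num.sqrt (C * ((H 0%N + H M.*2.*2) * H l.*2 * N ^+ 2)).
have S2 : S ^+ 2 = C * ((H 0%N + H M.*2.*2) * H l.*2 * N ^+ 2).
  by rewrite sqr_sqrtr // mulr_ge0 ?(ltW C0) // mulr_ge0 ?sqr_ge0 // mulr_ge0 // addr_ge0.
have S0 : 0 <= S by exact: sqrtr_ge0.
pose D i := ((1 + (scoord n x i - scoord n y i) ^+ 2 / 2) ^+ q)^-1.
pose B i := scoord n x i * scoord n y i / 2.
pose c i := 2 * Num.sqrt (xext x i * xext y i).
have sc0 (z : 'I_d -> R) (i : 'I_d.+1) : 0 <= scoord n z i by rewrite mulr_ge0 ?sqrtr_ge0.
have D0 i : 0 <= D i by rewrite invr_ge0 exprn_ge0 // addr_ge0 // divr_ge0 ?sqr_ge0.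
have B0 i : 0 <= B i by rewrite divr_ge0 // mulr_ge0.
pose CC i := CJ i * (D i * (1 + B i) `^ (- kappa i)).
have CC0 i : 0 <= CC i.
  by rewrite mulr_ge0 ?(ltW (HCJ i).1) // mulr_ge0 // powR_ge0.
have HJ i p M0 : 0 <= M0 -> (forall t, `|t| <= 1 -> `|p.[t]| <= M0 * (D i * jphi (B i) q t)) ->
     `|Jm (kappa i) p| <= M0 * CC i.
  move=> M00 hp; apply: le_trans ((HCJ i).2 p (M0 * D i) (B i) _ _ _) _ => //; first exact: mulr_ge0.
    by move=> t ht; rewrite -mulrA; exact: hp.
  by rewrite le_eqVlt; apply/orP; left; apply/eqP; rewrite /CC; ring.
have EB := @Ep_bound R _ kappa c q B D CC B0 D0 CC0 HJ (index_enum _) (Num.sqrt (u ^+ l) *: F) S 0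
   (index_enum_uniq _) S0.
have {EB} : `|(Ep kappa c (index_enum _) (Num.sqrt (u ^+ l) *: F)).[0]| <= S * \prod_i CC i.
  apply: EB => t ht; rewrite add0r.
  pose z := \sum_i Num.sqrt (xext x i * xext y i) * t i.
  have -> : \sum_i c i * t i = 2 * z by rewrite mulr_sumr; apply: eq_bigr => i _; rewrite mulrA.
  have zw : `|z| <= w.
    apply: le_trans (ler_norm_sum _ _ _) _; apply: ler_sum => i _.
    by rewrite normrM ger0_norm ?sqrtr_ge0 // ler_piMr ?sqrtr_ge0.
  have zw2 : z ^+ 2 <= w ^+ 2 by rewrite -real_normK ?num_real // lerXn2r ?nnegrE.
  have z2 : 0 <= z ^+ 2 <= 1 by rewrite sqr_ge0 (le_trans zw2) // expr_le1.
  have -> : (Num.sqrt (u ^+ l) *: F).[2 * z] =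
      Num.sqrt (u ^+ l) * \sum_(j < (2 * n).+1) g 0%N (j%:R / n%:R) * Qp T j (z ^+ 2).
    rewrite hornerZ horner_sum; congr (_ * _); apply: eq_bigr => j _.
    by rewrite hornerZ horner_Yq.
  have := HC g H n l c0 _ jg h1 h2 h3 h4 h5 h6 n0 ln z2; rewrite -/N -S2.
  set G := \sum_(j < _) _; set v := n%:R ^+ 2 * _ => hG.
  have v0 : 0 <= v by rewrite mulr_ge0 ?exprn_ge0 // subr_ge0; case/andP: z2.
  have uv : u <= v / 144 by rewrite ler_pM2r // ler_wpM2l ?exprn_ge0 // lerD2l lerN2.
  have key : Num.sqrt (u ^+ l) * `|G| * (1 + v) ^+ M <= S.
    rewrite -(@ler_pXn2r _ 2) ?nnegrE ?mulr_ge0 ?exprn_ge0 ?sqrtr_ge0 ?addr_ge0 //.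
    apply: le_trans hG.
    have -> : (Num.sqrt (u ^+ l) * `|G| * (1 + v) ^+ M) ^+ 2 = u ^+ l * G ^+ 2 * (1 + v) ^+ M.*2.
      have su := sqr_sqrtr (exprn_ge0 l u0).
      have sG : `|G| ^+ 2 = G ^+ 2 by rewrite real_normK // num_real.
      by rewrite -muln2 (exprM _ M 2) -su -sG -!exprMn su.
    have v1 : 0 <= (1 + v) ^+ M.*2 by rewrite exprn_ge0 // addr_ge0.
    rewrite mulrAC ler_wpM2r ?sqr_ge0 // ler_wpM2r //.
    by rewrite lerXn2r ?nnegrE // divr_ge0.
  rewrite normrM ger0_norm ?sqrtr_ge0 //.
  have := prod_jphi_le n q hx hy ht; rewrite -/v -/M; set Pi := \prod_i _ => hPi.
  have Pi0 : 0 <= Pi.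
    have : 0 < (1 + v) ^+ M by rewrite exprn_gt0 // ltr_pwDl.
    by move=> e0; rewrite -(pmulr_rge0 _ e0) (le_trans _ hPi).
  apply: (@le_trans _ _ (Num.sqrt (u ^+ l) * `|G| * ((1 + v) ^+ M * Pi))).
    by rewrite ler_peMr // mulr_ge0 ?sqrtr_ge0.
  by rewrite mulrA ler_wpM2r.
rewrite EpZ hornerZ normrM ger0_norm ?sqrtr_ge0 // => E.
rewrite (Lkernel_Ep kappa0 _ _ hP hx hy) -/F -/c (@exprMn _ _ (Cnorm kappa)^-1).
set L := (Ep _ _ _ _).[0] in E *.
pose U := \prod_i ((1 + scoord n x i ^+ 2) * (1 + scoord n y i ^+ 2)) `^ (- (kappa i / 2)).
have U0 : 0 <= U by apply: prodr_ge0 => i _; exact: powR_ge0.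
pose K1 := \prod_i (CJ i * 8 `^ (kappa i / 2)).
have CCU : \prod_i CC i <= K1 * U.
  rewrite -big_split /=; apply: ler_prod => i _; rewrite CC0 /= /CC -mulrA ler_wpM2l ?(ltW (HCJ i).1) //.
  apply: weight_factor => //; first by rewrite lerDl divr_ge0 ?sqr_ge0.
    by rewrite mulr_gt0 // ltr_pwDl ?sqr_ge0.
  rewrite /B; set X := scoord n x i; set Y := scoord n y i.
  have hX : 0 <= X := sc0 x i.
  have hY : 0 <= Y := sc0 y i.
  have hXY : 0 <= X * Y by rewrite mulr_ge0.
  have -> : (2 * (1 + X * Y / 2)) ^+ 2 * (2 * (1 + (X - Y) ^+ 2 / 2)) =
     (1 + X ^+ 2) * (1 + Y ^+ 2) + (7 + 6 * (X * Y) + (X * Y) ^+ 2 + 3 * (X - Y) ^+ 2 + 4 * (X * Y) * (X - Y) ^+ 2 + (X * Y) ^+ 2 * (X - Y) ^+ 2).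
    by field.
  have := sqr_ge0 (X * Y); have := sqr_ge0 (X - Y).
  move: hXY; move: (X * Y) ((X * Y) ^+ 2) ((X - Y) ^+ 2) => p p2 r p0 r0 p20.
  by rewrite lerDl !addr_ge0 ?mulr_ge0.
rewrite -(sqrt_Wk kappa n0 hx hy) -/N -/U.
have E2 : u ^+ l * L ^+ 2 <= S ^+ 2 * (K1 * U) ^+ 2.
  rewrite -(sqr_sqrtr (exprn_ge0 l u0)) -[L ^+ 2]real_normK ?num_real // -!exprMn.
  rewrite lerXn2r ?nnegrE ?mulr_ge0 ?sqrtr_ge0 //.
    by apply: prodr_ge0 => i _; rewrite mulr_ge0 ?powR_ge0 // ltW //; case: (HCJ i).
  by apply: le_trans E _; rewrite ler_wpM2l.
rewrite mulrCA; apply: (@le_trans _ _ ((Cnorm kappa)^-1 ^+ 2 * (S ^+ 2 * (K1 * U) ^+ 2))).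
  by rewrite ler_wpM2l ?sqr_ge0.
by rewrite S2 /K -/K1 le_eqVlt; apply/orP; left; apply/eqP; ring.
Qed.

End KernelBound.

(** * Optimising the number of derivatives *)

Section KernelDecay.
Variable R : realType.

(** From e^(-1/6) >= 5/6 and (6/5)^6 < 3. *)
Lemma expR1_le3 : expR 1 <= 3 :> R.
Proof.
have h := @expR_ge1Dx R (- 6^-1).
have h3 : (1 - 6^-1) ^+ 3 <= expR (- 6^-1) ^+ 3 :> R.
  by rewrite lerXn2r ?nnegrE ?expR_ge0 //; lra.
have e2 : 0 < expR 2^-1 :> R by exact: expR_gt0.
have e1 : expR 2^-1 <= 7 / 4 - 50^-1 :> R.
  move: h3; rewrite -expRM_natl; have -> : 3 * - 6^-1 = - 2^-1 :> R by field.
  rewrite expRN -[(expR _)^-1]div1r ler_pdivlMr //.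
  have -> : (1 - 6^-1) ^+ 3 = 125 / 216 :> R by field.
  by lra.
have -> : expR 1 = expR 2^-1 * expR 2^-1 :> R by rewrite -expRD; congr expR; field.
by move: e1 e2; nra.
Qed.

Variables (d : nat) (kappa : 'I_d.+1 -> R).
Hypothesis d0 : (0 < d)%N.
Hypothesis kappa0 : forall i, 0 <= kappa i.

Lemma rho_ge0 (x y : 'I_d -> R) : in_simplex x -> in_simplex y -> 0 <= rho x y.
Proof.
move=> hx hy; apply: acos_ge0; rewrite sum_sqrt_le1 // andbT.
by apply: (@le_trans _ _ 0); rewrite ?lerN10 // sumr_ge0 // => i _; exact: sqrtr_ge0.
Qed.

Lemma rho_le4 (x y : 'I_d -> R) : in_simplex x -> in_simplex y -> rho x y <= 4.
Proof.
move=> hx hy; rewrite -(@ler_pXn2r _ 2) ?nnegrE ?rho_ge0 //.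
have /acos_sqr_le : 0 <= \sum_i Num.sqrt (xext x i * xext y i) <= 1.
  by rewrite sumr_ge0 ?sum_sqrt_le1 // => i _; exact: sqrtr_ge0.
move=> /le_trans; apply; have -> : 4 ^+ 2 = 16 * 1 :> R by field.
by rewrite ler_wpM2l // gerBl sqr_ge0.
Qed.

(** Here y(u) is the number of derivatives that may be spent at u = n rho. For k = 2l <= y(u), 144
    beta_k <= u makes beta_k / (u / 48) at most 1/3 <= 1/e, so the square of the kernel gains
    e^(-2l). Rounding l costs a factor e; y(u) <= u / 16 and u <= 4 n ensure 8 l <= n. A negative
    y(u) is allowed and means l = 0. *)
Lemma kernel_expdecay (H beta : nat -> R) (y : R -> R) (A : R) :
  (forall i, (0 < i)%N -> 8 * i.+1%:R * H i <= H i.+1) -> (forall i, 0 <= H i) ->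
  0 <= A -> (forall k, 0 <= beta k) -> (forall k, H k <= A * beta k ^+ k) ->
  (forall u, 0 <= u -> y u <= u / 16) ->
  (forall u k, 0 <= u -> (0 < k)%N -> k%:R <= y u -> 144 * beta k <= u) ->
  exists2 c, 0 < c & forall P (g : nat -> R -> R) n c0 (x z : 'I_d -> R),
  (forall j, is_Pn_kernel kappa j (P j)) ->
  jet g -> (forall i t, (0 < i)%N -> 0 < t -> `|g i t| <= H i) ->
  (forall t, 0 <= t < 2^-1 -> g 0%N t = c0) -> (forall t, 2 < t -> g 0%N t = 0) ->
  (forall t, 0 <= t -> `|g 0%N t| <= H 0%N) ->
  (0 < n)%N -> in_simplex x -> in_simplex z ->
  `|Lkernel P (g 0%N) n x z| <=
    c * n%:R ^+ d / (Num.sqrt (Wk kappa n x) * Num.sqrt (Wk kappa n z)) * expR (- (y (n%:R * rho x z) / 2)).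
Proof.
move=> h1 h2 A0 b0 hA hy hk.
have [q [C C0 HC]] := kernel_estimate d0 kappa0.
pose B := C * (H 0%N + H q) * A.
have B0 : 0 <= B by rewrite mulr_ge0 // mulr_ge0 ?(ltW C0) // addr_ge0.
exists (Num.sqrt B * expR 1 + 1); first by rewrite ltr_wpDl // mulr_ge0 ?sqrtr_ge0 ?expR_ge0.
move=> P g n c0 x z hP jg hg g1 g2 g3 n0 hx hz.
set u := n%:R * rho x z; set W := Num.sqrt _ * Num.sqrt _.
have u0 : 0 <= u by rewrite mulr_ge0 ?rho_ge0.
have un : u <= 4 * n%:R by rewrite /u mulrC ler_wpM2r ?rho_le4.
pose l := if 0 <= y u then Num.truncn (y u / 2) else 0%N.
have l1 : y u <= 2 * l%:R + 2.
  rewrite /l; case: ifP => [y0|/negbT]; last by rewrite -ltNge => /ltW h; rewrite mulr0 add0r (le_trans h).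
  have := @truncnS_gt R (y u / 2); move: (Num.truncn _) => m; rewrite -(natr1 m); lra.
have l2 : (0 < l)%N -> l.*2%:R <= y u.
  rewrite /l; case: ifP => // y0 _.
  have : (Num.truncn (y u / 2))%:R <= y u / 2 by rewrite truncn_le // divr_ge0.
  by rewrite -muln2 natrM ler_pdivlMr.
have l3 : (8 * l <= n)%N.
  have [->|/l2 h] := posnP l; first by rewrite muln0.
  rewrite -(ler_nat R) natrM; have := hy u u0; move: h; rewrite -muln2 natrM; lra.
have := HC P g H n l c0 x z hP jg hg h1 h2 g1 g2 g3 n0 l3 hx hz; rewrite -/u -/W.
set L := Lkernel _ _ _ _ _ => hL.
pose w : R := n%:R ^+ d / W.
have w0 : 0 <= w by rewrite divr_ge0 ?exprn_ge0 // mulr_ge0 ?sqrtr_ge0.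
have E : L ^+ 2 <= (Num.sqrt B * w * expR (- l%:R)) ^+ 2.
  have -> : (Num.sqrt B * w * expR (- l%:R)) ^+ 2 = B * w ^+ 2 * expR (- (2 * l%:R)).
    rewrite -[B in RHS](sqr_sqrtr B0) -mulrN (expRM_natl 2); ring.
  have [l0|l0] := posnP l.
    move: hL; rewrite l0 /= !expr0 mul1r mulr0 oppr0 expR0 mulr1 -/w => /le_trans; apply.
    rewrite ler_wpM2r ?sqr_ge0 // /B -!mulrA ler_wpM2l ?(ltW C0) // ler_wpM2l ?addr_ge0 //.
    by have := hA 0%N; rewrite expr0 mulr1.
  set k := l.*2 in hL *; have k0 : (0 < k)%N by rewrite double_gt0.
  have ku : 144 * beta k <= u := hk u k u0 k0 (l2 l0).
  have up : 0 < u.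
    have := le_trans (l2 l0) (hy u u0); have : 0 < k%:R :> R by rewrite ltr0n.
    by lra.
  have v0 : 0 < (u / 48) ^+ k by rewrite exprn_gt0 // divr_gt0.
  have hL2 : (u / 48) ^+ k * L ^+ 2 <= B * w ^+ 2 * beta k ^+ k.
    apply: le_trans hL _; rewrite -/w /B [X in _ <= X]mulrAC ler_wpM2r ?sqr_ge0 //.
    by rewrite -!mulrA ler_wpM2l ?(ltW C0) // ler_wpM2l ?addr_ge0.
  have -> : expR (- (2 * l%:R)) = (expR (- 1)) ^+ k :> R.
    by rewrite -expRM_natl mulrN mulr1 /k -mul2n natrM.
  apply: (@le_trans _ _ (B * w ^+ 2 * (beta k ^+ k / (u / 48) ^+ k))).
    by rewrite mulrA ler_pdivlMr // mulrC.
  have Bw : 0 <= B * w ^+ 2 by rewrite mulr_ge0 ?sqr_ge0.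
  rewrite ler_wpM2l // -expr_div_n lerXn2r ?nnegrE ?expR_ge0 //.
    by rewrite divr_ge0 // divr_ge0.
  apply: (@le_trans _ _ 3^-1); last first.
    by rewrite expRN lef_pV2 ?posrE ?expR_gt0 // expR1_le3.
  by rewrite ler_pdivrMr ?divr_gt0 //; move: ku; lra.
have {}E : `|L| <= Num.sqrt B * w * expR (- l%:R).
  have p : 0 <= Num.sqrt B * w * expR (- l%:R).
    by apply: mulr_ge0 (expR_ge0 _); apply: mulr_ge0 w0; exact: sqrtr_ge0.
  rewrite -(@ler_pXn2r _ 2) ?nnegrE //.
  by rewrite real_normK ?num_real.
rewrite -[_ * _ / W]mulrA -/w; apply: le_trans E _.
apply: (@le_trans _ _ (Num.sqrt B * w * (expR 1 * expR (- (y u / 2))))).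
  apply: ler_wpM2l; first by apply: mulr_ge0 w0; exact: sqrtr_ge0.
  rewrite -expRD ler_expR; move: l1; lra.
have -> : Num.sqrt B * w * (expR 1 * expR (- (y u / 2))) = Num.sqrt B * expR 1 * w * expR (- (y u / 2)) by ring.
by rewrite ler_wpM2r ?expR_ge0 // ler_wpM2r // lerDl.
Qed.

End KernelDecay.

(** * The main estimate *)

Section Jets.
Variable R : realType.
Implicit Types (f : R -> R) (g : nat -> R -> R).

Lemma derive1n_jet f : smooth_pos f -> jet (fun k => derive1n k f).
Proof.
move=> hf k t t0; have h := hf k t t0.
by apply: DeriveDef h _; rewrite derive1nS derive1E.
Qed.

Lemma jet_derive1n g k (t : R) : jet g -> 0 < t ->
  is_derive t 1 (derive1n k (g 0%N)) (g k.+1 t) /\ derive1n k (g 0%N) t = g k t.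
Proof.
move=> jg; elim: k t => [|k IH] t t0; first by split => //; exact: jg.
have E (s : R) : 0 < s -> derive1n k.+1 (g 0%N) s = g k.+1 s.
  by move=> /IH[[_ h] _]; rewrite derive1nS derive1E h.
split; last exact: E.
apply: (@near_eq_is_derive _ _ _ (g k.+1)); last exact: jg.
by near=> s; rewrite E //; near: s; exact: lt_nbhsr.
Unshelve. all: by end_near. Qed.

Lemma jet_smooth g : jet g -> smooth_pos (g 0%N).
Proof. by move=> jg k t t0; have [[]] := jet_derive1n k jg t0. Qed.

End Jets.

(** * The estimate under the given growth of derivatives *)

Section GrowthDecay.
Variable R : realType.

Lemma powR_ge1 (a x : R) : 1 <= a -> 0 <= x -> 1 <= a `^ x.
Proof. by move=> a1 x0; rewrite -(powRr0 a) ler_powR. Qed.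

Lemma admissible_bounds ty (f : R -> R) : admissible ty f ->
  exists c0, (forall t, 0 <= t < 2^-1 -> f t = c0) /\ (forall t, 2 < t -> f t = 0).
Proof.
case: ty => -[_ /=].
- move=> [h1 h2]; exists 1; split=> // t /andP[t0 t1]; apply: h2; rewrite t0 /=; move: t1; lra.
- move=> h; exists 0; split=> t.
    by move=> /andP[t0 t1]; apply: h => //; rewrite t1.
  by move=> t2; apply: h; rewrite ?t2 ?orbT //; move: t2; lra.
- move=> [h _]; exists 0; split=> t.
    by move=> /andP[t0 t1]; apply: h => //; rewrite t1.
  by move=> t2; apply: h; rewrite ?t2 ?orbT //; move: t2; lra.
Qed.

(** The growth hypothesis starts with the first derivative, so the cutoff itself is bounded by the
    mean value theorem on [t, 3], where f(3) = 0; the value at 0 equals the one at 1/4. *)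
Lemma sup_of_derivative (f g : R -> R) B c0 : (forall t : R, 0 < t -> is_derive t 1 f (g t)) ->
  (forall t, 0 < t -> `|g t| <= B) ->
  (forall t, 0 <= t < 2^-1 -> f t = c0) -> (forall t, 2 < t -> f t = 0) ->
  forall t, 0 <= t -> `|f t| <= 3 * B.
Proof.
move=> df hg f0 f2.
have B0 : 0 <= B by apply: le_trans (hg 1 ltr01); exact: normr_ge0.
have pos t : 0 < t -> `|f t| <= 3 * B.
  move=> t0; have [t3|t3] := leP 3 t.
    by rewrite f2 ?normr0 ?mulr_ge0 //; move: t3; lra.
  have cont : {within `[t, 3], continuous f}.
    apply: continuous_in_subspaceT => v; rewrite inE /= in_itv /= => /andP[uv _].
    apply: differentiable_continuous; apply/derivable1_diffP.
    by have [] := df v (lt_le_trans t0 uv).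
  have [|c] := @MVT R f g t 3 t3 _ cont.
    by move=> x; rewrite in_itv /= => /andP[tx _]; apply: df; apply: lt_trans tx.
  rewrite in_itv /= => /andP[tc _] E; have f3 : f 3 = 0 by apply: f2; lra.
  rewrite -normrN -[- f t]add0r -f3 E normrM mulrC ler_pM //.
    by rewrite ger0_norm ?subr_ge0 ?(ltW t3) // gerBl ltW.
  by apply: hg; apply: lt_trans tc.
move=> t; rewrite le_eqVlt => /orP[/eqP <-|]; last exact: pos.
have <- : f 4^-1 = f 0 by rewrite !f0 //; apply/andP; split; lra.
by apply: pos; rewrite invr_gt0.
Qed.

Variable ctilde : R.
Hypothesis ct1 : 1 < ctilde.
Let A := 8 * ctilde.
Let gam : R := (144 * A)^-1.

(** The maximum with 1 covers k = 1, 2, where ln k < 1 and the hypothesis has no logarithm; the 8 in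
    A gives 8 k <= [gbeta eps k], from which the growth condition on [gH] follows. *)
Definition gbeta eps (k : nat) : R := A / eps * (k%:R * (Num.max 1 (ln k%:R)) `^ (1 + eps)).
Definition gH eps k := if k is k'.+1 then ctilde * gbeta eps k ^+ k
  else 3 * (ctilde * gbeta eps 1).

(** If k <= y(u), then k <= u and ln k <= ln (e + u), so 144 beta_k <= (144 A / eps) y(u) (ln (e +
    u))^(1 + eps) = u. This fixes gam = 1 / (144 A) and makes the exponent linear in eps. *)
Lemma growth_decay (d : nat) (kappa : 'I_d.+1 -> R) (eps : R) : (0 < d)%N ->
  (forall i, 0 <= kappa i) -> 0 < eps <= 1 ->
  exists2 c, 0 < c & forall ty (f : R -> R) P,
  admissible ty f -> deriv_growth ctilde eps f -> (forall j, is_Pn_kernel kappa j (P j)) ->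
  forall n (x y : 'I_d -> R), (0 < n)%N -> in_simplex x -> in_simplex y ->
  `|Lkernel P f n x y| <=
    c * n%:R ^+ d / (Num.sqrt (Wk kappa n x) * Num.sqrt (Wk kappa n y)) *
    expR (- (gam / 2 * eps * (n%:R * rho x y) / (ln (expR 1 + n%:R * rho x y)) `^ (1 + eps))).
Proof.
move=> d0 kappa0 /andP[e0 e1].
have ct0 : 0 < ctilde by apply: lt_trans ct1.
have ctn : 0 <= ctilde by exact: ltW.
have A0 : 0 < A by rewrite mulr_gt0.
have A8 : 8 <= A by rewrite /A ler_peMr // ltW.
have ep0 : 0 <= 1 + eps by rewrite addr_ge0 // ltW.
have g0 : 0 < gam by rewrite invr_gt0 mulr_gt0.
have Ae : 8 <= A / eps by apply: le_trans A8 _; rewrite ler_pdivlMr // ler_piMr // ltW.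
have Ae0 : 0 <= A / eps by apply: le_trans Ae.
pose l (k : nat) : R := (Num.max 1 (ln k%:R)) `^ (1 + eps).
have l1 k : 1 <= l k by apply: powR_ge1 => //; rewrite le_max lexx.
have mx0 (k : nat) : 0 <= Num.max 1 (ln k%:R) :> R by rewrite le_max ler01.
have lm k : (0 < k)%N -> l k <= l k.+1.
  move=> k0; apply: ge0_ler_powR; rewrite ?nnegrE ?mx0 //.
  rewrite ge_max !le_max lexx /= ler_ln ?posrE ?ltr0n // ler_nat leqnSn orbT; exact: isT.
have b0 k : 0 <= gbeta eps k by apply: mulr_ge0 => //; apply: mulr_ge0 => //; exact: powR_ge0.
have b8 k : 8 * k%:R <= gbeta eps k.
  by apply: ler_pM => //; rewrite ler_peMr // l1.
have bm k : (0 < k)%N -> gbeta eps k <= gbeta eps k.+1.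
  move=> k0; rewrite ler_wpM2l // ler_pM ?ler_nat ?lm // ?(le_trans ler01 (l1 k)) //.
have H0 k : 0 <= gH eps k.
  case: k => [|k]; rewrite /gH; last by apply: mulr_ge0; rewrite ?exprn_ge0.
  by apply: mulr_ge0 => //; exact: mulr_ge0.
have Hs k : (0 < k)%N -> 8 * k.+1%:R * gH eps k <= gH eps k.+1.
  case: k => // k _; rewrite /gH mulrCA ler_wpM2l ?(ltW ct0) // [X in _ <= X]exprS ler_pM //.
    by rewrite exprn_ge0.
  by rewrite lerXn2r ?nnegrE // bm.
pose AA := ctilde + gH eps 0%N.
have AA0 : 0 <= AA by rewrite addr_ge0 // ltW.
pose L (u : R) := (ln (expR 1 + u)) `^ (1 + eps).
have lnu u : 0 <= u -> 1 <= ln (expR 1 + u).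
  by move=> u0; rewrite -[X in X <= _]expRK ler_ln ?posrE ?ltr_wpDr ?expR_gt0 // lerDl.
have L1 u : 0 <= u -> 1 <= L u by move=> u0; apply: powR_ge1 => //; exact: lnu.
pose y u := gam * eps * u / L u.
have yu u : 0 <= u -> y u <= gam * eps * u.
  move=> u0; rewrite ler_pdivrMr ?(lt_le_trans ltr01 (L1 u u0)) // ler_peMr ?L1 //.
  by rewrite !mulr_ge0 // ltW.
have ge1 : gam * eps <= 16^-1.
  apply: (@le_trans _ _ gam); first by rewrite ler_piMr // ltW.
  by rewrite lef_pV2 ?posrE ?mulr_gt0 //; move: A8; lra.
have [|||c c0 hc] := @kernel_expdecay R d kappa d0 kappa0 (gH eps) (gbeta eps) y AA Hs H0 AA0 b0.
- case=> [|k]; first by rewrite expr0 mulr1 lerDr ltW.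
  by rewrite ler_wpM2r ?exprn_ge0 // lerDl.
- move=> u u0; apply: le_trans (yu u u0) _.
  by rewrite mulrC ler_wpM2l.
- move=> u k u0 k0 ky.
  have kR : 0 < k%:R :> R by rewrite ltr0n.
  have ku : k%:R <= u.
    apply: le_trans ky _; apply: le_trans (yu u u0) _; rewrite ler_piMl //.
    by apply: le_trans ge1 _; rewrite invf_le1 // ler1n.
  have lL : l k <= L u.
    have ln0 : 0 <= ln (expR 1 + u) by apply: (@le_trans _ _ 1); [exact: ler01 | exact: lnu].
    apply: ge0_ler_powR; rewrite ?nnegrE ?mx0 //.
    rewrite ge_max lnu //= ler_ln ?posrE ?ltr_wpDr ?expR_gt0 //.
    by apply: le_trans ku _; rewrite lerDr expR_ge0.
  have Lp : 0 < L u by apply: lt_le_trans (L1 u u0).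
  move: ky; rewrite /y ler_pdivlMr // => ky.
  apply: (@le_trans _ _ (144 * (A / eps * (k%:R * L u)))).
    by rewrite ler_wpM2l // /gbeta ler_wpM2l // ler_wpM2l // ltW.
  apply: (@le_trans _ _ (144 * (A / eps * (gam * eps * u)))).
    by rewrite ler_wpM2l // ler_wpM2l.
  rewrite le_eqVlt; apply/orP; left; apply/eqP; rewrite /gam; field.
  by rewrite (gt_eqF A0) (gt_eqF e0).
exists c => // ty f P ad gr hP n x z n0 hx hz.
have [c1 [f0 f2]] := admissible_bounds ad.
have jf := derive1n_jet ad.1.
have gb i t : (0 < i)%N -> 0 < t -> `|derive1n i f t| <= gH eps i.
  move=> i0 t0.
  have key : ctilde * (ctilde / eps) ^+ i * i%:R ^+ i * l i ^+ i <= gH eps i.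
    case: i i0 => // i _; rewrite /gH -!mulrA -!exprMn ler_wpM2l ?(ltW ct0) //.
    rewrite lerXn2r ?nnegrE ?mulr_ge0 ?(le_trans ler01 (l1 _)) ?invr_ge0 ?(ltW ct0) ?(ltW e0) //.
    rewrite /gbeta !mulrA ler_wpM2r ?(le_trans ler01 (l1 _)) // ler_wpM2r // ler_wpM2r ?invr_ge0 ?(ltW e0) //.
    by rewrite /A ler_peMl ?(ltW ct0) // ler1n.
  apply: le_trans key; have [i2|i2] := leqP i 2.
    apply: le_trans (gr.1 i _ t t0) _; first by rewrite i0.
    rewrite ler_peMr ?exprn_ege1 // mulr_ge0 ?exprn_ge0 // mulr_ge0 ?exprn_ge0 ?divr_ge0 ?(ltW ct0) ?(ltW e0) //.
  apply: le_trans (gr.2 i i2 t t0) _.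
  rewrite ler_wpM2l //.
    by rewrite mulr_ge0 ?exprn_ge0 // mulr_ge0 ?exprn_ge0 ?divr_ge0 ?(ltW ct0) ?(ltW e0).
  rewrite mulrC powRrM powR_mulrn ?powR_ge0 // lerXn2r ?nnegrE ?powR_ge0 // ?(le_trans ler01 (l1 _)) //.
  apply: ge0_ler_powR; rewrite ?nnegrE ?le_max ?ler01 ?lexx ?orbT //.
  by rewrite ln_ge0 // ler1n.
have g0b t : 0 <= t -> `|derive1n 0 f t| <= gH eps 0%N.
  apply: (@sup_of_derivative f (derive1n 1 f) _ c1) => //.
    by move=> s s0; exact: (jf 0%N s s0).
  by move=> s s0; have := gb 1%N s isT s0; rewrite /gH expr1.
have := hc P (fun k => derive1n k f) n c1 x z hP jf gb f0 f2 g0b n0 hx hz.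
rewrite /y -/(L _); set u := n%:R * rho x z.
by have -> : gam * eps * u / L u / 2 = gam / 2 * eps * u / L u by ring.
Qed.

End GrowthDecay.

(** * Cutoff functions with prescribed derivative bounds *)

Section Averaging.
Variable R : realType.
Implicit Types (f g : R -> R) (s t e : R).
Local Notation mu := (@lebesgue_measure R).

Definition antid f t : R := Rintegral mu [set` Interval (BRight 0) (BRight t)] f.
Definition avg e f t : R := (antid f (t + e) - antid f t) / e.

(** A class closed under averaging and under the limits taken below; 2 is the slope of the initial
    ramp, and the Lipschitz bound makes the convergence of iterated means quantitative. *)
Definition tame f := [/\ forall t, 0 < t -> 0 <= f t <= 1,
  forall s t, 0 < s -> s <= t -> f t <= f s &
  forall s t, 0 < s -> s <= t -> f s - f t <= 2 * (t - s)].

Lemma tame_continuous f t : tame f -> 0 < t -> {for t, continuous f}.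
Proof.
move=> [_ h1 h2] t0; apply/cvgrPdist_le => /= e e0.
near=> s.
have s0 : 0 < s by near: s; exact: lt_nbhsr.
have st : `|t - s| <= e / 2.
  near: s; apply/nbhs_ballP; exists (e / 2); first by rewrite /= divr_gt0.
  by move=> s /=; exact: ltW.
have [ts|ts] := leP t s.
  rewrite ger0_norm ?subr_ge0 ?h1 //; apply: le_trans (h2 t s t0 ts) _.
  move: st; rewrite distrC ger0_norm ?subr_ge0 //; lra.
rewrite distrC ger0_norm ?subr_ge0 ?h1 // ?(ltW ts) //; apply: le_trans (h2 s t s0 (ltW ts)) _.
by move: st; rewrite ger0_norm ?subr_ge0 ?(ltW ts) //; lra.
Unshelve. all: by end_near. Qed.

Lemma is_derive_antid f t : tame f -> 0 < t -> is_derive t 1 (antid f) (f t).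
Proof.
move=> tf t0.
have tt : t < t + 1 by rewrite ltrDl.
have int : mu.-integrable [set` Interval (BRight 0) (BRight (t + 1))] (EFin \o f).
  apply: measurable_bounded_integrable => //.
  - have fin : (lebesgue_measure (`]0%R, (t + 1)%R]%classic : set R) < +oo)%E.
      by rewrite lebesgue_measure_itv /=; case: ifP => _; rewrite ltry.
    exact: fin.
  - apply: (@measurable_funS _ _ _ _ `]0, t + 2[%classic) => //.
      move=> x /=; rewrite !in_itv /= => /andP[-> h] /=; move: h; lra.
    by apply: (@ocont_meas R (t + 2)) => x /andP[x0 _]; exact: tame_continuous.
  - exists 1; split=> // M M1 x /=; rewrite in_itv /= => /andP[x0 _].
    have [h _ _] := tf; have /andP[f0 f1] := h x x0.
    by rewrite ger0_norm // (le_trans f1) // ltW.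
have [d1 d2] := continuous_FTC1 tt int (t0 : (BRight 0 < BRight t)%O) (tame_continuous tf t0).
by apply: DeriveDef => //; rewrite -derive1E.
Qed.

Lemma is_derive_avg e f t : tame f -> 0 < e -> 0 < t ->
  is_derive t 1 (avg e f) ((f (t + e) - f t) / e).
Proof.
move=> tf e0 t0.
have h1 := is_derive_antid tf t0.
have te : 0 < t + e by rewrite addr_gt0.
have h2 := is_derive_shift (is_derive_antid tf te).
have d := is_deriveZ e^-1 (is_deriveB h2 h1).
rewrite (_ : avg e f = e^-1 *: ((fun v => antid f (v + e)) - antid f)); last first.
  by apply/funext => v; rewrite /avg mulrC.
by apply: (is_derive_eq d); rewrite mulrC.
Qed.

(** The mean value theorem for the antiderivative of f - a g: a = 0 represents an average as a
    value, a = 1 compares two averages at a common point. *)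
Lemma MVT_avg e f g t a : tame f -> tame g -> 0 < e -> 0 < t ->
  exists2 c, t < c < t + e & avg e f t - a * avg e g t = f c - a * g c.
Proof.
move=> tf tg e0 t0.
pose phi := antid f - a *: antid g.
have d (c : R) : 0 < c -> is_derive c 1 phi (f c - a * g c).
  move=> c0; have h1 := is_derive_antid tf c0; have h2 := is_derive_antid tg c0.
  exact: (is_deriveB h1 (is_deriveZ a h2)).
have te : t < t + e by rewrite ltrDl.
have cont : {within `[t, t + e], continuous phi}.
  apply: continuous_in_subspaceT => v; rewrite inE /= in_itv /= => /andP[tv _].
  apply: differentiable_continuous; apply/derivable1_diffP.
  by have [] := d v (lt_le_trans t0 tv).
have [|c] := @MVT R phi (fun c => f c - a * g c) t (t + e) te _ cont.
  by move=> x; rewrite in_itv /= => /andP[tx _]; apply: d; exact: lt_trans tx.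
rewrite in_itv /= => tce E; exists c => //.
have e1 : e != 0 by rewrite gt_eqF.
apply: (mulIf e1); have -> : e = t + e - t by ring.
rewrite -E /phi !fctE /avg; have -> : t + e - t = e by ring.
rewrite mulrBl mulrA !divfK //.
by rewrite /GRing.scale /=; ring.
Qed.

Lemma avg_mean e f t : tame f -> 0 < e -> 0 < t ->
  exists2 c, t < c < t + e & avg e f t = f c.
Proof.
move=> tf e0 t0; have [c hc] := MVT_avg 0 tf tf e0 t0.
by rewrite !mul0r !subr0; exists c.
Qed.

Lemma tame_avg e f : tame f -> 0 < e -> tame (avg e f).
Proof.
move=> tf e0; have [h0 h1 h2] := tf.
have lip s t : 0 < s -> s < t -> 0 <= avg e f s - avg e f t <= 2 * (t - s).
  move=> s0 st.
  have cont : {within `[s, t], continuous (avg e f)}.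
    apply: continuous_in_subspaceT => v; rewrite inE /= in_itv /= => /andP[sv _].
    apply: differentiable_continuous; apply/derivable1_diffP.
    by have [] := is_derive_avg tf e0 (lt_le_trans s0 sv).
  have [|c] := @MVT R (avg e f) (fun c => (f (c + e) - f c) / e) s t st _ cont.
    by move=> x; rewrite in_itv /= => /andP[tx _]; apply: is_derive_avg => //; exact: lt_trans tx.
  rewrite in_itv /= => /andP[sc _] E; have c0 : 0 < c by apply: lt_trans sc.
  have ce : c <= c + e by rewrite lerDl ltW.
  rewrite -opprB E -mulNr -mulNr opprB; have ts : 0 <= t - s by rewrite subr_ge0 ltW.
  rewrite mulr_ge0 //=; last by rewrite divr_ge0 ?(ltW e0) // subr_ge0 h1.
  rewrite ler_wpM2r // ler_pdivrMr //.
  by apply: le_trans (h2 c (c + e) c0 ce) _; rewrite addrAC subrr add0r.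
split.
- by move=> t t0; have [c /andP[tc _] ->] := avg_mean tf e0 t0; apply: h0; exact: lt_trans tc.
- move=> s t s0; rewrite le_eqVlt => /orP[/eqP -> //|st].
  by have /andP[] := lip s t s0 st; rewrite subr_ge0.
- move=> s t s0; rewrite le_eqVlt => /orP[/eqP ->|st]; first by rewrite !subrr mulr0.
  by have /andP[] := lip s t s0 st.
Qed.

Lemma avg_le e f t : tame f -> 0 < e -> 0 < t -> avg e f t <= f t.
Proof.
move=> tf e0 t0; have [c /andP[tc _] ->] := avg_mean tf e0 t0.
by have [_ h1 _] := tf; apply: h1 => //; exact: ltW.
Qed.

Lemma avg_ge e f t : tame f -> 0 < e -> 0 < t -> f t - avg e f t <= 2 * e.
Proof.
move=> tf e0 t0; have [c /andP[tc ce] ->] := avg_mean tf e0 t0.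
have [_ _ h2] := tf; apply: le_trans (h2 t c t0 (ltW tc)) _; move: ce; lra.
Qed.

Lemma avg_sub_le e f g t B : tame f -> tame g -> 0 < e -> 0 < t ->
  (forall s, 0 < s -> f s - g s <= B) -> avg e f t - avg e g t <= B.
Proof.
move=> tf tg e0 t0 hB; have [c /andP[tc _]] := MVT_avg 1 tf tg e0 t0.
by rewrite !mul1r => ->; apply: hB; exact: lt_trans tc.
Qed.

End Averaging.

(** * Infinite iterated means of a ramp *)

Section SmoothStep.
Variable R : realType.
Variables (delta tau : nat -> R).
Hypothesis delta0 : forall j, 0 < delta j.
Hypothesis tau0 : forall j, 0 <= tau j.
Hypothesis dtau : forall j, delta j <= tau j - tau j.+1.
Hypothesis tau_half : tau 0%N <= 2^-1.
Implicit Types (s t : R) (k r m : nat).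

(** It falls from 1 at 3/2 to 0 at 2. Averages look to the right over windows of total length at
    most 1/2, so the zeros beyond 2 are kept and the value 1 survives on ]0, 1]. *)
Definition ramp t : R := Num.max 0 (Num.min 1 (4 - 2 * t)).

Lemma tame_ramp : tame ramp.
Proof.
rewrite /ramp; split.
- by move=> t _; rewrite le_max lexx /= ge_max ler01 ge_min lexx.
- by move=> s t _ st; rewrite /Num.max /Num.min; do !case: ifPn; rewrite -?leNgt; lra.
- by move=> s t _ st; rewrite /Num.max /Num.min; do !case: ifPn; rewrite -?leNgt; lra.
Qed.

Lemma ramp0 t : 2 <= t -> ramp t = 0.
Proof. by move=> t2; rewrite /ramp /Num.max /Num.min; do !case: ifPn; rewrite -?leNgt; lra. Qed.

Lemma ramp1 t : t <= 3 / 2 -> ramp t = 1.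
Proof. by move=> t2; rewrite /ramp /Num.max /Num.min; do !case: ifPn; rewrite -?leNgt; lra. Qed.

(* [psi k], the limit in r of [fam k r], is the mean of [psi k.+1] over windows of length
   [delta k]; so its derivative is a difference quotient of [psi k.+1], of size 1 / delta k. *)
Fixpoint fam k r : R -> R := if r is r'.+1 then avg (delta k) (fam k.+1 r') else ramp.

Lemma tame_fam k r : tame (fam k r).
Proof. by elim: r k => [|r IH] k /=; [exact: tame_ramp | exact: tame_avg]. Qed.

Lemma fam_dec k r t : 0 < t -> fam k r.+1 t <= fam k r t.
Proof.
elim: r k t => [|r IH] k t t0; first by apply: avg_le => //; exact: tame_ramp.
rewrite -subr_le0; apply: (@avg_sub_le _ _ (fam k.+1 r.+1) (fam k.+1 r)) => //; try exact: tame_fam.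
by move=> s s0; rewrite subr_le0; exact: IH.
Qed.

Lemma fam_gap k r t : 0 < t -> fam k r t - fam k r.+1 t <= 2 * delta (k + r).
Proof.
elim: r k t => [|r IH] k t t0; first by rewrite addn0; apply: avg_ge => //; exact: tame_ramp.
apply: (@avg_sub_le _ _ (fam k.+1 r) (fam k.+1 r.+1)) => //; try exact: tame_fam.
by move=> s s0; rewrite addnS -addSn; exact: IH.
Qed.

Lemma fam_cauchy k r m t : 0 < t -> fam k r t - fam k (r + m) t <= 2 * (tau (k + r) - tau (k + r + m)).
Proof.
move=> t0; elim: m => [|m IH]; first by rewrite !addn0 !subrr mulr0.
have := fam_gap k (r + m) t0; have := dtau (k + (r + m)); rewrite !addnS !addnA.
by move: IH; lra.
Qed.

Lemma fam0 k r t : 2 <= t -> fam k r t = 0.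
Proof.
elim: r k t => [|r IH] k t t2 /=; first exact: ramp0.
have t0 : 0 < t by apply: lt_le_trans t2.
have [c /andP[tc _] ->] := avg_mean (tame_fam k.+1 r) (delta0 k) t0.
by apply: IH; apply: le_trans t2 _; exact: ltW.
Qed.

Lemma fam1 k r t : 0 < t -> t <= 3 / 2 - (tau k - tau (k + r)) -> fam k r t = 1.
Proof.
elim: r k t => [|r IH] k t t0 /=; first by rewrite addn0 subrr subr0; exact: ramp1.
move=> ht; have [c /andP[tc ce] ->] := avg_mean (tame_fam k.+1 r) (delta0 k) t0.
apply: IH; first exact: lt_trans tc.
by move: ht ce (dtau k); rewrite addnS addSn; lra.
Qed.

Definition psi k t : R := limn (fun r => fam k r t).

Lemma fam_cvg k t : 0 < t -> fam k r t @[r --> \oo] --> psi k t.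
Proof.
move=> t0; apply: nonincreasing_is_cvgn.
  by apply/nonincreasing_seqP => r; exact: fam_dec.
exists 0 => _ [r _ <-]; have [h _ _] := tame_fam k r.
by have /andP[] := h t t0.
Qed.

Lemma psi_le k r t : 0 < t -> psi k t <= fam k r t.
Proof.
move=> t0; apply: (@nonincreasing_cvgn_ge _ (fun r => fam k r t)).
  by apply/nonincreasing_seqP => m; exact: fam_dec.
exact: fam_cvg t0.
Qed.

Lemma tau_dec : nonincreasing_seq tau.
Proof.
by apply/nonincreasing_seqP => j; rewrite -subr_ge0; apply: le_trans (dtau j); exact: ltW.
Qed.

Lemma tau_cvg : tau r @[r --> \oo] --> limn tau.
Proof.
by apply: nonincreasing_is_cvgn; [exact: tau_dec | exists 0 => _ [r _ <-]].
Qed.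

Lemma fam_sub_psi k r t : 0 < t -> fam k r t - psi k t <= 2 * (tau (k + r) - limn tau).
Proof.
move=> t0.
have h : fam k r t - 2 * (tau (k + r) - limn tau) <= psi k t.
  apply: limr_ge; first by apply: cvgP; exact: fam_cvg.
  near=> m; have rm : (r <= m)%N by near: m; exact: nbhs_infty_ge.
  have := fam_cauchy k r (m - r) t0; rewrite -addnA subnKC //.
  have := nonincreasing_cvgn_ge tau_dec (cvgP _ tau_cvg) (k + m); lra.
by move: h; lra.
Unshelve. all: by end_near. Qed.

Lemma tame_psi k : tame (psi k).
Proof.
split.
- move=> t t0; apply/andP; split.
    apply: limr_ge; first by apply: cvgP; exact: fam_cvg.
    by near=> m; have [h _ _] := tame_fam k m; have /andP[] := h t t0.
  by apply: le_trans (psi_le k 0 t0) _; have [h _ _] := tame_ramp; have /andP[] := h t t0.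
- move=> s t s0 st; have t0 : 0 < t by apply: lt_le_trans st.
  rewrite -subr_ge0; apply: (cvgr_to_ge (cvgB (@fam_cvg k _ s0) (@fam_cvg k _ t0))).
  by near=> m; rewrite !fctE subr_ge0; have [_ h _] := tame_fam k m; exact: h.
- move=> s t s0 st; have t0 : 0 < t by apply: lt_le_trans st.
  apply: (cvgr_to_le (cvgB (@fam_cvg k _ s0) (@fam_cvg k _ t0))).
  by near=> m; rewrite !fctE; have [_ _ h] := tame_fam k m; exact: h.
Unshelve. all: by end_near. Qed.

(** The convergence is uniform in t by [fam_sub_psi], and averaging preserves pointwise bounds, so
    the limit passes through the average. *)
Lemma psi_avg k t : 0 < t -> psi k t = avg (delta k) (psi k.+1) t.
Proof.
move=> t0.
suff h : fam k r.+1 t @[r --> \oo] --> avg (delta k) (psi k.+1) t.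
  apply: (cvg_unique _ _ h) => //; have := @fam_cvg k _ t0.
  by rewrite -(cvg_shiftS (fun r => fam k r t)).
have e0 : (2 * (tau (k.+1 + r) - limn tau)) @[r --> \oo] --> (0 : R).
  rewrite -(mulr0 2); apply: cvgM; first exact: cvg_cst.
  rewrite -(subrr (limn tau)); apply: cvgB; last exact: cvg_cst.
  rewrite (_ : (fun r => tau (k.+1 + r)%N) = fun r => tau (r + k.+1)%N); last first.
    by apply/funext => r; rewrite addnC.
  by have := tau_cvg; rewrite -(cvg_shiftn k.+1 tau).
apply/cvgrPdist_le => e ep; have /cvgrPdist_le/(_ e ep) := e0.
apply: filterS => r; rewrite sub0r normrN => he.
apply: le_trans he; rewrite distrC ger0_norm.
  apply: le_trans (ler_norm _); apply: avg_sub_le => //.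
    exact: tame_fam.
    exact: tame_psi.
  by move=> s s0; exact: fam_sub_psi.
rewrite subr_ge0 -subr_le0; apply: avg_sub_le => //.
  exact: tame_psi.
  exact: tame_fam.
by move=> s s0; rewrite subr_le0; exact: psi_le.
Qed.

Lemma psi0 k t : 2 <= t -> psi k t = 0.
Proof.
move=> t2; rewrite /psi; under eq_fun do rewrite fam0 //.
exact: lim_cst.
Qed.

Lemma psi1 t : 0 < t -> t <= 1 -> psi 0 t = 1.
Proof.
move=> t0 t1; rewrite /psi (_ : (fun r => fam 0 r t) = fun=> 1); first exact: lim_cst.
apply/funext => r; apply: fam1 => //; have := tau0 (0 + r); move: tau_half; lra.
Qed.

Definition dq (e : R) (f : R -> R) t := (f (t + e) - f t) / e.
(** Difference quotients with steps delta 0, ..., delta (k-1). Applied to [psi k] they give the k-th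
    derivative of [psi 0], since differentiation commutes with them and turns [psi k] into a
    quotient of [psi k.+1]. *)
Fixpoint dqs k (f : R -> R) : R -> R := if k is k'.+1 then dqs k' (dq (delta k') f) else f.

Lemma is_derive_dqs k (f g : R -> R) : (forall t : R, 0 < t -> is_derive t 1 f (g t)) ->
  forall t : R, 0 < t -> is_derive t 1 (dqs k f) (dqs k g t).
Proof.
elim: k f g => [//|k IH] f g h; apply: IH => t t0.
have te : 0 < t + delta k by rewrite addr_gt0.
have d := is_deriveZ (delta k)^-1 (is_deriveB (is_derive_shift (h _ te)) (h t t0)).
rewrite (_ : dq (delta k) f = (delta k)^-1 *: ((fun v => f (v + delta k)) - f)); last first.
  by apply/funext => v; rewrite /dq mulrC.
by apply: (is_derive_eq d); rewrite /dq mulrC.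
Qed.

Lemma dqs_bound k (f : R -> R) M : (forall t, 0 < t -> `|f t| <= M) ->
  forall t, 0 < t -> `|dqs k f t| <= M * \prod_(j < k) (2 / delta j).
Proof.
elim: k f M => [|k IH] f M h t t0; first by rewrite big_ord0 mulr1; exact: h.
rewrite big_ord_recr /= [_ * (2 / _)]mulrC mulrA; apply: IH => // s s0.
rewrite /dq normrM normfV (gtr0_norm (delta0 k)) mulrA ler_wpM2r ?invr_ge0 ?(ltW (delta0 k)) //.
have := h (s + delta k) (addr_gt0 s0 (delta0 k)); have := h s s0.
have := ler_normB (f (s + delta k)) (f s); lra.
Qed.

Definition psi_jet k : R -> R := dqs k (psi k).

Lemma jet_psi : jet psi_jet.
Proof.
move=> k u u0; apply: (@is_derive_dqs k (psi k) (dq (delta k) (psi k.+1)) _ u u0) => {u u0} t t0.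
apply: (@near_eq_is_derive _ _ _ (avg (delta k) (psi k.+1))).
  by near=> s; rewrite -psi_avg //; near: s; exact: lt_nbhsr.
exact: is_derive_avg (tame_psi _) (delta0 k) t0.
Unshelve. all: by end_near. Qed.

Lemma psi_jet_bound k t : 0 < t -> `|psi_jet k t| <= \prod_(j < k) (2 / delta j).
Proof.
move=> t0; rewrite -[X in _ <= X]mul1r; apply: dqs_bound => // s s0.
by have [h _ _] := tame_psi k; have /andP[p0 p1] := h s s0; rewrite ger0_norm.
Qed.

End SmoothStep.

(** * Derivatives of the sine of a function *)

Section SineJet.
Variable R : realType.
Implicit Types (chi : nat -> R -> R) (t th : R) (k j n m : nat).

(* [n] is recursion fuel: the value is the k-th derivative of sin(chi + th) whenever k <= n. *)
Fixpoint sin_rec chi n k th t : R :=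
  match n, k with
  | n'.+1, k'.+1 => \sum_(j < k) 'C(k', j)%:R * (chi j.+1 t * sin_rec chi n' (k' - j) (th + pi / 2) t)
  | _, _ => sin (chi 0%N t + th)
  end.

Definition sin_jet chi th k t := sin_rec chi k k th t.

Lemma sin_rec_fuel chi n m k th t : (k <= n)%N -> (k <= m)%N ->
  sin_rec chi n k th t = sin_rec chi m k th t.
Proof.
elim: n m k th => [|n IH] [|m] [|k] th //= kn km.
apply: eq_bigr => j _; rewrite (IH m) //; lia.
Qed.

Lemma sin_jetS chi th k t : sin_jet chi th k.+1 t =
  \sum_(j < k.+1) 'C(k, j)%:R * (chi j.+1 t * sin_jet chi (th + pi / 2) (k - j) t).
Proof.
by apply: eq_bigr => j _; congr (_ * (_ * _)); apply: sin_rec_fuel => //; exact: leq_subr.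
Qed.

Lemma pascal_sum (u : nat -> R) k :
  \sum_(j < k.+1) 'C(k, j)%:R * u j + \sum_(j < k.+1) 'C(k, j)%:R * u j.+1 =
  \sum_(j < k.+2) 'C(k.+1, j)%:R * u j.
Proof.
rewrite [RHS]big_ord_recl /= bin0 -(bin0 k).
under [X in _ = _ + X]eq_bigr do rewrite /bump /= add1n binS natrD mulrDl.
rewrite big_split /= addrA; congr (_ + _).
rewrite -(big_ord_recl k.+1 (fun j : 'I_k.+2 => 'C(k, j)%:R * u j)).
by rewrite [RHS]big_ord_recr /= bin_small // mul0r addr0.
Qed.

(** The derivative of sin (chi + th) is chi' sin (chi + th + pi/2), so Leibniz's rule stays within
    the family with a shifted phase, which is why the induction is over all th. Differentiating the
    recursion once more gives two sums that Pascal's rule merges. *)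
Lemma jet_sin chi th : jet chi -> jet (sin_jet chi th).
Proof.
move=> jc k t t0; elim/ltn_ind: k th => -[_|k IH] th.
  rewrite sin_jetS big_ord1 bin0 mul1r subnn /sin_jet /=.
  have d0 := jc 0%N t t0.
  have d1 : is_derive t 1 (fun s => chi 0%N s + th) (chi 1%N t).
    by rewrite -[chi 1%N t]addr0; apply: (is_deriveD d0 (is_derive_cst th t 1)).
  have := @is_derive1_comp R sin (fun s => chi 0%N s + th) t _ _ (is_derive_sin _) d1.
  rewrite addrA sinDpihalf mulrC; exact.
have E1 : sin_jet chi th k.+1 = \sum_(j < k.+1) ('C(k, j)%:R *: (chi j.+1 * sin_jet chi (th + pi / 2) (k - j))).
  apply/funext => s; rewrite sin_jetS fct_sumE; apply: eq_bigr => j _.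
  by rewrite !fctE.
rewrite E1.
have d (j : 'I_k.+1) : is_derive t 1 ('C(k, j)%:R *: (chi j.+1 * sin_jet chi (th + pi / 2) (k - j)))
    ('C(k, j)%:R * (chi j.+1 t * sin_jet chi (th + pi / 2) (k - j).+1 t + chi j.+2 t * sin_jet chi (th + pi / 2) (k - j) t)).
  have dj := IH (k - j)%N (leq_subr _ _) (th + pi / 2).
  apply: (is_derive_eq (is_deriveZ _ (is_deriveM (jc j.+1 t t0) dj))).
  by rewrite /GRing.scale /=; ring.
apply: (is_derive_eq (is_derive_sum d)).
rewrite sin_jetS; under eq_bigr do rewrite mulrDr.
rewrite big_split /= -(pascal_sum (fun j => chi j.+1 t * sin_jet chi (th + pi / 2) (k.+1 - j) t)).
by congr (_ + _); apply: eq_bigr => j _ /=; rewrite subSn // -ltnS.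
Qed.

(** The hypothesis on X makes the j-th Leibniz term at most 2^(k-j) X_(k+1), and these powers sum to
    less than 2^(k+1): composing with the sine costs only a geometric factor. *)
Lemma sin_jet_bound chi (X : nat -> R) th k t :
  (forall k j, (j <= k)%N -> 'C(k, j)%:R * (X j.+1 * X (k - j)%N) <= X k.+1) -> (forall j, 0 <= X j) -> 1 <= X 0%N ->
  (forall j, `|chi j.+1 t| <= X j.+1) -> `|sin_jet chi th k t| <= 2 ^+ k * X k.
Proof.
move=> hX X0 X1 hchi; elim/ltn_ind: k th => -[_|k IH] th.
  rewrite expr0 mul1r; apply: le_trans X1; rewrite ler_norml sin_geN1 sin_le1 //.
rewrite sin_jetS; apply: le_trans (ler_norm_sum _ _ _) _.
apply: (@le_trans _ _ (\sum_(j < k.+1) 2 ^+ (k - j) * X k.+1)).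
  apply: ler_sum => j _; rewrite !normrM normr_nat.
  have jk : (j <= k)%N by rewrite -ltnS.
  apply: (@le_trans _ _ ('C(k, j)%:R * (X j.+1 * (2 ^+ (k - j) * X (k - j)%N)))).
    by rewrite ler_wpM2l // ler_pM // IH // ltnS leq_subr.
  have -> : 'C(k, j)%:R * (X j.+1 * (2 ^+ (k - j) * X (k - j)%N)) =
      2 ^+ (k - j) * ('C(k, j)%:R * (X j.+1 * X (k - j)%N)) by ring.
  by rewrite ler_wpM2l ?exprn_ge0 // hX.
rewrite -mulr_suml ler_wpM2r //.
rewrite (reindex_inj rev_ord_inj) /=.
rewrite (eq_bigr (fun j : 'I_k.+1 => 2 ^+ j)); last first.
  by move=> j _; rewrite subSS subKn // -ltnS.
have -> : \sum_(j < k.+1) 2 ^+ j = 2 ^+ k.+1 - 1 :> R.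
  elim: (k.+1) => [|n IHn]; first by rewrite big_ord0 subrr.
  by rewrite big_ord_recr /= IHn [2 ^+ n.+1]exprS; ring.
by rewrite gerBl.
Qed.

End SineJet.

(** * Derivative bounds of the form k! q_0 ... q_(k-1) *)

Section FactorialProduct.
Variable R : realType.
Variable q : nat -> R.
Hypothesis q0 : forall j, 0 <= q j.
Hypothesis qm : forall i j, (i <= j)%N -> q i <= q j.

Definition fprodq k : R := k`!%:R * \prod_(j < k) q j.

Lemma fprodq_ge0 k : 0 <= fprodq k.
Proof. by rewrite mulr_ge0 // prodr_ge0. Qed.

Lemma prodq_mul a b : (\prod_(j < a) q j) * (\prod_(j < b) q j) <= \prod_(j < a + b) q j.
Proof.
elim: b => [|b IH]; first by rewrite big_ord0 mulr1 addn0.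
rewrite addnS !big_ord_recr /= mulrA ler_pM // ?mulr_ge0 ?prodr_ge0 //.
by apply: qm; exact: leq_addl.
Qed.

(** C(k, j) (j+1)! (k-j)! = (j+1) k! <= (k+1)!, and moving one block of the increasing q's to larger
    indices only increases the product. This is the condition on X in [sin_jet_bound]. *)
Lemma fprodq_bin k j : (j <= k)%N -> 'C(k, j)%:R * (fprodq j.+1 * fprodq (k - j)) <= fprodq k.+1.
Proof.
move=> jk; rewrite /fprodq; set P := \prod_(_ < j.+1) _; set Q := \prod_(_ < k - j) _.
have -> : 'C(k, j)%:R * (j.+1`!%:R * P * ((k - j)`!%:R * Q)) = 'C(k, j)%:R * (j.+1`!%:R * (k - j)`!%:R) * (P * Q) by ring.
apply: ler_pM; rewrite ?mulr_ge0 ?prodr_ge0 //.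
  rewrite -!natrM ler_nat !factS -(bin_fact jk).
  have -> : ('C(k, j) * (j.+1 * j`! * (k - j)`!) = j.+1 * ('C(k, j) * (j`! * (k - j)`!)))%N by ring.
  by rewrite leq_mul2r ltnS jk orbT.
by have := prodq_mul j.+1 (k - j); rewrite addSn subnKC.
Qed.

End FactorialProduct.

(** * Iterated logarithms and a convergent telescoping series *)

Section IteratedLog.
Variable R : realType.
Implicit Types (i j k : nat) (x u : R).

Lemma expi1_ge1 i : 1 <= expi1 R i.
Proof.
elim: i => [//|i IH]; rewrite /expi1 iterS -/(expi1 R i).
by apply: le_trans (expR_ge1Dx _); rewrite lerDl (le_trans ler01).
Qed.

Lemma expi1_mono i j : (i <= j)%N -> expi1 R i <= expi1 R j.
Proof.
elim: j => [|j IH]; first by rewrite leqn0 => /eqP ->.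
rewrite leq_eqVlt => /orP[/eqP -> //|/IH h]; apply: le_trans h _.
rewrite [in X in _ <= X]/expi1 iterS -/(expi1 R j).
by apply: le_trans (expR_ge1Dx _); rewrite lerDr.
Qed.

Lemma lni_ge1 i x : expi1 R i <= x -> 1 <= lni i x.
Proof.
elim: i x => [//|i IH] x hx; rewrite /lni iterSr -/(lni i (ln x)); apply: IH.
have x0 : 0 < x by apply: lt_le_trans hx; exact: expR_gt0.
by rewrite -[X in X <= _]expRK ler_ln ?posrE ?expR_gt0.
Qed.

Lemma lni_mono i x u : expi1 R i <= x -> x <= u -> lni i x <= lni i u.
Proof.
elim: i x u => [//|i IH] x u hx xu; rewrite /lni !iterSr; apply: IH.
  have x0 : 0 < x by apply: lt_le_trans hx; exact: expR_gt0.
  by rewrite -[X in X <= _]expRK ler_ln ?posrE ?expR_gt0.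
have x0 : 0 < x by apply: lt_le_trans hx; exact: expR_gt0.
by rewrite ler_ln ?posrE // (lt_le_trans x0).
Qed.

Lemma is_derive_lni i x : expi1 R i <= x ->
  is_derive x 1 (@lni R i) (\prod_(j < i) (lni j x)^-1).
Proof.
elim: i => [|i IH] hx; first by rewrite big_ord0; exact: is_derive_id.
have hi : expi1 R i <= x by apply: le_trans hx; exact: expi1_mono.
have l0 : 0 < lni i x by apply: lt_le_trans (lni_ge1 hi).
have d := @is_derive1_comp R (@ln R) (@lni R i) x _ _ (is_derive1_ln l0) (IH hi).
by apply: (is_derive_eq d); rewrite big_ord_recr /= mulrC.
Qed.

Variables (eps : R) (ell : nat).
Hypothesis eps01 : 0 < eps <= 1.

(** [logfactor] without its shifts, for x >= exp_(ell+1)(1). With the same argument in all factors,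
    1 / (x logprod x) has an explicit antiderivative. *)
Definition logprod x : R := (\prod_(1 <= i < ell.+1) lni i x) * (lni ell.+1 x) `^ (1 + eps).
Definition logtail x : R := (lni ell.+1 x) `^ (- eps).
Local Notation E := (expi1 R ell.+1).

Lemma lni_le i x : (i <= ell.+1)%N -> E <= x -> 1 <= lni i x.
Proof. by move=> il hx; apply: lni_ge1; apply: le_trans hx; exact: expi1_mono. Qed.

Lemma logprod_ge1 x : E <= x -> 1 <= logprod x.
Proof.
move=> hx; rewrite /logprod -[X in X <= _]mulr1; apply: ler_pM => //; last first.
  by apply: powR_ge1; rewrite ?lni_le // addr_ge0 //; case/andP: eps01 => /ltW.
rewrite big_seq; elim/big_rec: _ => [//|i a]; rewrite mem_index_iota => /andP[_ il] a1.
by rewrite -[X in X <= _]mulr1; apply: ler_pM => //; apply: lni_le => //; exact: ltnW.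
Qed.

Lemma logprod_mono x u : E <= x -> x <= u -> logprod x <= logprod u.
Proof.
move=> hx xu; have hu := le_trans hx xu; rewrite /logprod; apply: ler_pM => //.
- rewrite big_seq prodr_ge0 // => i; rewrite mem_index_iota => /andP[_ il].
  by rewrite (le_trans ler01) // lni_le // ltnW.
- exact: powR_ge0.
- rewrite big_seq [X in _ <= X]big_seq; apply: ler_prod => i; rewrite mem_index_iota => /andP[_ il].
  rewrite (le_trans ler01) ?lni_le ?(ltnW il) //=; apply: lni_mono => //.
  by apply: le_trans hx; apply: expi1_mono; exact: ltnW.
- have ep : 0 <= 1 + eps by rewrite addr_ge0 //; case/andP: eps01 => /ltW.
  have l0 v : E <= v -> 0 <= lni ell.+1 v by move=> hv; rewrite (le_trans ler01) // lni_le.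
  by apply: ge0_ler_powR; rewrite ?nnegrE ?l0 // lni_mono.
Qed.

Lemma lni_shift_ge1 i u : 0 <= u -> 1 <= lni i (expi1 R i + u).
Proof. by move=> u0; apply: lni_ge1; rewrite lerDl. Qed.

Lemma logfactor_ge1 u : 0 <= u -> 1 <= logfactor ell eps u.
Proof.
move=> u0; rewrite /logfactor -[X in X <= _]mulr1; apply: ler_pM => //; last first.
  by apply: powR_ge1; rewrite ?lni_shift_ge1 // addr_ge0 //; case/andP: eps01 => /ltW.
elim/big_rec: _ => [//|i a _ a1].
by rewrite -[X in X <= _]mulr1; apply: ler_pM => //; apply: lni_shift_ge1.
Qed.

Lemma logfactor_ge_ln u : (0 < ell)%N -> 0 <= u -> ln (expR 1 + u) <= logfactor ell eps u.
Proof.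
move=> l0 u0; rewrite /logfactor big_ltn // -mulrA.
have h1 : 0 <= ln (expR 1 + u) by have := lni_shift_ge1 1 u0 => /(le_trans ler01).
rewrite -[X in X <= _]mulr1; apply: ler_pM => //.
rewrite -[X in X <= _]mulr1; apply: ler_pM => //; last first.
  by apply: powR_ge1; rewrite ?lni_shift_ge1 // addr_ge0 //; case/andP: eps01 => /ltW.
elim/big_rec: _ => [//|i a _ a1].
by rewrite -[X in X <= _]mulr1; apply: ler_pM => //; apply: lni_shift_ge1.
Qed.

Lemma logprod_le_logfactor x u : E <= x -> x <= u -> logprod x <= logfactor ell eps u.
Proof.
move=> hx xu; have lu i : x <= expi1 R i + u.
  by apply: le_trans xu _; rewrite lerDr (le_trans ler01) // expi1_ge1.
have hi i : (i <= ell.+1)%N -> expi1 R i <= x.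
  by move=> il; apply: le_trans hx; exact: expi1_mono.
rewrite /logprod /logfactor; apply: ler_pM => //.
- rewrite big_seq prodr_ge0 // => i; rewrite mem_index_iota => /andP[_ il].
  by rewrite (le_trans ler01) // lni_le // ltnW.
- exact: powR_ge0.
- rewrite big_seq [X in _ <= X]big_seq; apply: ler_prod => i; rewrite mem_index_iota => /andP[_ il].
  by rewrite (le_trans ler01) ?lni_le ?(ltnW il) //=; apply: lni_mono => //; apply: hi; exact: ltnW.
- have ep : 0 <= 1 + eps by rewrite addr_ge0 //; case/andP: eps01 => /ltW.
  have l1 := lni_mono (hi _ (leqnn _)) (lu ell.+1).
  have l0 : 0 <= lni ell.+1 x by rewrite (le_trans ler01) // lni_le.
  by apply: ge0_ler_powR; rewrite ?nnegrE // (le_trans l0).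
Qed.

Lemma logtail01 x : E <= x -> 0 <= logtail x <= 1.
Proof.
move=> hx; rewrite /logtail; apply/andP; split; first exact: powR_ge0.
rewrite powRN invf_le1.
  by apply: powR_ge1; rewrite ?lni_le //; case/andP: eps01 => /ltW.
by rewrite powR_gt0 // (lt_le_trans ltr01) // lni_le.
Qed.

Lemma is_derive_logtail x : E <= x -> is_derive x 1 logtail (- (eps / (x * logprod x))).
Proof.
move=> hx; have l0 : 0 < lni ell.+1 x by rewrite (lt_le_trans ltr01) // lni_le.
have d := @is_derive1_comp R (@powR R ^~ (- eps)) (@lni R ell.+1) x _ _ (is_derive1_powR _ l0) (is_derive_lni hx).
apply: (is_derive_eq d); rewrite mulNr mulNr; congr (- _); rewrite -mulrA; congr (_ * _).
rewrite -opprD powRN addrC /logprod prodfV -invfM; congr (_^-1).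
rewrite mulrA mulrC; congr (_ * _).
by rewrite big_ord_recl /=; congr (_ * _); rewrite big_add1 big_mkord.
Qed.

(** The mean value theorem on [K m, K (m+1)], with the increasing denominator evaluated at the right
    end. The dilation by K keeps every argument in the range where all the iterated logarithms are
    at least 1. *)
Lemma logtail_telescope K m : (0 < m)%N -> E <= K%:R ->
  (m.+1%:R * logprod (K * m.+1)%:R)^-1 <= (logtail (K * m)%:R - logtail (K * m.+1)%:R) / eps.
Proof.
move=> m0 hK; have /andP[e0 _] := eps01.
have K0 : 0 < K%:R :> R by apply: lt_le_trans hK; apply: lt_le_trans (expi1_ge1 _).
have lt : (K * m)%:R < (K * m.+1)%:R :> R by rewrite !natrM ltr_pM2l // ltr_nat.
have Em : E <= (K * m)%:R by apply: le_trans hK _; rewrite ler_nat leq_pmulr.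
have cont : {within `[(K * m)%:R, (K * m.+1)%:R], continuous logtail}.
  apply: continuous_in_subspaceT => v; rewrite inE /= in_itv /= => /andP[tv _].
  apply: differentiable_continuous; apply/derivable1_diffP.
  by have [] := is_derive_logtail (le_trans Em tv).
have [|c] := @MVT R logtail (fun x => - (eps / (x * logprod x))) _ _ lt _ cont.
  by move=> x; rewrite in_itv /= => /andP[tx _]; apply: is_derive_logtail; apply: le_trans (ltW tx).
rewrite in_itv /= => /andP[c1 c2] EE; rewrite -opprB EE !mulNr opprK.
have Ec : E <= c by apply: le_trans (ltW c1).
have c0 : 0 < c by apply: lt_le_trans Ec; apply: lt_le_trans (expi1_ge1 _).
have pc : 0 < logprod c by apply: lt_le_trans (logprod_ge1 Ec).
have pm : logprod c <= logprod (K * m.+1)%:R by apply: logprod_mono => //; exact: ltW.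
rewrite -natrB ?leq_mul2l ?leqnSn ?orbT // -mulnBr subSnn muln1.
have -> : eps / (c * logprod c) * K%:R / eps = (c / K%:R * logprod c)^-1.
  by field; rewrite !gt_eqF.
have pm0 : 0 < logprod (K * m.+1)%:R by apply: lt_le_trans pm.
move: pc pm pm0; move: (logprod c) (logprod (K * m.+1)%:R) => p1 p2 p10 p12 p20.
rewrite lef_pV2 ?posrE ?mulr_gt0 ?invr_gt0 //.
apply: ler_pM => //; rewrite ?(ltW p10) // ?divr_ge0 ?(ltW c0) ?(ltW K0) //.
by rewrite ler_pdivrMr // -natrM mulnC; exact: ltW.
Qed.

End IteratedLog.

(** * The refined estimate *)

Section FprodqBounds.
Variable R : realType.
Implicit Types (q : nat -> R).

Lemma fprodqS q k : fprodq q k.+1 = k.+1%:R * q k * fprodq q k.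
Proof. by rewrite /fprodq big_ord_recr /= factS natrM; ring. Qed.

Lemma fprodq_scale q (a : R) k : fprodq (fun j => a * q j) k = a ^+ k * fprodq q k.
Proof.
by elim: k => [|k IH]; [rewrite /fprodq !big_ord0 expr0 mul1r | rewrite !fprodqS IH exprS; ring].
Qed.

Lemma fprodq_le q k : (forall j, 0 <= q j) -> (forall i j, (i <= j)%N -> q i <= q j) ->
  fprodq q k.+1 <= (k.+1%:R * q k) ^+ k.+1.
Proof.
move=> q0 qm; elim: k => [|k IH]; first by rewrite fprodqS /fprodq big_ord0 expr1 fact0 !mulr1.
have a0 (j : nat) : 0 <= j.+1%:R * q j by rewrite mulr_ge0.
rewrite fprodqS exprS ler_wpM2l //; apply: le_trans IH _.
rewrite lerXn2r ?nnegrE //.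
by apply: ler_pM => //; [rewrite ler_nat | exact: qm].
Qed.

End FprodqBounds.

(** * The cutoff functions of the refined estimate and their decay *)

Section RefinedDecay.
Variable R : realType.
Variables (eps : R) (ell K : nat).
Hypothesis eps01 : 0 < eps <= 1.
Hypothesis ell0 : (0 < ell)%N.
Hypothesis hK : expi1 R ell.+1 <= K%:R.

(* The windows [dseq] have lengths of sum at most 1/2, by comparison with the telescoping [tseq]. *)
Definition qseq j : R := 8 / eps * logprod eps ell (K * j.+1)%:R.
Definition dseq j : R := 2 / (j.+1%:R * qseq j).
Definition tseq j : R := if j is j'.+1 then logtail eps ell (K * j)%:R / 4 else 2^-1.
(** 16 = 2 * 8: the composition with the sine costs 2^k, its inner function 8^k. *)
Definition Hseq : nat -> R := fprodq (fun j => 16 * qseq j).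

Let e0 : 0 < eps. Proof. by case/andP: eps01. Qed.

Lemma hKm j : (0 < j)%N -> expi1 R ell.+1 <= (K * j)%:R.
Proof. by move=> j0; apply: le_trans hK _; rewrite ler_nat leq_pmulr. Qed.

Lemma qseq_ge8 j : 8 <= qseq j.
Proof.
rewrite -[X in X <= _]mulr1; apply: ler_pM => //; last first.
  by have := @logprod_ge1 R eps ell eps01 _ (@hKm j.+1 isT).
by rewrite ler_pdivlMr // ler_piMr //; case/andP: eps01.
Qed.

Lemma qseq_mono i j : (i <= j)%N -> qseq i <= qseq j.
Proof.
move=> ij; rewrite /qseq ler_wpM2l ?divr_ge0 ?(ltW e0) //.
by apply: logprod_mono => //; [exact: hKm | rewrite ler_nat leq_mul2l ltnS ij orbT].
Qed.

Lemma dseq_gt0 j : 0 < dseq j.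
Proof. by rewrite divr_gt0 // mulr_gt0 // (lt_le_trans _ (qseq_ge8 j)). Qed.

Lemma tseq_ge0 j : 0 <= tseq j.
Proof. by case: j => [|j] /=; [rewrite invr_ge0 | rewrite divr_ge0 // powR_ge0]. Qed.

(** [dseq j] is eps / 4 over (j+1) [logprod] at K (j+1), so [logtail_telescope] applies for j > 0;
    for j = 0 both [dseq 0] and [tseq 1] are at most 1/4. *)
Lemma dseq_tseq j : dseq j <= tseq j - tseq j.+1.
Proof.
have -> : dseq j = eps / 4 * (j.+1%:R * logprod eps ell (K * j.+1)%:R)^-1.
  rewrite /dseq /qseq; field.
  have := logprod_ge1 eps01 (@hKm j.+1 isT) => /(lt_le_trans ltr01) /gt_eqF ->.
  by rewrite (gt_eqF e0) nat1r pnatr_eq0.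
case: j => [|j].
  rewrite mul1r muln1 /=; have /andP[t0 t1] := logtail01 eps01 (@hKm 1 isT).
  have p1 := logprod_ge1 eps01 (@hKm 1 isT); rewrite muln1 in t1 p1 t0 *.
  have : (logprod eps ell K%:R)^-1 <= 1 by rewrite invf_le1 // (lt_le_trans ltr01).
  have : 0 <= (logprod eps ell K%:R)^-1 by rewrite invr_ge0 (le_trans ler01).
  move: t1 eps01; move: (logtail _ _ _) (_^-1) => a b; nra.
have := @logtail_telescope R eps ell eps01 K j.+1 isT hK; rewrite ler_pdivlMr // => h.
rewrite /tseq -mulrBl mulrAC ler_pM2r // mulrC; exact: h.
Qed.

Lemma tseq_half : tseq 0 <= 2^-1. Proof. by []. Qed.

Lemma prod_dseq k : \prod_(j < k) (2 / dseq j) = fprodq qseq k.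
Proof.
elim: k => [|k IH]; first by rewrite /fprodq !big_ord0 mulr1.
rewrite big_ord_recr /= IH fprodqS mulrC; congr (_ * _); rewrite /dseq; field.
by rewrite nat1r pnatr_eq0 /= andbT gt_eqF // (lt_le_trans _ (qseq_ge8 k)).
Qed.

Lemma q16 j : 0 <= 16 * qseq j.
Proof. by rewrite mulr_ge0 // (le_trans _ (qseq_ge8 j)). Qed.

Lemma Hseq_ge0 k : 0 <= Hseq k.
Proof. by apply: fprodq_ge0; exact: q16. Qed.

Lemma Hseq_grow k : 8 * k.+1%:R * Hseq k <= Hseq k.+1.
Proof.
rewrite /Hseq fprodqS ler_wpM2r ?Hseq_ge0 // mulrC ler_wpM2l //.
by have := qseq_ge8 k; lra.
Qed.

(** 1 / gam = 18432 / eps and 18432 = 144 * 16 * 8: the 144 of [kernel_expdecay], the 16 of [Hseq]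
    and the 8 / eps of [qseq]. *)
Let gam : R := eps * (2 * 192^-1 ^+ 2).

Lemma refined_decay (d : nat) (kappa : 'I_d.+1 -> R) : (0 < d)%N -> (forall i, 0 <= kappa i) ->
  exists2 c, 0 < c & forall P (g : nat -> R -> R) n c0 (x z : 'I_d -> R),
  (forall j, is_Pn_kernel kappa j (P j)) ->
  jet g -> (forall i t, 0 < t -> `|g i t| <= Hseq i) ->
  (forall t, 0 <= t < 2^-1 -> g 0%N t = c0) -> (forall t, 2 < t -> g 0%N t = 0) ->
  (0 < n)%N -> in_simplex x -> in_simplex z ->
  `|Lkernel P (g 0%N) n x z| <=
    c * n%:R ^+ d / (Num.sqrt (Wk kappa n x) * Num.sqrt (Wk kappa n z)) *
    expR (- (192^-1 ^+ 2 * eps * (n%:R * rho x z) / logfactor ell eps (n%:R * rho x z))).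
Proof.
move=> d0 kappa0; have g0 : 0 < gam by rewrite !mulr_gt0 // exprn_gt0 // invr_gt0.
pose beta k : R := k%:R * (16 * (8 / eps * logprod eps ell (K * k)%:R)).
(* Comparing [logprod] at K k with [logfactor] at u requires K k <= u, which follows once
   [logfactor] is at least gam K. Otherwise u <= u0, because [logfactor] dominates ln (e + u), and
   subtracting gam u0 makes y(u) <= 0, so that no k > 0 is concerned. The shift is absorbed by the
   final constant. *)
pose u0 := expR (gam * K%:R).
pose y u := gam * (u / logfactor ell eps u) - gam * u0.
have u00 : 0 <= u0 by exact: expR_ge0.
have b0 k : 0 <= beta k.
  case: k => [|k]; first by rewrite /beta mul0r.
  by rewrite mulr_ge0 // q16.
have hH k : Hseq k <= 1 * beta k ^+ k.
  rewrite mul1r; case: k => [|k]; first by rewrite /Hseq /fprodq big_ord0 mulr1.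
  apply: fprodq_le; first exact: q16.
  by move=> i j ij; rewrite ler_wpM2l // qseq_mono.
have quo u : 0 <= u -> 0 <= u / logfactor ell eps u <= u.
  move=> uu; have l1 := logfactor_ge1 ell eps01 uu; have l0 := lt_le_trans ltr01 l1.
  by rewrite divr_ge0 ?(ltW l0) //= ler_pdivrMr // ler_peMr.
have yu u : 0 <= u -> y u <= gam * u - gam * u0.
  by move=> uu; rewrite lerD2r ler_wpM2l ?(ltW g0) //; case/andP: (quo u uu).
have ge1 : gam <= 16^-1.
  have h : 2 * 192^-1 ^+ 2 <= 16^-1 :> R by lra.
  by apply: le_trans h; rewrite /gam ler_piMl ?mulr_ge0 ?exprn_ge0 ?invr_ge0 //; case/andP: eps01.
have [||c c0 hc] := @kernel_expdecay R d kappa d0 kappa0 Hseq beta y 1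
   (fun k _ => Hseq_grow k) Hseq_ge0 ler01 b0 hH.
- move=> u uu; apply: le_trans (yu u uu) _.
  have : 0 <= gam * u0 by rewrite mulr_ge0 // ltW.
  have : gam * u <= 16^-1 * u by rewrite ler_wpM2r.
  lra.
- move=> u k uu k0 ky.
  have l1 := logfactor_ge1 ell eps01 uu; have l0 := lt_le_trans ltr01 l1.
  have kR : 0 < k%:R :> R by rewrite ltr0n.
  have [lK|lK] := ltP (logfactor ell eps u) (gam * K%:R).
    have lu := le_lt_trans (logfactor_ge_ln eps01 ell0 uu) lK.
    have e1 : 0 < expR 1 + u by rewrite ltr_wpDr // expR_gt0.
    have : u <= u0.
      rewrite /u0; apply: le_trans (_ : expR 1 + u <= _); first by rewrite lerDr expR_ge0.
      by rewrite -(lnK (e1 : expR 1 + u \is Num.pos)) ler_expR ltW.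
    have := yu u uu; move=> h1 h2; have : gam * u <= gam * u0 by rewrite ler_wpM2l // ltW.
    by move: ky; lra.
  have kq : k%:R <= gam * (u / logfactor ell eps u).
    by apply: le_trans ky _; rewrite gerBl mulr_ge0 // ltW.
  have kl : k%:R * logfactor ell eps u <= gam * u by move: kq; rewrite mulrA ler_pdivlMr.
  have Kk : (K * k)%:R <= u.
    rewrite natrM mulrC -(ler_pM2l g0); apply: le_trans kl.
    by rewrite mulrCA ler_wpM2l // ltW.
  have pl := logprod_le_logfactor eps01 (hKm k0) Kk.
  have -> : u = gam^-1 * (gam * u) by rewrite mulKf // gt_eqF.
  apply: (@le_trans _ _ (gam^-1 * (k%:R * logfactor ell eps u))); last first.
    by rewrite ler_wpM2l // invr_ge0 ltW.
  have -> : 144 * beta k = gam^-1 * (k%:R * logprod eps ell (K * k)%:R).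
    by rewrite /beta /gam; field; rewrite gt_eqF.
  by rewrite ler_wpM2l ?invr_ge0 ?(ltW g0) // ler_wpM2l.
exists (c * expR (gam * u0 / 2)); first by rewrite mulr_gt0 // expR_gt0.
move=> P g n c1 x z hP jg hg g1 g2 n0 hx hz.
have g3 t : 0 <= t -> `|g 0%N t| <= Hseq 0.
  rewrite le_eqVlt => /orP[/eqP <-|]; last exact: hg.
  have -> : g 0%N 0 = g 0%N 4^-1 by rewrite !g1 //; apply/andP; split; lra.
  by apply: hg; rewrite invr_gt0.
have := hc P g n c1 x z hP jg (fun i t _ => hg i t) g1 g2 g3 n0 hx hz.
rewrite /y; set u := n%:R * rho x z; set W := Num.sqrt _ * Num.sqrt _ => /le_trans; apply.
rewrite le_eqVlt; apply/orP; left; apply/eqP.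
have -> : - ((gam * (u / logfactor ell eps u) - gam * u0) / 2) =
  gam * u0 / 2 + - (192^-1 ^+ 2 * eps * u / logfactor ell eps u) by rewrite /gam; field; rewrite gt_eqF // (lt_le_trans ltr01) // logfactor_ge1 // mulr_ge0 // rho_ge0.
by rewrite expRD; ring.
Qed.

Let psij := psi_jet dseq.

(** The jets are controlled for t > 0 only, while admissibility also prescribes values at t = 0. *)
Definition extend0 (c : R) (g : nat -> R -> R) k t : R := if 0 < t then g k t else c.

Lemma jet_extend0 c g : jet g -> jet (extend0 c g).
Proof.
move=> jg k t t0; rewrite /extend0 t0.
apply: (@near_eq_is_derive _ _ _ (g k)); last exact: jg.
by near=> s; rewrite ifT //; near: s; exact: lt_nbhsr.
Unshelve. all: by end_near. Qed.

Lemma jet_psij : jet psij.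
Proof. exact: jet_psi dseq_gt0 tseq_ge0 dseq_tseq. Qed.

Lemma psij_bound k t : 0 < t -> `|psij k t| <= fprodq qseq k.
Proof. by move=> t0; rewrite -prod_dseq; exact: (psi_jet_bound dseq_gt0 k t0). Qed.

Lemma psij1 t : 0 < t -> t <= 1 -> psij 0 t = 1.
Proof. exact: (psi1 dseq_gt0 tseq_ge0 dseq_tseq tseq_half). Qed.

Lemma psij0 t : 2 <= t -> psij 0 t = 0.
Proof. exact: (psi0 dseq_gt0). Qed.

Definition chij k t : R := pi / 2 * (psij k t - 2 ^+ k * psij k (2 * t)).

Lemma jet_chij : jet chij.
Proof.
move=> k t t0; have t2 : 0 < 2 * t by rewrite mulr_gt0.
have d2 : is_derive t 1 (fun s : R => 2 * s) 2.
  by apply: (is_derive_eq (is_deriveZ 2 (is_derive_id t (1 : R)))); rewrite /GRing.scale /= mulr1.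
have d := @is_derive1_comp R (psij k) (fun s => 2 * s) t _ _ (jet_psij k t2) d2.
have := is_deriveZ (pi / 2) (is_deriveB (jet_psij k t0) (is_deriveZ (2 ^+ k) d)).
move=> dd; apply: (is_derive_eq dd).
by rewrite /chij /GRing.scale /= exprS; ring.
Qed.

(** From pi / 2 < 2 and 2 (1 + 2^m) <= 8^m for m >= 1, where 2^m comes from the dilation t -> 2t. *)
Lemma chij_bound k t : 0 < t -> `|chij k.+1 t| <= fprodq (fun j => 8 * qseq j) k.+1.
Proof.
move=> t0; have t2 : 0 < 2 * t by rewrite mulr_gt0.
rewrite fprodq_scale /chij normrM ger0_norm ?divr_ge0 ?pi_ge0 //.
have h1 := psij_bound k.+1 t0; have h2 := psij_bound k.+1 t2.
have F0 : 0 <= fprodq qseq k.+1 by apply: le_trans h1; exact: normr_ge0.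
have e1 : 1 <= 2 ^+ k.+1 :> R by rewrite exprn_ege1 // ler1n.
apply: (@le_trans _ _ (2 * ((1 + 2 ^+ k.+1) * fprodq qseq k.+1))).
  apply: ler_pM; rewrite ?divr_ge0 ?pi_ge0 ?(ltW (pihalf_lt2 _)) //.
  apply: le_trans (ler_normB _ _) _; rewrite [X in _ <= X]mulrDl mul1r; apply: lerD => //.
  by rewrite normrM ger0_norm ?exprn_ge0 // ler_wpM2l // exprn_ge0.
rewrite mulrA ler_wpM2r //.
have -> : 8 = 2 * 4 :> R by ring.
rewrite exprMn; have : 4 <= 4 ^+ k.+1 :> R by rewrite exprS ler_peMr // exprn_ege1 // ler1n.
by move: e1; move: (2 ^+ k.+1) (4 ^+ k.+1) => a b; nra.
Qed.

Definition cutoffC := sin_jet chij 0.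

Lemma cutoffC_bound k t : 0 < t -> `|cutoffC k t| <= Hseq k.
Proof.
move=> t0; have q8 j : 0 <= 8 * qseq j by rewrite mulr_ge0 // (le_trans _ (qseq_ge8 j)).
apply: le_trans (@sin_jet_bound R chij (fprodq (fun j => 8 * qseq j)) 0 k t _ _ _ _) _.
- by move=> i j; apply: fprodq_bin => // a b ab; rewrite ler_wpM2l // qseq_mono.
- exact: fprodq_ge0.
- by rewrite /fprodq big_ord0 mulr1.
- by move=> j; exact: chij_bound.
rewrite /Hseq !fprodq_scale mulrA -exprMn; have -> : 2 * 8 = 16 :> R by ring.
by [].
Qed.

Lemma cutoffA_bound k t : 0 < t -> `|psij k t| <= Hseq k.
Proof.
move=> t0; apply: le_trans (psij_bound k t0) _; rewrite /Hseq fprodq_scale ler_peMl ?exprn_ege1 ?ler1n //.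
by apply: fprodq_ge0 => j; rewrite (le_trans _ (qseq_ge8 j)).
Qed.

Lemma cutoffC_supp t : 0 < t -> (t < 2^-1) || (2 < t) -> cutoffC 0 t = 0.
Proof.
move=> t0 ht; rewrite /cutoffC /sin_jet /= /chij addr0 expr0 mul1r.
suff -> : psij 0 t = psij 0 (2 * t) by rewrite subrr mulr0 sin0.
case/orP: ht => ht; first by rewrite !psij1 //; move: t0 ht; lra.
by rewrite !psij0 //; move: ht; lra.
Qed.

(** On [1, 2], psi(2t) = 0 and psi(t/2) = 1, so the two values are the sine and the cosine of (pi/2)
    psi(t). *)
Lemma cutoffC_sqr t : 1 <= t <= 2 -> cutoffC 0 t ^+ 2 + cutoffC 0 (t / 2) ^+ 2 = 1.
Proof.
move=> /andP[t1 t2]; rewrite /cutoffC /sin_jet /= /chij !addr0 expr0 !mul1r.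
have -> : 2 * (t / 2) = t by field.
rewrite (@psij0 (2 * t)) ?(@psij1 (t / 2)); try by move: t1 t2; lra.
have -> : pi / 2 * (1 - psij 0 t) = - (pi / 2 * psij 0 t) + pi / 2 by ring.
by rewrite subr0 sinDpihalf cosN addrC cos2Dsin2.
Qed.

Lemma admissible_cutoff ty : exists (g : nat -> R -> R) c0, [/\ jet g, admissible ty (g 0%N),
  forall i t, 0 < t -> `|g i t| <= Hseq i, forall t, 0 <= t < 2^-1 -> g 0%N t = c0 &
  forall t, 2 < t -> g 0%N t = 0].
Proof.
have pos t : 2 < t -> 0 < t by move=> h; apply: lt_trans h.
case: ty.
- have j := jet_extend0 1 jet_psij; exists (extend0 1 psij), 1.
  have e1 t : 0 <= t <= 1 -> extend0 1 psij 0 t = 1.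
    by rewrite /extend0 => /andP[t0 t1]; case: ifP => // h; exact: psij1.
  have e2 t : 2 < t -> extend0 1 psij 0 t = 0.
    by move=> h; rewrite /extend0 pos //; apply: psij0; exact: ltW.
  split => //; first by split; [exact: jet_smooth | split].
  + by move=> i t t0; rewrite /extend0 t0; exact: cutoffA_bound.
  + by move=> t /andP[t0 t1]; apply: e1; rewrite t0 /=; move: t1; lra.
(* Type (b) prescribes smoothness and support only, so the zero function is a witness. *)
- have j : jet (fun _ _ => 0 : R) by move=> i t _; exact: is_derive_cst.
  exists (fun _ _ => 0), 0; split => //; first by split=> //; exact: jet_smooth j.
  by move=> i t _; rewrite normr0; exact: Hseq_ge0.
- have j := jet_extend0 0 (jet_sin 0 jet_chij); exists (extend0 0 cutoffC), 0.
  have e1 t : 0 <= t -> (t < 2^-1) || (2 < t) -> extend0 0 cutoffC 0 t = 0.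
    by rewrite /extend0 => t0; case: ifP => // h; exact: cutoffC_supp.
  split => //; first split; first exact: jet_smooth j.
  + split => // t /[dup] ht /andP[t1 t2]; rewrite /extend0 !ifT ?cutoffC_sqr //.
      by rewrite divr_gt0 // (lt_le_trans ltr01).
    by rewrite (lt_le_trans ltr01).
  + by move=> i t t0; rewrite /extend0 t0; exact: cutoffC_bound.
  + by move=> t /andP[t0 t1]; apply: e1 => //; rewrite t1.
  + by move=> t h; apply: e1; rewrite ?h ?orbT // ltW // pos.
Qed.

End RefinedDecay.

Theorem theorem7p2 (R : realType) (ctilde : R) (hct : 1 < ctilde) :
  exists cprime : R, 0 < cprime /\
  (* main estimate *)
  (forall (d : nat) (kappa : 'I_d.+1 -> R) (eps : R),
     (1 <= d)%N -> (forall i, 0 <= kappa i) -> 0 < eps <= 1 ->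
     exists c : R, 0 < c /\
     forall (ty : cutoff_type) (ahat : R -> R)
            (P : nat -> ('I_d -> R) -> ('I_d -> R) -> R),
       admissible ty ahat -> deriv_growth ctilde eps ahat ->
       (forall j, is_Pn_kernel kappa j (P j)) ->
       forall (n : nat) (x y : 'I_d -> R),
         (1 <= n)%N -> in_simplex x -> in_simplex y ->
         `| Lkernel P ahat n x y | <=
           c * n%:R ^+ d / (Num.sqrt (Wk kappa n x) * Num.sqrt (Wk kappa n y))
           * expR (- (cprime * eps * (n%:R * rho x y)
                      / (ln (expR 1 + n%:R * rho x y)) `^ (1 + eps)))) /\
  (* refined estimate with iterated logarithms *)
  (forall (eps : R) (ell : nat) (ty : cutoff_type),
     0 < eps <= 1 -> (1 < ell)%N ->
     exists ahat : R -> R, admissible ty ahat /\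
     forall (d : nat) (kappa : 'I_d.+1 -> R),
       (1 <= d)%N -> (forall i, 0 <= kappa i) ->
       exists c : R, 0 < c /\
       forall (P : nat -> ('I_d -> R) -> ('I_d -> R) -> R),
         (forall j, is_Pn_kernel kappa j (P j)) ->
         forall (n : nat) (x y : 'I_d -> R),
           (1 <= n)%N -> in_simplex x -> in_simplex y ->
           `| Lkernel P ahat n x y | <=
             c * n%:R ^+ d / (Num.sqrt (Wk kappa n x) * Num.sqrt (Wk kappa n y))
             * expR (- (cprime * eps * (n%:R * rho x y)
                        / logfactor ell eps (n%:R * rho x y)))).
Proof.
(* [c1] and [c2] are the constants of the exponents in [growth_decay] and [refined_decay]; both
   estimates are weakened to the minimum, which depends on [ctilde] alone. *)
pose c1 : R := (144 * (8 * ctilde))^-1 / 2; pose c2 : R := 192^-1 ^+ 2.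
have ct0 : 0 < ctilde by apply: lt_trans hct.
have c10 : 0 < c1 by rewrite divr_gt0 // invr_gt0 !mulr_gt0.
have c20 : 0 < c2 by rewrite exprn_gt0 // invr_gt0.
have weaken (c c' e v l A B : R) : 0 <= A -> c <= c' -> 0 <= e -> 0 <= v -> 0 <= l ->
    B <= A * expR (- (c' * e * v / l)) -> B <= A * expR (- (c * e * v / l)).
  move=> A0 cc e0 v0 l0 /le_trans; apply; rewrite ler_wpM2l // ler_expR lerN2.
  by rewrite ler_wpM2r ?invr_ge0 // ler_wpM2r // ler_wpM2r.
exists (Num.min c1 c2); split; first by rewrite lt_min c10.
split.
- move=> d kappa eps d0 kappa0 eps01; have [c c0 hc] := growth_decay hct d0 kappa0 eps01.
  exists c; split=> // ty f P ad gr hP n x y n0 hx hy.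
  apply: weaken (hc ty f P ad gr hP n x y n0 hx hy).
  + by rewrite divr_ge0 ?mulr_ge0 ?exprn_ge0 ?sqrtr_ge0 // ltW.
  + by rewrite ge_min lexx.
  + by case/andP: eps01 => /ltW.
  + by rewrite mulr_ge0 // rho_ge0.
  + exact: powR_ge0.
- move=> eps ell ty eps01 ell1; have ell0 : (0 < ell)%N by apply: ltn_trans ell1.
  (* This fixes K as an integer above exp_(ell+1)(1), so the cutoff depends on eps, ell and the type
     but is chosen before d and kappa. *)
  have hK := ltW (archi_boundP (le_trans ler01 (expi1_ge1 R ell.+1))).
  have [g [c1' [jg ad gb g1 g2]]] := admissible_cutoff eps01 hK ty.
  exists (g 0%N); split=> // d kappa d0 kappa0.
  have [c c0 hc] := refined_decay eps01 ell0 hK d0 kappa0.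
  exists c; split=> // P hP n x y n0 hx hy.
  apply: weaken (hc P g n c1' x y hP jg gb g1 g2 n0 hx hy).
  + by rewrite divr_ge0 ?mulr_ge0 ?exprn_ge0 ?sqrtr_ge0 // ltW.
  + by rewrite ge_min lexx orbT.
  + by case/andP: eps01 => /ltW.
  + by rewrite mulr_ge0 // rho_ge0.
  + by rewrite (le_trans ler01) // logfactor_ge1 // mulr_ge0 // rho_ge0.
Qed.
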